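(* For every $\delta>0$ there exists $T>0$ such that $$\inf\{I_T(\pi):\ \pi\in D([0,T],\mathcal{M}^0\setminus\mathbb{B}_\delta(\bar\rho))\}>0,$$ where $D([0,T],\mathcal{M}^0\setminus\mathbb{B}_\delta(\bar\rho))$ denotes the set of trajectories $\pi(t,du)=\rho(t,u)du$ in $D([0,T],\mathcal{M}^0)$ such that $\rho_t\notin\mathbb{B}_\delta(\bar\rho)$ for all $0\le t\le T$.
   Context: **Setting.** Fix an integer $d\ge1$ and a real $a>-\frac12$. Let $\mathbb{T}^{k}=[0,1)^k$ be the $k$-dimensional torus, $\Omega=(-1,1)\times\mathbb{T}^{d-1}$, $\overline\Omega=[-1,1]\times\mathbb{T}^{d-1}$, $\Gamma=\{-1,1\}\times\mathbb{T}^{d-1}$, $\Gamma^\pm=\{\pm1\}\times\mathbb{T}^{d-1}$, and fix $b:\Gamma\to(0,1)$ of class $C^2$. Set $\varphi(r)=r(1+ar)$ and $\sigma(r)=2r(1-r)(1+2ar)$ for $r\in[0,1]$. $dS$ is the surface element on $\Gamma$ and $\mathbf{n}=(\mathbf{n}_1,\dots,\mathbf{n}_d)$ the outward unit normal. $\mathcal{M}$ is the space of positive measures on $\Omega$ with total mass bounded by $2$, with the weak topology; $\mathcal{M}^0$ is the subset of measures $\rho(u)du$ in $\mathcal{M}$ with $0\le\rho\le1$ a.e. **Stationary profile.** $\bar\rho:\Omega\to[0,1]$ is the unique weak solution of $\Delta\varphi(\rho)=0$ on $\Omega$, $\rho=b$ on $\Gamma$, meaning: $\rho\in H^1(\Omega)$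 and, for all $G\in C^2(\overline\Omega)$ vanishing on $\Gamma$, $\int_\Omega\Delta G\,\varphi(\rho)\,du=\int_\Gamma\varphi(b)\,\mathbf{n}_1\,\partial_{u_1}G\,dS$. For $\delta>0$, $\mathbb{B}_\delta(\bar\rho)=\{\tilde\rho:\Omega\to[0,1]\text{ measurable}:\|\tilde\rho-\bar\rho\|_2<\delta\}$, with $\|\cdot\|_2$ the $L^2(\Omega)$ norm. **The functional $I_T$.** For $T>0$, $D([0,T],\mathcal{M})$ is the space of right continuous trajectories with left limits with the Skorohod topology, and $D([0,T],\mathcal{M}^0)$ its subset of $\mathcal{M}^0$-valued trajectories. Let $\Omega_T=(0,T)\times\Omega$, $\overline{\Omega_T}=[0,T]\times\overline\Omega$; $C_0^{1,2}(\overline{\Omega_T})$ is the set of real functions on $\overline{\Omega_T}$ with one continuous time derivative and two continuous space derivatives, vanishing on $[0,T]\times\Gamma$; $C_c^\infty(\Omega_T)$ is the set of smooth functions with compact support in $\Omega_T$. $\langle\vartheta,G\rangle=\int G\,d\vartheta$, and $\langle f,G\rangle=\int_\Omega fG\,du$ for functions $f$. Set $$\mathcal{Q}_T(\pi)=\sum_{i=1}^d\sup_{G\in C_c^\infty(\Omega_T)}\Big\{2\int_0^T\langle\pi_t,\partial_{u_i}G_t\rangle dt-\int_0^T\!\!\int_\Omega G(t,u)^2du\,dt\Big\}.$$ For $G\in C_0^{1,2}(\overline{\Omega_T})$ and $\pi\in D([0,T],\mathcal{M}^0)$, $\pi_t(du)=\rho_t(u)du$, $$J_G(\pi)=\langle\pi_T,G_T\rangle-\langle\pi_0,G_0\rangle-\int_0^T\langle\pi_t,\partial_tG_t\rangle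 dt-\int_0^T\langle\varphi(\rho_t),\Delta G_t\rangle dt+\int_0^T\!\!\int_{\Gamma^+}\varphi(b)\partial_{u_1}G\,dS\,dt-\int_0^T\!\!\int_{\Gamma^-}\varphi(b)\partial_{u_1}G\,dS\,dt-\frac12\int_0^T\langle\sigma(\rho_t),\|\nabla G_t\|^2\rangle dt,$$ and $J_G(\pi)=+\infty$ if $\pi\notin D([0,T],\mathcal{M}^0)$. Then $I_T(\pi)=\sup_{G\in C_0^{1,2}(\overline{\Omega_T})}J_G(\pi)$ if $\mathcal{Q}_T(\pi)<\infty$, and $I_T(\pi)=+\infty$ otherwise. *)

(* Defs.v *)
From HB Require Import structures.
From mathcomp Require Import all_boot all_order all_algebra.
From mathcomp Require Import all_classical all_reals all_analysis.

Set Implicit Arguments.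
Unset Strict Implicit.
Unset Printing Implicit Defensive.

Import Order.TTheory GRing.Theory Num.Theory.
Import numFieldNormedType.Exports.

Local Open Scope classical_set_scope.
Local Open Scope ring_scope.

(* The product sigma-algebra on 'rV[R]_n; over the reals it is the Borel
   sigma-algebra. *)
Definition row_display : measure_display. Proof. by constructor. Qed.

Section measurable_row.
Variables (R : realType) (n : nat).

Let coors : 'I_n -> 'rV[R]_n -> measurableTypeR R := fun i u => u 0 i.

Let row_set0 : g_sigma_preimage coors set0.
Proof. exact: sigma_algebra0. Qed.

Let row_setC A : g_sigma_preimage coors A -> g_sigma_preimage coors (~` A).
Proof. exact: sigma_algebraC. Qed.

Let row_bigcup (F : _^nat) : (forall i, g_sigma_preimage coors (F i)) ->
  g_sigma_preimage coors (\bigcup_i (F i)).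
Proof. exact: sigma_algebra_bigcup. Qed.

HB.instance Definition _ := @isMeasurable.Build row_display
  'rV[R]_n (g_sigma_preimage coors) row_set0 row_setC row_bigcup.

Lemma measurable_coord (i : 'I_n) :
  measurable_fun setT (fun u : 'rV[R]_n => u 0 i : measurableTypeR R).
Proof.
move=> _ Y mY; rewrite setTI; apply: sub_sigma_algebra => /=.
rewrite -bigcup_seq/=; exists i => /=; first by rewrite mem_index_enum.
by exists Y => //; rewrite setTI.
Qed.

Lemma measurable_fun_row d (T : measurableType d) (f : T -> 'rV[R]_n) :
  (forall i, measurable_fun setT (fun x => f x 0 i : measurableTypeR R)) ->
  measurable_fun setT f.
Proof.
move=> mf.
apply: (measurability (\big[setU/set0]_(i < n)
  preimage_set_system setT (coors i) measurable)) => //.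
move=> _ [/= A + <-]; rewrite -bigcup_seq => -[i _ [B mB <-]].
have := mf i measurableT B mB.
by rewrite !setTI.
Qed.

End measurable_row.

Section lebesgue_row.
Variable R : realType.

Definition consr n (p : R * 'rV[R]_n) : 'rV[R]_n.+1 :=
  row_mx (const_mx p.1 : 'rV[R]_1) p.2.

Lemma consr0 n (p : R * 'rV[R]_n) : consr p 0 ord0 = p.1.
Proof.
by rewrite mxE; case: splitP => //= j _; rewrite mxE.
Qed.

Lemma consrS n (p : R * 'rV[R]_n) (i : 'I_n) : consr p 0 (lift ord0 i) = p.2 0 i.
Proof.
rewrite mxE; case: splitP => [j|j] /=; rewrite /bump/= add1n.
  by case: j => -[].
by rewrite add1n => -[ij]; congr (p.2 0 _); exact/esym/val_inj.
Qed.

Lemma measurable_consr n : measurable_fun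
  [set: measurableTypeR R * 'rV[R]_n] (@consr n).
Proof.
apply: measurable_fun_row => i; case: (unliftP ord0 i) => [j|] ->.
  under eq_fun do rewrite consrS.
  exact: measurableT_comp (measurable_coord _) measurable_snd.
by under eq_fun do rewrite consr0; exact: measurable_fst.
Qed.

Definition unconsr n (u : 'rV[R]_n.+1) : measurableTypeR R * 'rV[R]_n :=
  (u 0 ord0, \row_i u 0 (lift ord0 i)).

Lemma consrK n : cancel (@consr n) (@unconsr n).
Proof.
move=> [x v]; rewrite /unconsr consr0; congr pair.
by apply/rowP => i; rewrite mxE consrS.
Qed.

Lemma unconsrK n : cancel (@unconsr n) (@consr n).
Proof.
move=> u; apply/rowP => i; case: (unliftP ord0 i) => [j|] ->.
  by rewrite consrS mxE.
by rewrite consr0.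
Qed.

Lemma measurable_unconsr n : measurable_fun setT (@unconsr n).
Proof.
apply: measurable_fun_pair; first exact: measurable_coord.
apply: measurable_fun_row => i; under eq_fun do rewrite mxE.
exact: measurable_coord.
Qed.

Section cons_measure.
Variables (n : nat) (mu : {sigma_finite_measure set 'rV[R]_n -> \bar R}).

Definition cons_measure : set 'rV[R]_n.+1 -> \bar R :=
  pushforward ((@lebesgue_measure R) \x mu)%E (@consr n).

Let cons_measure0 : cons_measure set0 = 0%E.
Proof. by rewrite /cons_measure /pushforward preimage_set0 measure0. Qed.

Let cons_measure_ge0 A : (0 <= cons_measure A)%E.
Proof. by rewrite /cons_measure /pushforward; exact: measure_ge0. Qed.

Let mconsr_preimage A : measurable A -> measurable (@consr n @^-1` A).
Proof. by move=> mA; rewrite -[X in measurable X]setTI; exact: measurable_consr. Qed.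

Let cons_measure_sigma_additive : semi_sigma_additive cons_measure.
Proof.
move=> F mF tF mUF; rewrite /cons_measure /pushforward preimage_bigcup.
apply: measure_semi_sigma_additive.
- by move=> i; exact: mconsr_preimage.
- apply/trivIsetP => /= i j _ _ ij; rewrite -preimage_setI.
  by move/trivIsetP : tF => /(_ _ _ _ _ ij) ->//; rewrite preimage_set0.
- by rewrite -preimage_bigcup; exact: mconsr_preimage.
Qed.

HB.instance Definition _ := isMeasure.Build _ _ _ cons_measure
  cons_measure0 cons_measure_ge0 cons_measure_sigma_additive.

Let cons_measure_sigma_finite : sigma_finite setT cons_measure.
Proof.
have /sigma_finiteP[F [TF ndF Foo]] := sigma_finiteT (@lebesgue_measure R).
have /sigma_finiteP[G [TG ndG Goo]] := sigma_finiteT mu.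
exists (fun i => @unconsr n @^-1` (F i `*` G i)).
  apply/esym; rewrite -subTset => u _.
  have [i _ Fi] : (\bigcup_i F i) (unconsr u).1 by rewrite -TF.
  have [j _ Gj] : (\bigcup_i G i) (unconsr u).2 by rewrite -TG.
  exists (maxn i j) => //; split.
  - by move: Fi; exact/subsetPset/ndF/leq_maxl.
  - by move: Gj; exact/subsetPset/ndG/leq_maxr.
move=> i; have [mFi Fioo] := Foo i; have [mGi Gioo] := Goo i; split.
  rewrite -[X in measurable X]setTI; apply: measurable_unconsr => //.
  exact: measurableX.
rewrite /cons_measure /pushforward -comp_preimage.
rewrite (_ : _ \o _ = id) ?preimage_id; last first.
  by apply/funext => p /=; rewrite consrK.
by rewrite product_measure1E// lte_mul_pinfty// ge0_fin_numE.
Qed.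

HB.instance Definition _ := Measure_isSigmaFinite.Build _ _ _ cons_measure
  cons_measure_sigma_finite.

End cons_measure.

(* Lebesgue measure on R^n; on R^0, the unit mass *)
Fixpoint leb n : {sigma_finite_measure set 'rV[R]_n -> \bar R} :=
  if n is n'.+1 then cons_measure (leb n') else \d_(0 : 'rV[R]_0).

Lemma leb_box n (l r : 'rV[R]_n) : (forall i, l 0 i <= r 0 i) ->
  leb n [set u | forall i, l 0 i <= u 0 i < r 0 i] =
  (\prod_i (r 0 i - l 0 i))%:E.
Proof.
elim: n l r => [|n IHn] l r lr.
  rewrite big_ord0 /= diracE mem_set//= => i; by case: i.
rewrite big_ord_recl /=; pose tl (u : 'rV[R]_n.+1) := (unconsr u).2.
have E : @consr n @^-1` [set u | forall i, l 0 i <= u 0 i < r 0 i] =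
    (`[l 0 ord0, r 0 ord0[%classic `*`
    [set v : 'rV[R]_n | forall i, tl l 0 i <= v 0 i < tl r 0 i] :
      set (measurableTypeR R * 'rV[R]_n)).
  apply/seteqP; split => [[x v] /= H|[x v] /= [Hx Hv] i].
    split; first by have := H ord0; rewrite consr0 in_itv.
    by move=> i; have := H (lift ord0 i); rewrite consrS !mxE.
  case: (unliftP ord0 i) => [j|] ->; last by move: Hx; rewrite consr0 in_itv.
  by have := Hv j; rewrite consrS !mxE.
rewrite /cons_measure /pushforward E product_measure1E//; last first.
  rewrite (_ : [set v | _] = \bigcap_(i in [set: 'I_n])
      ((fun v : 'rV[R]_n => v 0 i : measurableTypeR R) @^-1`
        `[tl l 0 i, tl r 0 i[%classic)); last first.
    apply/seteqP; split => [v /= H i _|v /= H i]; first by have := H i; rewrite /= in_itv.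
    by have := H i I; rewrite /= in_itv.
  apply: fin_bigcap_measurable => // i _.
  by rewrite -[X in measurable X]setTI; exact: measurable_coord.
rewrite IHn; last by move=> i; rewrite !mxE.
have lbE : lebesgue_measure (`[l 0 ord0, r 0 ord0[ : set R) =
    (r 0 ord0 - l 0 ord0)%:E.
  rewrite lebesgue_measure_itv /= lte_fin EFinB; have := lr ord0.
  by rewrite le_eqVlt => /predU1P[->|->//]; rewrite ltxx subee.
rewrite [X in (X * _)%E]lbE -EFinM; congr (_ * _)%:E.
by apply: eq_bigr => i _; rewrite !mxE.
Qed.

End lebesgue_row.

Section smooth_functions.
Variables (R : realType) (V : normedModType R).
Implicit Types (D F K : set V) (vs ps : set V) (f : V -> R).

(* Derivative of f at x along v relative to D: the increments are restricted
   to those that stay in D, so that it is the usual derivative at an interior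
   point of D and the one-sided derivative at the faces of a closed slab. *)
Definition dquot f (v x : V) (h : R) : R := h^-1 * (f (h *: v + x) - f x).

Definition dfilter D (v x : V) : set_system R :=
  within [set h | D (h *: v + x)] 0^'.

Definition derivable_on D v f x : Prop :=
  cvg (dquot f v x h @[h --> dfilter D v x]).

Definition der D v f x : R := lim (dquot f v x h @[h --> dfilter D v x]).

Lemma der_interior D v f x : D° x -> der D v f x = 'D_v (f : V -> R^o) x.
Proof.
move=> Dx; rewrite /der /derive /dfilter.
suff -> : within [set h : R | D (h *: v + x)] 0^' = 0^' by [].
have H : \forall h \near (0 : R)^', D (h *: v + x).
  apply: (@nbhs_dnbhs R).
  have : (fun h : R => h *: v + x) h @[h --> (0 : R)] --> x.
    rewrite -[X in _ --> X]add0r -(scale0r v).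
    apply: cvgD; last exact: cvg_cst.
    by apply: cvgZr_tmp; exact: cvg_id.
  by apply.
apply/seteqP; split => A; rewrite /within/=.
  by move=> HA; near=> h; apply: (near HA h) => //; near: h.
by move=> HA; near=> h => _; near: h.
Unshelve. all: by end_near.
Qed.

(* f has continuous iterated derivatives on D up to order k, along the
   directions in vs. *)
Fixpoint Ck D vs (k : nat) f : Prop :=
  {within D, continuous f} /\
  if k is k'.+1 then
    forall v, vs v -> (forall x, D x -> derivable_on D v f x) /\
                      Ck D vs k' (der D v f)
  else True.

Definition gradient_sq D d (e : 'I_d -> V) f x : R := \sum_i der D (e i) f x ^+ 2.

Definition laplacian D d (e : 'I_d -> V) f x : R :=
  \sum_i der D (e i) (der D (e i) f) x.

(* Functions on a space with torus factors are the functions on its universal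
   cover that are invariant under the unit translations ps of these factors. *)
Definition periodic ps f : Prop := forall v x, ps v -> f (x + v) = f x.

(* Smooth functions on the quotient of the open set D by the translations ps,
   with compact support; F is a fundamental domain of the quotient. *)
Definition Cc_infty D F vs ps : set (V -> R) :=
  [set f | [/\ periodic ps f, forall k, Ck D vs k f &
    exists K, [/\ compact K, K `<=` D & forall x, F x -> ~ K x -> f x = 0]]].

End smooth_functions.

Section domain.
Variables (R : realType) (n : nat).

(* The dimension d is n.+1, and the first coordinate u_1 has index ord0. *)
Local Notation Rd := 'rV[R]_n.+1.
Local Notation RxRd := (R^o * 'rV[R]_n.+1)%type.

Definition evec (i : 'I_n.+1) : Rd := delta_mx 0 i.
Definition torus_dirs : set Rd := [set evec i | i in [set i | i != ord0]].

(* Omega is (-1,1) x [0,1)^(d-1); the sets whose name ends in U are the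
   preimages in the universal cover R x R^(d-1). *)
Definition Omega : set Rd :=
  [set u | -1 < u 0 ord0 < 1 /\ forall i, i != ord0 -> 0 <= u 0 i < 1].
Definition OmegaU : set Rd := [set u | -1 < u 0 ord0 < 1].
Definition cOmegaU : set Rd := [set u | -1 <= u 0 ord0 <= 1].
Definition GammaU : set Rd := [set u | u 0 ord0 = -1 \/ u 0 ord0 = 1].

Definition time_vec : RxRd := (1, 0).
Definition space_vec (i : 'I_n.+1) : RxRd := (0, evec i).
Definition space_torus_dirs : set RxRd :=
  [set space_vec i | i in [set i | i != ord0]].

Definition Omega_T (T : R) : set RxRd := [set z | 0 < z.1 < T /\ Omega z.2].
Definition OmegaU_T (T : R) : set RxRd := [set z | 0 < z.1 < T /\ OmegaU z.2].
Definition cOmegaU_T (T : R) : set RxRd :=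
  [set z | 0 <= z.1 <= T /\ cOmegaU z.2].

Definition C2_0 : set (Rd -> R) :=
  [set G | [/\ periodic torus_dirs G, Ck cOmegaU (range evec) 2 G &
    forall u, GammaU u -> G u = 0]].

Definition C12_0 (T : R) : set (RxRd -> R) :=
  [set G | [/\ periodic space_torus_dirs G,
    Ck (cOmegaU_T T) [set time_vec] 1 G,
    Ck (cOmegaU_T T) (range space_vec) 2 G &
    forall t u, 0 <= t <= T -> GammaU u -> G (t, u) = 0]].

Definition Cc_infty_Omega : set (Rd -> R) :=
  Cc_infty OmegaU Omega (range evec) torus_dirs.

Definition Cc_infty_Omega_T (T : R) : set (RxRd -> R) :=
  Cc_infty (OmegaU_T T) (Omega_T T) (time_vec |` range space_vec)
    space_torus_dirs.

Definition Cb_Omega : set (Rd -> R) :=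
  [set f | [/\ periodic torus_dirs f, {within OmegaU, continuous f} &
    exists M, forall u, OmegaU u -> `|f u| <= M]].

Definition intO (f : Rd -> R) : R := \int[leb R n.+1]_(u in Omega) f u.

(* Integral of f dS over the face {s} x T^(d-1), where s is 1 or -1 *)
Definition int_face (s : R) (f : Rd -> R) : R :=
  \int[leb R n]_(v in [set v | forall i, 0 <= v 0 i < 1]) f (consr (s, v)).

Definition int_Gamma (f : Rd -> R) : R := int_face 1 f + int_face (-1) f.

Definition int_time (T : R) (f : R -> R) : R :=
  \int[lebesgue_measure]_(t in `]0, T[) f t.

Definition L2_norm (f : Rd -> R) : \bar R :=
  ('N[leb R n.+1]_2%:E [EFin \o (f \_ Omega)])%E.

Definition L2 : set (Rd -> R) :=
  [set f | measurable_fun Omega f /\ (L2_norm f < +oo)%E].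

Definition H1 : set (Rd -> R) :=
  [set f | L2 f /\ forall i, exists2 g, L2 g &
    forall G, Cc_infty_Omega G ->
      intO (fun u => f u * der OmegaU (evec i) G u) =
      - intO (fun u => g u * G u)].

End domain.

Section model.
Variables (R : realType) (n : nat).
Local Notation Rd := 'rV[R]_n.+1.
Local Notation RxRd := (R^o * 'rV[R]_n.+1)%type.
Local Notation measureRd := {measure set 'rV[R]_n.+1 -> \bar R}.
Variables (a : R) (b : Rd -> R).

Definition phi (r : R) : R := r * (1 + a * r).
Definition sigma (r : R) : R := 2 * r * (1 - r) * (1 + 2 * a * r).

(* b : Gamma -> (0,1) of class C^2; only derivatives tangent to Gamma occur *)
Definition boundary_density : Prop :=
  [/\ periodic (@torus_dirs R n) b, Ck (@GammaU R n) (@torus_dirs R n) 2 b &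
    forall u, GammaU u -> 0 < b u < 1].

(* On Gamma the first component of the outward unit normal is u_1 itself. *)
Definition normal1 (u : Rd) : R := u 0 ord0.

Definition stationary_profile (rho : Rd -> R) : Prop :=
  [/\ forall u, Omega u -> 0 <= rho u <= 1, H1 rho &
    forall G, C2_0 G ->
      intO (fun u => laplacian (@cOmegaU R n) (@evec R n) G u * phi (rho u)) =
      int_Gamma (fun u =>
        phi (b u) * normal1 u * der (@cOmegaU R n) (evec R ord0) G u)].

Definition L2_ball (rhobar : Rd -> R) (delta : R) : set (Rd -> R) :=
  [set rho : Rd -> R | [/\ measurable_fun (@Omega R n) rho,
    forall u, Omega u -> 0 <= rho u <= 1 &
    (L2_norm (rho \- rhobar)%R < delta%:E)%E]].

(* Measures on Omega are the measures on R^d carried by Omega. *)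
Definition measM : set measureRd :=
  [set mu | mu (~` @Omega R n) = 0%E /\ (mu setT <= 2%:E)%E].

Definition is_density (mu : measureRd) (rho : Rd -> R) : Prop :=
  [/\ measurable_fun (@Omega R n) rho,
    {ae leb R n.+1, forall u, Omega u -> 0 <= rho u <= 1} &
    forall A, measurable A ->
      mu A = (\int[leb R n.+1]_(u in A `&` @Omega R n) (rho u)%:E)%E].

Definition measM0 : set measureRd :=
  [set mu | measM mu /\ exists rho, is_density mu rho].

Definition density (mu : measureRd) : Rd -> R := xget (cst 0) (is_density mu).

Definition pairing (mu : measureRd) (G : Rd -> R) : R :=
  \int[mu]_(u in @Omega R n) G u.

(* pi s --> mu along F in the weak topology *)
Definition weak_cvg (F : set_system R) (pi : R -> measureRd) (mu : measureRd) :=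
  forall f, Cb_Omega f -> pairing (pi s) f @[s --> F] --> pairing mu f.

(* D([0,T], M) *)
Definition D_M (T : R) : set (R -> measureRd) :=
  [set pi | [/\ forall t, 0 <= t <= T -> measM (pi t),
    forall t, 0 <= t < T -> weak_cvg t^'+ pi (pi t) &
    forall t, 0 < t <= T -> exists2 mu, measM mu & weak_cvg t^'- pi mu]].

Definition D_M0 (T : R) : set (R -> measureRd) :=
  [set pi | D_M T pi /\ forall t, 0 <= t <= T -> measM0 (pi t)].

(* Trajectories avoiding the ball; densities are only defined almost
   everywhere, so no version of the density may be in the ball. *)
Definition D_avoid (T : R) (B : set (Rd -> R)) : set (R -> measureRd) :=
  [set pi | D_M0 T pi /\
    forall t, 0 <= t <= T -> forall rho, is_density (pi t) rho -> ~ B rho].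

Definition energy (T : R) (pi : R -> measureRd) : \bar R :=
  (\sum_(i < n.+1) ereal_sup
    [set (2 * int_time T (fun t => pairing (pi t)
                (fun u => der (@OmegaU_T R n T) (space_vec R i) G (t, u)))
          - int_time T (fun t => intO (fun u => G (t, u) ^+ 2)))%R%:E
     | G in @Cc_infty_Omega_T R n T])%E.

Definition J (T : R) (G : RxRd -> R) (pi : R -> measureRd) : \bar R :=
  let rho t := density (pi t) in
  let dG v := der (@cOmegaU_T R n T) v G in
  let lapG := laplacian (@cOmegaU_T R n T) (@space_vec R n) G in
  let gradG2 := gradient_sq (@cOmegaU_T R n T) (@space_vec R n) G in
  let face s := int_time T (fun t =>
    int_face s (fun u => phi (b u) * dG (space_vec R ord0) (t, u))) in
  if `[< D_M0 T pi >] then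
    (pairing (pi T) (fun u => G (T, u)) - pairing (pi 0) (fun u => G (0, u))
     - int_time T (fun t => pairing (pi t) (fun u => dG (time_vec R n) (t, u)))
     - int_time T (fun t => intO (fun u => phi (rho t u) * lapG (t, u)))
     + face 1 - face (-1)
     - 2^-1 * int_time T (fun t =>
         intO (fun u => sigma (rho t u) * gradG2 (t, u))))%:E
  else +oo%E.

Definition I_T (T : R) (pi : R -> measureRd) : \bar R :=
  if (energy T pi < +oo)%E then ereal_sup [set J T G pi | G in @C12_0 R n T]
  else +oo%E.

End model.

(* Main.v *)
Require Import Defs.
From mathcomp Require Import all_boot all_order all_algebra.
From mathcomp Require Import all_classical all_reals all_analysis.
From mathcomp Require Import measurable_realfun ring lra zify.

(** As the action is a supremum over test functions, a trajectory only needs one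
    test function with a large value of [J], by a bound that does not depend on
    the trajectory. Formally one takes
      G = lam chi^2 (- Laplacian)^-1 (rho - rhobar),   chi (t) = sin (pi t / T),
    which vanishes at the ends of [0, T] and on the boundary. The stationary
    equation of rhobar turns the boundary terms of [J] into the diffusion term of
    rhobar ([stationary_flux]), and the remaining terms are bounded as follows.
    - The diffusion yields lam times the integral of
      chi^2 <phi (rho) - phi (rhobar), rho - rhobar>, hence at least
      lam c0 X, where X is the integral in time of chi^2 |rho - rhobar|^2 and
      c0 > 0 a lower bound of the slope of phi: here a > -1/2 is used.
    - The time derivative is that of a norm of order -1 of rho - rhobar. After
      integration by parts it only falls on chi, where it is of order 1 / T, so
      this term is at most lam pi times the volume of the domain, for all T.
    - The mobility term is at most lam^2 L X / 2, where L bounds sigma.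
    Outside the ball X >= delta^2 T / 2. A small lam makes the mobility a fraction
    of the diffusion, and then a large T makes the diffusion beat the constant
    ([action_constants]).

    This G is not admissible: a trajectory is merely weakly right continuous in
    time, and its densities are merely bounded. It is replaced by a finite sum
    [spacetime_sum], whose spatial modes are the eigenfunctions of the Laplacian
    for Dirichlet conditions in the first coordinate and periodic conditions in the
    others, and whose coefficients [gcoef] contain the projection p of
    w = chi <rho - rhobar, e> to finitely many Fourier modes in time. Two facts
    make this work. The integral of w p' over [0, T] vanishes exactly
    ([int_mul_dtproj]), which spares any regularity in time. In the diffusion
    term, half of the coercivity absorbs the squared distance between
    chi (rho - rhobar) and its approximation ([flux_lower_bound]), and the
    integral of this distance is as small as desired ([excess_small]). The number
    of modes depends on the trajectory, but the bound that then follows from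
    [J_lower_bound] does not.

    The smallness rests on the completeness of both systems ([eigenfun_complete],
    [time_complete]). Call a bounded function a multiplier if its products with
    approximable functions are approximable. Product-to-sum formulas show that
    cosines and sines of the coordinates are multipliers; multipliers are an
    algebra closed under bounded limits, hence contain signs, hence the indicators
    of half spaces, hence all bounded measurable functions; and a positive mode
    carries this over to approximability ([approximable_bmeas]). *)

Set Implicit Arguments.
Unset Strict Implicit.
Unset Printing Implicit Defensive.

Import Order.TTheory GRing.Theory Num.Theory.
Import numFieldNormedType.Exports.
Local Open Scope classical_set_scope.
Local Open Scope ring_scope.

(** * Integration of bounded measurable functions *)

Section bounded_measurable.
Context d (X : measurableType d) (R : realType).
Variables (mu : {measure set X -> \bar R}) (D : set X).
Implicit Types f g : X -> R.

(** On a set of finite measure these functions are integrable and, unlike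
    integrable functions, they are stable under products. *)
Definition bmeas f : Prop :=
  measurable_fun D f /\ exists M, forall x, D x -> `|f x| <= M.

Lemma bmeas_cst c : bmeas (cst c).
Proof. by split => //; exists `|c|. Qed.

Lemma bmeas01 f : measurable_fun D f -> (forall x, D x -> 0 <= f x <= 1) -> bmeas f.
Proof.
move=> mf f01; split => //; exists 1 => x /f01/andP[f0 f1].
by rewrite ger0_norm.
Qed.

Lemma bmeasD f g : bmeas f -> bmeas g -> bmeas (fun x => f x + g x).
Proof.
move=> [mf [M fM]] [mg [N gN]]; split; first exact: measurable_funD.
exists (M + N) => x Dx; rewrite (le_trans (ler_normD _ _))// lerD//; [exact: fM|exact: gN].
Qed.

Lemma bmeasM f g : bmeas f -> bmeas g -> bmeas (fun x => f x * g x).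
Proof.
move=> [mf [M fM]] [mg [N gN]]; split; first exact: measurable_funM.
by exists (M * N) => x Dx; rewrite normrM ler_pM//; [exact: fM|exact: gN].
Qed.

Lemma bmeasZ c f : bmeas f -> bmeas (fun x => c * f x).
Proof. exact: bmeasM (bmeas_cst c). Qed.

Lemma bmeasN f : bmeas f -> bmeas (fun x => - f x).
Proof. by move=> /(bmeasZ (-1)); under eq_fun do rewrite mulN1r. Qed.

Lemma bmeasB f g : bmeas f -> bmeas g -> bmeas (fun x => f x - g x).
Proof. by move=> bf /bmeasN; exact: bmeasD. Qed.

Lemma bmeasX f n : bmeas f -> bmeas (fun x => f x ^+ n).
Proof.
move=> bf; elim: n => [|n IH]; first exact: (bmeas_cst 1).
by under eq_fun do rewrite exprS; exact: bmeasM.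
Qed.

Lemma bmeas_sum I (s : seq I) (F : I -> X -> R) :
  (forall i, bmeas (F i)) -> bmeas (fun x => \sum_(i <- s) F i x).
Proof.
move=> bF; elim: s => [|i s IH].
  by under eq_fun do rewrite big_nil; exact: (bmeas_cst 0).
by under eq_fun do rewrite big_cons; exact: bmeasD.
Qed.

Lemma bmeas_ext f g : (forall x, D x -> f x = g x) -> bmeas f -> bmeas g.
Proof.
move=> fg [mf [M fM]]; split.
  by apply: eq_measurable_fun mf => x /set_mem; exact: fg.
by exists M => x Dx; rewrite -fg// fM.
Qed.

Hypotheses (mD : measurable D) (muD : (mu D < +oo)%E).

Lemma bmeas_integrable f : bmeas f -> mu.-integrable D (EFin \o f).
Proof.
move=> [mf [M fM]]; apply: measurable_bounded_integrable => //.
exists M; split; first exact: num_real.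
by move=> x Mx y Dy; rewrite /= (le_trans (fM _ Dy))// ltW.
Qed.

Lemma intD f g : bmeas f -> bmeas g ->
  \int[mu]_(x in D) (f x + g x) = \int[mu]_(x in D) f x + \int[mu]_(x in D) g x.
Proof. by move=> bf bg; rewrite RintegralD//; exact: bmeas_integrable. Qed.

Lemma intB f g : bmeas f -> bmeas g ->
  \int[mu]_(x in D) (f x - g x) = \int[mu]_(x in D) f x - \int[mu]_(x in D) g x.
Proof. by move=> bf bg; rewrite RintegralB//; exact: bmeas_integrable. Qed.

Lemma intZ c f : bmeas f ->
  \int[mu]_(x in D) (c * f x) = c * \int[mu]_(x in D) f x.
Proof. by move=> bf; rewrite RintegralZl//; exact: bmeas_integrable. Qed.

Lemma int_sum I (s : seq I) (F : I -> X -> R) : (forall i, bmeas (F i)) ->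
  \int[mu]_(x in D) (\sum_(i <- s) F i x) = \sum_(i <- s) \int[mu]_(x in D) F i x.
Proof.
move=> bF; elim: s => [|i s IH].
  by rewrite big_nil; under eq_Rintegral do rewrite big_nil;
     rewrite Rintegral_cst// mul0r.
rewrite big_cons -IH -intD//; last exact: bmeas_sum.
by apply: eq_Rintegral => x _; rewrite big_cons.
Qed.

Lemma int_le f g : bmeas f -> bmeas g -> (forall x, D x -> f x <= g x) ->
  \int[mu]_(x in D) f x <= \int[mu]_(x in D) g x.
Proof. by move=> bf bg; apply: le_Rintegral => //; exact: bmeas_integrable. Qed.

Lemma int_ext f g : (forall x, D x -> f x = g x) ->
  \int[mu]_(x in D) f x = \int[mu]_(x in D) g x.
Proof. by move=> fg; apply: eq_Rintegral => x /set_mem; exact: fg. Qed.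

Lemma bounded_cvg_bmeas (h : nat -> X -> R) f M :
  (forall n, measurable_fun D (h n)) ->
  (forall n x, D x -> `|h n x| <= M) ->
  (forall x, D x -> h n x @[n --> \oo] --> f x) ->
  bmeas f /\ \int[mu]_(x in D) h n x @[n --> \oo] --> \int[mu]_(x in D) f x.
Proof.
move=> mh hM hf.
have fM x : D x -> `|f x| <= M.
  move=> Dx; have /cvg_norm hfx := hf x Dx.
  rewrite -(cvg_lim _ hfx)//; apply: limr_le; first by apply/cvg_ex; eexists; exact: hfx.
  by apply: nearW => n; exact: hM.
have mf : measurable_fun D f by apply: measurable_fun_cvg hf.
split; first by split => //; exists M.
have iM : mu.-integrable D (EFin \o cst M).
  exact: bmeas_integrable (bmeas_cst M).
have := @dominated_convergence _ _ _ mu D mD (fun n => EFin \o h n) (EFin \o f) (EFin \o cst M).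
case.
- by move=> n; apply/measurable_EFinP.
- exact/measurable_EFinP.
- by apply: aeW => x Dx /=; apply: cvg_EFin; [exact: nearW|exact: hf].
- exact: iM.
- by apply: aeW => x n Dx /=; rewrite lee_fin hM.
move=> _ _ H; apply: fine_cvg; rewrite fineK//.
by apply: integrable_fin_num => //; apply: bmeas_integrable; split => //; exists M.
Qed.

End bounded_measurable.

Section bounded_induction.
Context d (X : measurableType d) (R : realType) (D : set X).
Hypothesis mD : measurable D.
Variable P : (X -> R) -> Prop.
Hypothesis P_indic : forall E, measurable E -> P (\1_E).
Hypothesis P_comb : forall a f g, P f -> P g -> P (fun x => a * f x + g x).
Hypothesis P_lim : forall (h : nat -> X -> R) f M, (forall n, P (h n)) ->
  (forall n x, D x -> `|h n x| <= M) ->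
  (forall x, D x -> h n x @[n --> \oo] --> f x) -> P f.

Let P_cst c : P (cst c).
Proof.
have := P_comb c (P_indic measurableT) (P_indic measurable0).
by congr P; apply/funext => x; rewrite !indicE in_setT in_set0 mulr1 addr0.
Qed.

Let P_unit (q : X -> R) :
  measurable_fun D q -> (forall x, D x -> 0 <= q x <= 1) -> P q.
Proof.
move=> mq q01.
(* One binary digit per step: the next digit is 1 where the function is at
   least 1/2, and the step is repeated on the doubled remainder. *)
have S n (f : X -> R) : measurable_fun D f -> (forall x, D x -> 0 <= f x <= 1) ->
    exists2 g, P g & forall x, D x -> 0 <= f x - g x <= 2^-1 ^+ n.
  elim: n f => [|n IH] f mf f01.
    by exists (cst 0); [exact: P_cst|move=> x Dx; rewrite subr0 expr0 f01].
  pose E := D `&` [set x | 2^-1 <= f x].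
  have mE : measurable E.
    have := mf mD `[2^-1, +oo[%classic (measurable_itv _).
    congr measurable; apply/seteqP; split => x [Dx] /=; rewrite in_itv/= ?andbT//;
      by rewrite andbT.
  have [||g Pg Hg] := IH (fun x => 2 * f x - \1_E x).
  - apply: measurable_funB; first exact: measurable_funM.
    by apply: measurable_funTS; exact: measurable_indic.
  - move=> x Dx; have := f01 x Dx; rewrite indicE.
    have [h|h] := leP 2^-1 (f x).
      by rewrite mem_set//=; lra.
    by rewrite memNset/=; [lra|move=> [_ /=]; rewrite leNgt h].
  exists (fun x => 2^-1 * \1_E x + (2^-1 * g x + cst 0 x)).
    apply: P_comb; first exact: P_indic.
    by apply: P_comb; [exact: Pg|exact: P_cst].
  by move=> x Dx; have := Hg x Dx; rewrite exprS /cst; set a := 2^-1 ^+ n; lra.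
have H n := S n q mq q01.
pose g n := sval (cid2 (H n)).
have Pg n : P (g n) by rewrite /g; case: cid2.
have Hg n x : D x -> 0 <= q x - g n x <= 2^-1 ^+ n.
  by rewrite /g; case: cid2 => /= h _; exact.
apply: (@P_lim g _ 2).
- exact: Pg.
- move=> n x Dx; have := Hg n x Dx; have := q01 x Dx.
  have : 2^-1 ^+ n <= 1 :> R by rewrite exprn_ile1//; lra.
  by rewrite ler_norml; set a := _ ^+ n; lra.
- move=> x Dx; have H0 : q x - (2^-1 : R) ^+ n @[n --> \oo] --> q x.
    rewrite -[X in _ --> X]subr0; apply: cvgB; first exact: cvg_cst.
    by apply: cvg_expr; rewrite ger0_norm; lra.
  apply: squeeze_cvgr H0 (cvg_cst (q x)).
  by apply: nearW => n; have := Hg n x Dx; set a := _ ^+ n; lra.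
Qed.

(** A function with values in [0, 1] is the uniform limit of its binary
    expansions, which are combinations of indicators, and a bounded function is
    an affine image of such a function. *)
Lemma bmeas_ind p : bmeas D p -> P p.
Proof.
move=> [mp [M pM]].
have M0 : 0 < `|M| + 1 by rewrite ltr_wpDl.
pose q x := 2^-1 * ((`|M| + 1)^-1 * p x + 1).
have Pq : P q.
  apply: P_unit.
    apply: measurable_funM => //; apply: measurable_funD => //.
    exact: measurable_funM.
  move=> x Dx; rewrite /q.
  have : `|(`|M| + 1)^-1 * p x| <= 1.
    rewrite normrM normfV (gtr0_norm M0) ler_pdivrMl// mulr1.
    by rewrite (le_trans (pM _ Dx))// (le_trans (ler_norm _))// lerDl.
  by rewrite ler_norml; set a := _^-1 * _; lra.
have := P_comb (2 * (`|M| + 1)) Pq (P_cst (- (`|M| + 1))).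
congr P; apply/funext => x; rewrite /q /cst; field.
by rewrite gt_eqF.
Qed.

End bounded_induction.

(** * Orthonormal systems and mean-square approximation *)

(** The finite sets [K N] that exhaust the indices are part of the system, since
    completeness below is convergence of the partial sums along [K]. *)
Record orthonormal_system d (X : measurableType d) (R : realType)
    (mu : {measure set X -> \bar R}) (D : set X)
    (I : eqType) (e : I -> X -> R) (K : nat -> seq I) : Prop := OrthonormalSystem {
  ons_measurable : measurable D;
  ons_finite : (mu D < +oo)%E;
  ons_bmeas : forall i, bmeas D (e i);
  ons_orth : forall i j, \int[mu]_(x in D) (e i x * e j x) = (i == j)%:R;
  ons_uniq : forall N, uniq (K N);
  ons_exhaust : forall i, \forall N \near \oo, i \in K N }.

Section orthonormal.
Context d (X : measurableType d) (R : realType).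
Variables (mu : {measure set X -> \bar R}) (D : set X).
Variables (I : eqType) (e : I -> X -> R) (K : nat -> seq I).
Hypothesis ons : orthonormal_system mu D e K.

Let mD : measurable D. Proof. by case: ons. Qed.
Let muD : (mu D < +oo)%E. Proof. by case: ons. Qed.
Let be i : bmeas D (e i). Proof. by case: ons => _ _ /(_ i). Qed.
Let orth i j : \int[mu]_(x in D) (e i x * e j x) = (i == j)%:R.
Proof. by case: ons => _ _ _ /(_ i j). Qed.
Let Kuniq N : uniq (K N). Proof. by case: ons => _ _ _ _ /(_ N). Qed.
Let Kexh i : \forall N \near \oo, i \in K N.
Proof. by case: ons => _ _ _ _ _ /(_ i). Qed.

Definition coef (f : X -> R) (i : I) : R := \int[mu]_(x in D) (f x * e i x).
Definition proj (s : seq I) f x : R := \sum_(i <- s) coef f i * e i x.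
Definition resid (s : seq I) f : R := \int[mu]_(x in D) (f x - proj s f x) ^+ 2.

Lemma bmeas_comb (s : seq I) (c : I -> R) :
  bmeas D (fun x => \sum_(i <- s) c i * e i x).
Proof. by apply: bmeas_sum => i; exact: bmeasZ. Qed.

Lemma coefD f g i : bmeas D f -> bmeas D g ->
  coef (fun x => f x + g x) i = coef f i + coef g i.
Proof.
move=> bf bg; rewrite /coef -intD//; try exact: bmeasM.
by apply: int_ext => x _; rewrite mulrDl.
Qed.

Lemma coefZ c f i : bmeas D f -> coef (fun x => c * f x) i = c * coef f i.
Proof.
move=> bf; rewrite /coef -intZ//; last exact: bmeasM.
by apply: int_ext => x _; rewrite mulrA.
Qed.

Lemma coefB f g i : bmeas D f -> bmeas D g ->
  coef (fun x => f x - g x) i = coef f i - coef g i.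
Proof.
move=> bf bg; rewrite /coef -intB//; try exact: bmeasM.
by apply: int_ext => x _; rewrite mulrBl.
Qed.

Lemma int_comb_mul f (s : seq I) (c : I -> R) : bmeas D f ->
  \int[mu]_(x in D) (f x * \sum_(i <- s) c i * e i x) = \sum_(i <- s) c i * coef f i.
Proof.
move=> bf; under eq_Rintegral do rewrite mulr_sumr.
rewrite (int_sum mD muD); last by move=> i; apply: bmeasM => //; exact: bmeasZ.
apply: eq_bigr => i _; rewrite /coef -(intZ mD muD); last exact: bmeasM.
by apply: int_ext => x _; rewrite mulrCA.
Qed.

Lemma coef_comb (s : seq I) (c : I -> R) j : uniq s ->
  coef (fun x => \sum_(i <- s) c i * e i x) j = if j \in s then c j else 0.
Proof.
move=> us; rewrite /coef.
under eq_Rintegral do rewrite mulrC.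
rewrite int_comb_mul// (eq_bigr (fun i => if i == j then c i else 0)); last first.
  by move=> i _; rewrite /coef orth eq_sym; case: eqP => _; rewrite ?mulr1 ?mulr0.
rewrite -big_mkcond; case: ifPn => js; last first.
  by rewrite big_seq_cond big1// => i /andP[iS /eqP ij]; rewrite -ij iS in js.
rewrite -big_filter (_ : [seq i <- s | i == j] = [:: j]) ?big_seq1//.
by rewrite filter_pred1_uniq.
Qed.

Lemma int_comb_sq (s : seq I) (c : I -> R) : uniq s ->
  \int[mu]_(x in D) (\sum_(i <- s) c i * e i x) ^+ 2 = \sum_(i <- s) c i ^+ 2.
Proof.
move=> us; under eq_Rintegral do rewrite expr2.
rewrite int_comb_mul; last exact: bmeas_comb.
rewrite big_seq [RHS]big_seq; apply: eq_bigr => i iS.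
by rewrite coef_comb// iS expr2.
Qed.

(** Pythagoras: the squared distance to a combination is the squared distance to
    the span plus the squared error of the coefficients. *)
Lemma int_sub_comb_sq f (s : seq I) (c : I -> R) : bmeas D f -> uniq s ->
  \int[mu]_(x in D) (f x - \sum_(i <- s) c i * e i x) ^+ 2 =
  \int[mu]_(x in D) f x ^+ 2 - \sum_(i <- s) coef f i ^+ 2
  + \sum_(i <- s) (c i - coef f i) ^+ 2.
Proof.
move=> bf us; pose g x := \sum_(i <- s) c i * e i x.
have bg : bmeas D g by exact: bmeas_comb.
have -> : \int[mu]_(x in D) (f x - \sum_(i <- s) c i * e i x) ^+ 2 =
    \int[mu]_(x in D) (f x ^+ 2 + (-2 * (f x * g x) + g x ^+ 2)).
  by apply: int_ext => x _; rewrite -/(g x); ring.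
rewrite (intD mD muD); [|exact: bmeasX|
  by apply: bmeasD; [apply: bmeasZ; exact: bmeasM|exact: bmeasX]].
rewrite (intD mD muD); [|by apply: bmeasZ; exact: bmeasM|exact: bmeasX].
rewrite (intZ mD muD); last exact: bmeasM.
rewrite int_comb_mul// int_comb_sq//.
rewrite -[RHS]addrA; congr (_ + _); rewrite mulr_sumr -sumrN -!big_split /=.
by apply: eq_bigr => i _; ring.
Qed.

Lemma resid_ge0 s f : 0 <= resid s f.
Proof. by apply: Rintegral_ge0 => x _; exact: sqr_ge0. Qed.

Lemma residE s f : bmeas D f -> uniq s ->
  resid s f = \int[mu]_(x in D) f x ^+ 2 - \sum_(i <- s) coef f i ^+ 2.
Proof.
move=> bf us; rewrite /resid /proj int_sub_comb_sq//.
rewrite [X in _ + X](_ : _ = 0) ?addr0//.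
by apply: big1 => i _; rewrite subrr expr0n.
Qed.

Lemma bessel s f : bmeas D f -> uniq s ->
  \sum_(i <- s) coef f i ^+ 2 <= \int[mu]_(x in D) f x ^+ 2.
Proof. by move=> bf us; rewrite -subr_ge0 -residE// resid_ge0. Qed.

Lemma resid_le s f : bmeas D f -> uniq s ->
  resid s f <= \int[mu]_(x in D) f x ^+ 2.
Proof.
by move=> bf us; rewrite residE// gerBl; apply: sumr_ge0 => i _; exact: sqr_ge0.
Qed.

Lemma bmeas_proj s f : bmeas D (proj s f).
Proof. exact: bmeas_comb. Qed.

Lemma resid_comb s a f g : bmeas D f -> bmeas D g ->
  resid s (fun x => a * f x + g x) <= 2 * a ^+ 2 * resid s f + 2 * resid s g.
Proof.
move=> bf bg.
have bF := bmeasB bf (bmeas_proj s f); have bG := bmeasB bg (bmeas_proj s g).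
rewrite /resid -(intZ mD muD); last exact: bmeasX.
rewrite -(intZ mD muD); last exact: bmeasX.
rewrite -(intD mD muD); try by apply: bmeasZ; exact: bmeasX.
have -> : \int[mu]_(x in D) (a * f x + g x - proj s (fun x => a * f x + g x) x) ^+ 2 =
    \int[mu]_(x in D) (a * (f x - proj s f x) + (g x - proj s g x)) ^+ 2.
  apply: int_ext => x _; congr (_ ^+ 2).
  have -> : proj s (fun x => a * f x + g x) x = a * proj s f x + proj s g x.
    rewrite /proj mulr_sumr -big_split /=; apply: eq_bigr => i _.
    by rewrite coefD ?coefZ//; [rewrite mulrDl mulrA|exact: bmeasZ].
  by ring.
apply: (int_le mD muD).
- by apply: bmeasX; apply: bmeasD => //; exact: bmeasZ.
- by apply: bmeasD; apply: bmeasZ; exact: bmeasX.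
move=> x _; set u := f x - _; set v := g x - _.
by rewrite -subr_ge0 (_ : _ - _ = (a * u - v) ^+ 2) ?sqr_ge0//; ring.
Qed.

(** Boundedness is included because products and bounded limits of approximable
    functions have to be formed. *)
Definition approximable f : Prop :=
  bmeas D f /\ resid (K N) f @[N --> \oo] --> (0 : R).

Lemma approximableP f : bmeas D f ->
  (forall eps, 0 < eps -> \forall N \near \oo, resid (K N) f <= eps) ->
  approximable f.
Proof.
move=> bf H; split => //; apply/cvgrPdist_le => eps eps0.
by near=> N; rewrite sub0r normrN ger0_norm ?resid_ge0//; near: N; exact: H.
Unshelve. all: by end_near. Qed.

Lemma approximable_near f eps : approximable f -> 0 < eps ->
  \forall N \near \oo, resid (K N) f <= eps.
Proof.
move=> [bf /cvgrPdist_le H] eps0; near=> N.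
have : `|0 - resid (K N) f| <= eps by near: N; exact: H.
by rewrite sub0r normrN ger0_norm ?resid_ge0.
Unshelve. all: by end_near. Qed.

Lemma approximable_comb a f g :
  approximable f -> approximable g -> approximable (fun x => a * f x + g x).
Proof.
move=> af ag; have [bf _] := af; have [bg _] := ag.
apply: approximableP; first by apply: bmeasD => //; exact: bmeasZ.
move=> eps eps0.
have A0 : 0 < 4 * (a ^+ 2 + 1) by rewrite mulr_gt0// ltr_wpDl// sqr_ge0.
have h1 : 0 < eps / (4 * (a ^+ 2 + 1)) by rewrite divr_gt0.
have h2 : 0 < eps / 4 by rewrite divr_gt0.
near=> N; apply: le_trans (resid_comb _ _ bf bg) _.
have rf : resid (K N) f <= eps / (4 * (a ^+ 2 + 1)).
  by near: N; exact: approximable_near.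
have rg : resid (K N) g <= eps / 4 by near: N; exact: approximable_near.
have : 2 * a ^+ 2 * resid (K N) f <= 2 * (a ^+ 2 + 1) * (eps / (4 * (a ^+ 2 + 1))).
  apply: ler_pM => //; first by rewrite mulr_ge0// sqr_ge0.
  - exact: resid_ge0.
  - by rewrite ler_pM2l// lerDl.
have -> : 2 * (a ^+ 2 + 1) * (eps / (4 * (a ^+ 2 + 1))) = eps / 2.
  by field; rewrite gt_eqF// ltr_wpDl// sqr_ge0.
move: rg; clear; move: (resid _ g) (_ * resid _ f) => u v; lra.
Unshelve. all: by end_near. Qed.

Lemma approximable_e i : approximable (e i).
Proof.
apply: approximableP => // eps eps0; near=> N.
have iN : i \in K N by near: N; exact: Kexh.
rewrite residE// (bigD1_seq i)//=.
rewrite [X in _ - (_ + X)]big1; last first.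
  by move=> j ji; rewrite /coef orth eq_sym (negbTE ji) expr0n.
under eq_Rintegral do rewrite expr2.
by rewrite /coef !orth eqxx expr1n addr0 subrr ltW.
Unshelve. all: by end_near. Qed.

Lemma approximable0 : approximable (fun=> 0).
Proof.
apply: approximableP; first exact: (bmeas_cst D 0).
move=> eps eps0; apply: nearW => N.
apply: (@le_trans _ _ (\int[mu]_(x in D) (cst (0 : R) x) ^+ 2)).
  by apply: resid_le => //; exact: bmeas_cst.
under eq_Rintegral do rewrite /= expr0n.
by rewrite Rintegral_cst// mul0r ltW.
Qed.

Lemma approximableD f g :
  approximable f -> approximable g -> approximable (fun x => f x + g x).
Proof.
move=> af ag; have := approximable_comb 1 af ag.
by under eq_fun do rewrite mul1r.
Qed.

Lemma approximableZ a f : approximable f -> approximable (fun x => a * f x).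
Proof.
move=> af; have := approximable_comb a af approximable0.
by under eq_fun do rewrite addr0.
Qed.

Lemma approximable_sum J (s : seq J) (F : J -> X -> R) :
  (forall j, approximable (F j)) -> approximable (fun x => \sum_(j <- s) F j x).
Proof.
move=> aF; elim: s => [|j s IH].
  by under eq_fun do rewrite big_nil; exact: approximable0.
have := approximableD (aF j) IH.
by congr approximable; apply/funext => x; rewrite big_cons.
Qed.

(** The residual does not increase the norm, so that close functions have close
    residuals, uniformly in the partial sum. *)
Lemma approximable_closed f : bmeas D f ->
  (forall eps, 0 < eps -> exists2 g, approximable g &
     \int[mu]_(x in D) (f x - g x) ^+ 2 <= eps) ->
  approximable f.
Proof.
move=> bf H; apply: approximableP => // eps eps0.
have e4 : 0 < eps / 4 by rewrite divr_gt0.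
have [g ag fg] := H _ e4; have [bg _] := ag.
near=> N.
have rg : resid (K N) g <= eps / 4 by near: N; exact: approximable_near.
have : resid (K N) f <= 2 * 1 ^+ 2 * resid (K N) g + 2 * resid (K N) (fun x => f x - g x).
  rewrite [X in X <= _](_ : _ = resid (K N) (fun x => 1 * g x + (f x - g x))).
    by apply: resid_comb => //; exact: bmeasB.
  by congr (resid _ _); apply/funext => x; rewrite mul1r addrC subrK.
have : resid (K N) (fun x => f x - g x) <= eps / 4.
  by apply: le_trans fg; apply: resid_le => //; exact: bmeasB.
move: rg; clear; move: (resid _ _) (resid _ _) (resid _ _) => u v w; lra.
Unshelve. all: by end_near. Qed.

Lemma approximable_ext f g : (forall x, D x -> f x = g x) ->
  approximable f -> approximable g.
Proof.
move=> fg af; have [bf _] := af.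
apply: approximable_closed; first exact: bmeas_ext bf.
move=> eps eps0; exists f => //.
rewrite (_ : \int[mu]_(x in D) _ = 0) ?ltW//.
rewrite -[RHS](@mul0r _ (fine (mu D))) -Rintegral_cst//.
by apply: int_ext => x Dx; rewrite fg// subrr expr0n.
Qed.

(** Bounded convergence turns pointwise convergence into convergence in mean
    square. *)
Lemma approximable_lim (h : nat -> X -> R) f M :
  (forall n, approximable (h n)) -> (forall n x, D x -> `|h n x| <= M) ->
  (forall x, D x -> h n x @[n --> \oo] --> f x) -> approximable f.
Proof.
move=> ah hM hf.
have mh n : measurable_fun D (h n) by case: (ah n) => -[].
have [bf _] := bounded_cvg_bmeas mD muD mh hM hf.
have bd n : bmeas D (fun x => (f x - h n x) ^+ 2).
  by apply: bmeasX; apply: bmeasB => //; case: (ah n).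
apply: approximable_closed => // eps eps0.
have [N fN] := bf.2.
have := @bounded_cvg_bmeas _ _ _ mu D mD muD (fun n x => (f x - h n x) ^+ 2)
  (fun=> 0) ((N + M) ^+ 2) (fun n => (bd n).1).
case.
- move=> n x Dx; rewrite ger0_norm ?sqr_ge0// -ler_sqrt ?sqr_ge0//.
    rewrite !sqrtr_sqr; apply: le_trans (ler_norm _); apply: le_trans (ler_normB _ _) _.
    by rewrite lerD ?fN ?hM.
- move=> x Dx; rewrite -[0](expr0n R 2) -(subrr (f x)).
  have H : f x - h n x @[n --> \oo] --> f x - f x.
    by apply: cvgB; [exact: cvg_cst|exact: hf].
  under eq_fun do rewrite expr2.
  by rewrite expr2; exact: cvgM.
move=> _; rewrite Rintegral_cst// mul0r => /cvgrPdist_le/(_ _ eps0).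
case=> n _ /(_ n (leqnn _)) /=; rewrite sub0r normrN => H.
exists (h n) => //; apply: le_trans H; exact: ler_norm.
Qed.

End orthonormal.

(** * Multipliers and completeness *)

Section newton_sign.
Variable R : realType.
Implicit Type z : R.

(** The Newton-Schulz step for the sign, a polynomial whose iterates tend to
    [Num.sg] on [-1, 1]. Through it an algebra of functions closed under bounded
    limits contains the indicators of the superlevel sets of its members. *)
Definition newton z : R := 2^-1 * z * (3 - z ^+ 2).

Lemma newtonN z : newton (- z) = - newton z.
Proof. by rewrite /newton sqrrN mulrN mulNr. Qed.

Lemma iter_newtonN n z : iter n newton (- z) = - iter n newton z.
Proof. by elim: n => //= n ->; rewrite newtonN. Qed.

(** The step squares the error: 1 - newton w = (1 - w)^2 (2 + w) / 2. The iterates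
    increase, so each step contracts the error by at least 1 - z / 2. *)
Lemma iter_newton_bound n z : 0 < z <= 1 ->
  z <= iter n newton z <= 1 /\ 1 - iter n newton z <= (1 - z / 2) ^+ n.
Proof.
move=> /andP[z0 z1]; elim: n => [|n [/andP[zw w1] IH]] /=.
  by rewrite expr0 lexx z1; split => //; rewrite lerBlDl lerDr ltW.
set w := iter n newton z in zw w1 IH *.
have w0 : 0 < w by exact: lt_le_trans zw.
have E : 1 - newton w = (1 - w) * ((1 - w) * (2 + w) / 2) by rewrite /newton; field.
have F : 0 <= (1 - w) * (2 + w) / 2 <= 1 - z / 2 by apply/andP; split; nra.
have /andP[F0 F1] := F.
have E0 : 0 <= 1 - newton w by rewrite E mulr_ge0// subr_ge0.
split; last by rewrite E exprSr ler_pM// subr_ge0.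
apply/andP; split; last by rewrite -subr_ge0.
have : 1 - newton w <= 1 - w.
  rewrite E ler_piMr ?subr_ge0//; apply: le_trans F1 _; lra.
by move: zw; clear; lra.
Qed.

Lemma iter_newton_norm n z : `|z| <= 1 -> `|iter n newton z| <= 1.
Proof.
have P y : 0 < y <= 1 -> `|iter n newton y| <= 1.
  move=> y01; have [/andP[yn n1] _] := iter_newton_bound n y01.
  by rewrite ger0_norm// (le_trans _ yn)//; case/andP: y01 => /ltW.
move=> z1; have [z0|z0|z0] := ltgtP z 0.
- by rewrite -[z]opprK iter_newtonN normrN P// oppr_gt0 z0 -ltr0_norm.
- by rewrite P// z0 -(gtr0_norm z0).
- rewrite z0 (_ : iter n newton 0 = 0) ?normr0//.
  by elim: n {P} => //= n ->; rewrite /newton mulr0 mul0r.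
Qed.

Lemma newton_cvg z : `|z| <= 1 -> iter n newton z @[n --> \oo] --> Num.sg z.
Proof.
have P y : 0 < y <= 1 -> iter n newton y @[n --> \oo] --> (1 : R).
  move=> y01; have /andP[y0 y1] := y01.
  apply: (@squeeze_cvgr _ _ _ _ (fun n => 1 - (1 - y / 2) ^+ n) (cst 1)).
  - apply: nearW => n; have [/andP[_ ->] H] := iter_newton_bound n y01.
    by rewrite andbT; lra.
  - rewrite -[X in _ --> X](subr0 1); apply: cvgB; first exact: cvg_cst.
    by apply: cvg_expr; rewrite ger0_norm; lra.
  - exact: cvg_cst.
move=> z1; have [z0|z0|z0] := ltgtP z 0.
- rewrite ltr0_sg// (_ : (fun n => _) = (fun n => - iter n newton (- z))); last first.
    by apply/funext => n; rewrite iter_newtonN opprK.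
  by apply: cvgN; apply: P; rewrite oppr_gt0 z0 -ltr0_norm.
- by rewrite gtr0_sg//; apply: P; rewrite z0 -(gtr0_norm z0).
- rewrite z0 sgr0 (_ : (fun n => _) = cst 0); first exact: cvg_cst.
  apply/funext; elim => //= n ->; by rewrite /newton mulr0 mul0r.
Qed.

End newton_sign.

Section multiplier.
Context d (X : measurableType d) (R : realType).
Variables (mu : {measure set X -> \bar R}) (D : set X).
Variables (I : eqType) (e : I -> X -> R) (K : nat -> seq I).
Hypothesis ons : orthonormal_system mu D e K.

Let mD : measurable D. Proof. by case: ons. Qed.
Let muD : (mu D < +oo)%E. Proof. by case: ons. Qed.

Local Notation apx := (approximable mu D e K).

(** Products of approximable functions are not visibly approximable. Multipliers
    are stable under products by definition, and they form an algebra closed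
    under bounded limits: measurable functions are shown to belong to it. *)
Definition multiplier (p : X -> R) : Prop :=
  bmeas D p /\ forall f, apx f -> apx (fun x => p x * f x).

Lemma multiplier_cst c : multiplier (cst c).
Proof. by split; [exact: bmeas_cst|move=> f af; exact: approximableZ]. Qed.

Lemma multiplierD p q : multiplier p -> multiplier q ->
  multiplier (fun x => p x + q x).
Proof.
move=> [bp ap] [bq aq]; split; first exact: bmeasD.
move=> f af; have := approximableD ons (ap _ af) (aq _ af).
by congr approximable; apply/funext => x; rewrite mulrDl.
Qed.

Lemma multiplierM p q : multiplier p -> multiplier q ->
  multiplier (fun x => p x * q x).
Proof.
move=> [bp ap] [bq aq]; split; first exact: bmeasM.
move=> f af; have := ap _ (aq _ af).
by congr approximable; apply/funext => x; rewrite mulrA.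
Qed.

Lemma multiplierZ c p : multiplier p -> multiplier (fun x => c * p x).
Proof. exact: multiplierM (multiplier_cst c). Qed.

Lemma multiplierN p : multiplier p -> multiplier (fun x => - p x).
Proof. by move=> /(multiplierZ (-1)); under eq_fun do rewrite mulN1r. Qed.

Lemma multiplierB p q : multiplier p -> multiplier q ->
  multiplier (fun x => p x - q x).
Proof. by move=> ap /multiplierN; exact: multiplierD. Qed.

Lemma multiplier_ext p q : (forall x, D x -> p x = q x) ->
  multiplier p -> multiplier q.
Proof.
move=> pq [bp ap]; split; first exact: bmeas_ext bp.
move=> f /ap; apply: approximable_ext => // x Dx.
by rewrite pq.
Qed.

Lemma multiplier_lim (h : nat -> X -> R) p M :
  (forall n, multiplier (h n)) -> (forall n x, D x -> `|h n x| <= M) ->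
  (forall x, D x -> h n x @[n --> \oo] --> p x) -> multiplier p.
Proof.
move=> ah hM hp; split.
  by have [|//] := bounded_cvg_bmeas mD muD _ hM hp => n; case: (ah n) => -[].
move=> f af; have [[mf [N fN]] _] := af.
apply: (approximable_lim ons (h := fun n x => h n x * f x) (M := M * N)).
- by move=> n; apply: (ah n).2.
- by move=> n x Dx; rewrite normrM ler_pM ?hM ?fN.
- by move=> x Dx; apply: cvgM; [exact: hp|exact: cvg_cst].
Qed.

(** As [p] is bounded, [p * f] is close in mean square to the product of [p] with
    a partial sum of [f]. *)
Lemma multiplier_gen p : bmeas D p ->
  (forall i, apx (fun x => p x * e i x)) -> multiplier p.
Proof.
move=> bp ap; split; first exact: bp.
move=> f af; have [bf _] := af; have [_ [M pM]] := bp.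
apply: (approximable_closed ons); first exact: bmeasM.
move=> eps eps0.
have c0 : 0 < eps / (M ^+ 2 + 1) by rewrite divr_gt0// ltr_wpDl// sqr_ge0.
have [N _ /(_ N (leqnn N)) /= HN] := approximable_near af c0.
exists (fun x => p x * proj mu D e (K N) f x).
  have := approximable_sum ons (K N)
    (fun i => approximableZ ons (coef mu D e f i) (ap i)).
  congr approximable; apply/funext => x; rewrite /proj mulr_sumr.
  by apply: eq_bigr => i _; rewrite mulrCA.
apply: (@le_trans _ _ ((M ^+ 2 + 1) * resid mu D e (K N) f)); last first.
  by rewrite mulrC -ler_pdivlMr// ltr_wpDl// sqr_ge0.
have bF := bmeasB bf (bmeas_proj ons (K N) f).
rewrite /resid -(intZ mD muD); last exact: bmeasX.
apply: (int_le mD muD).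
- by apply: bmeasX; apply: bmeasB; apply: bmeasM => //; exact: (bmeas_proj ons).
- by apply: bmeasZ; exact: bmeasX.
- move=> x Dx; rewrite -mulrBr exprMn ler_wpM2r ?sqr_ge0//.
  apply: (@le_trans _ _ (M ^+ 2)); last by rewrite lerDl.
  by rewrite -real_normK ?num_real// lerXn2r ?nnegrE// ?pM// (le_trans _ (pM _ Dx)).
Qed.

(** Rescaled to take its values in [-1, 1], a multiplier can be fed to the
    polynomials that tend to the sign. *)
Lemma multiplier_sg p : multiplier p -> multiplier (fun x => Num.sg (p x)).
Proof.
move=> ap; have [[_ [M pM]] _] := ap.
have M0 : 0 < `|M| + 1 by rewrite ltr_wpDl.
pose q x := (`|M| + 1)^-1 * p x.
have q1 x : D x -> `|q x| <= 1.
  move=> Dx; rewrite normrM normfV (gtr0_norm M0) ler_pdivrMl// mulr1.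
  by rewrite (le_trans (pM _ Dx))// (le_trans (ler_norm _))// lerDl.
apply: (@multiplier_lim (fun n x => iter n (@newton R) (q x)) _ 1).
- elim => [|n IH] /=; first exact: multiplierZ.
  apply: multiplierM; first exact: multiplierZ.
  apply: multiplierB; first exact: multiplier_cst.
  by under eq_fun do rewrite expr2; exact: multiplierM.
- by move=> n x Dx; apply: iter_newton_norm; exact: q1.
- move=> x Dx; have := newton_cvg (q1 x Dx).
  by rewrite sgrM [Num.sg _^-1]gtr0_sg ?invr_gt0// mul1r.
Qed.

Lemma multiplier_pos p : multiplier p ->
  multiplier (\1_[set x | 0 < p x] : X -> R).
Proof.
move=> ap; have as_ := multiplier_sg ap.
have := multiplierZ 2^-1 (multiplierD as_ (multiplierM as_ as_)).
apply: multiplier_ext => x _; rewrite indicE; have [p0|p0|p0] := ltgtP (p x) 0.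
- by rewrite memNset/= ?ltr0_sg//; [lra|rewrite lt_gtF].
- by rewrite mem_set/= ?gtr0_sg//; lra.
- by rewrite memNset/= ?p0 ?sgr0 ?ltxx//; lra.
Qed.

Lemma multiplier_indicC (E : set X) :
  multiplier (\1_E) -> multiplier (\1_(~` E)).
Proof.
move=> aE; have := multiplierB (multiplier_cst 1) aE.
apply: multiplier_ext => x _; rewrite !indicE in_setC.
by case: (x \in E); rewrite /cst/= ?subrr ?subr0.
Qed.

Lemma multiplier_indicI (E F : set X) :
  multiplier (\1_E) -> multiplier (\1_F) -> multiplier (\1_(E `&` F)).
Proof.
move=> aE aF; have := multiplierM aE aF.
apply: multiplier_ext => x _; rewrite !indicE in_setI.
by case: (x \in E); case: (x \in F); rewrite ?mulr1 ?mulr0.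
Qed.

Lemma multiplier_gt p c : multiplier p -> multiplier (\1_[set x | c < p x] : X -> R).
Proof.
move=> mp; have := multiplier_pos (multiplierB mp (multiplier_cst c)).
by apply: multiplier_ext => x _; congr (\1_(_) _);
  apply/seteqP; split => y /=; rewrite subr_gt0.
Qed.

Lemma multiplier_indic_ext (E F : set X) : (forall x, D x -> E x <-> F x) ->
  multiplier (\1_E) -> multiplier (\1_F).
Proof.
move=> EF; apply: multiplier_ext => x Dx; rewrite !indicE.
congr (_%:R); apply: congr1.
by apply/idP/idP => /set_mem H; apply/mem_set; apply/(EF x Dx).
Qed.

Lemma multiplier_triv (E : set X) (P : Prop) :
  (forall x, D x -> E x <-> P) -> multiplier (\1_E).
Proof.
move=> EP; have [p|np] := pselect P.
  apply: multiplier_ext (multiplier_cst 1) => x Dx.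
  by rewrite indicE mem_set//; apply/EP.
apply: multiplier_ext (multiplier_cst 0) => x Dx.
by rewrite indicE memNset// => /(EP x Dx).
Qed.

(** Products of indicators give intersections, and the indicators of finite
    unions tend boundedly to that of the countable union. *)
Lemma multiplier_sigma_algebra :
  sigma_algebra setT [set E : set X | multiplier (\1_E)].
Proof.
have C0 : multiplier (\1_(set0 : set X)).
  by apply: multiplier_ext (multiplier_cst 0) => x _; rewrite indicE in_set0.
split; first exact: C0.
  by move=> E aE; rewrite /= setTD; exact: multiplier_indicC.
move=> F aF.
pose G n := \bigcup_(i < n) F i.
have aG n : multiplier (\1_(G n)).
  rewrite /G bigcup_mkord; elim: n => [|n IH]; first by rewrite big_ord0.
  rewrite big_ord_recr /= -[_ `|` _]setCK setCU.
  by apply: multiplier_indicC; apply: multiplier_indicI; apply: multiplier_indicC; [exact: IH|exact: aF].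
apply: (@multiplier_lim (fun n => \1_(G n)) _ 1).
- exact: aG.
- by move=> n x _; rewrite indicE; case: (_ \in _); rewrite ?normr1 ?normr0.
- move=> x _; have [[i _ Fix]|nF] := pselect ((\bigcup_i F i) x).
  rewrite indicE mem_set; last by exists i.
  apply: cvg_near_cst; exists i.+1 => // n /= iN.
  by rewrite indicE mem_set//; exists i.
rewrite indicE memNset//; apply: cvg_near_cst; apply: nearW => n.
by rewrite indicE memNset// => -[i _ Fix]; apply: nF; exists i.
Qed.

Lemma multiplier_preimage (u : X -> R) :
  (forall c, multiplier (\1_[set x | u x < c])) ->
  forall B : set R, measurable B -> multiplier (\1_(u @^-1` B)).
Proof.
move=> H B; have [S0 SC SU] := multiplier_sigma_algebra.
rewrite (_ : measurable = <<s @RGenInftyO.G R >>); last exact: RGenInftyO.measurableE.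
have sub : <<s @RGenInftyO.G R >> `<=` [set B | multiplier (\1_(u @^-1` B))]; last first.
  exact (sub B).
apply: smallest_sub.
  split => [|A|F aF].
  - by rewrite /= preimage_set0.
  - by rewrite /= setTD preimage_setC => /SC; rewrite setTD.
  - by rewrite /= preimage_bigcup; apply: SU.
by move=> _ [c ->]; exact (H c).
Qed.

Lemma multiplier_bmeas p :
  (forall E, measurable E -> multiplier (\1_E)) -> bmeas D p -> multiplier p.
Proof.
move=> HE bp; apply: (bmeas_ind mD HE) bp.
- move=> a f g mf mg; apply: multiplierD; last exact: mg.
  exact: multiplierZ.
- by move=> h f M ah hM hf; apply: multiplier_lim hM hf.
Qed.

(** The constant 1 need not be a mode, so a positive approximable [s] takes its
    place: [f] is the bounded limit of the products of [s] with the bounded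
    functions [f / (s + 1 / n)], which are multipliers. *)
Theorem approximable_bmeas s f :
  (forall E, measurable E -> multiplier (\1_E)) ->
  apx s -> (forall x, D x -> 0 < s x) ->
  bmeas D f -> apx f.
Proof.
move=> HE as_ s0 bf; have [[ms _] _] := as_; have [mf [M fM]] := bf.
have D0 n x : D x -> 0 < s x + n.+1%:R^-1 by move=> /s0 sx; rewrite addr_gt0.
have mh n : measurable_fun D (fun x => (s x + n.+1%:R^-1)^-1).
  apply: (@measurable_comp _ _ _ X (measurableTypeR R) (measurableTypeR R)
    [set y | y != 0] (fun y : R => y^-1) D (fun x => s x + n.+1%:R^-1)).
  - by apply: open_measurable; exact: open_neq.
  - by move=> _ [x Dx <-] /=; rewrite gt_eqF// D0.
  - apply: open_continuous_measurable_fun; first exact: open_neq.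
    by move=> x /set_mem /= x0; exact: inv_continuous.
  - exact: measurable_funD.
pose h n x := f x * (s x + n.+1%:R^-1)^-1.
have ah n : multiplier (h n).
  apply: multiplier_bmeas; first exact: HE.
  apply: bmeasM; first exact: bf.
  split; first exact: mh.
  exists n.+1%:R => x Dx; rewrite ger0_norm; last by rewrite invr_ge0 ltW// D0.
  by rewrite -[leRHS]invrK lef_pV2 ?posrE ?invr_gt0 ?D0// lerDr ltW// s0.
apply: (approximable_lim ons (h := fun n x => h n x * s x) (M := M)).
- by move=> n; exact: (ah n).2.
- move=> n x Dx; rewrite -mulrA normrM (le_trans _ (fM x Dx))// ler_piMr//.
  rewrite ger0_norm; last by rewrite mulr_ge0 ?invr_ge0// ltW ?s0 ?D0.
  by rewrite mulrC ler_pdivrMr ?D0// mul1r lerDl.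
- move=> x Dx; rewrite /h.
  have -> : f x = f x * (s x + 0)^-1 * s x by rewrite addr0 mulfVK// gt_eqF ?s0.
  apply: cvgM; last exact: cvg_cst.
  apply: cvgM; first by rewrite addr0 mulfVK ?gt_eqF ?s0//; exact: cvg_cst.
  apply: cvgV; first by rewrite addr0 gt_eqF ?s0.
  by apply: cvgD; [exact: cvg_cst|exact: cvg_harmonic].
Qed.

End multiplier.

(** * Sine waves on an interval *)

Section waves.
Variable R : realType.
Implicit Types (c w th a b x : R).

(** Constants, sines and cosines form one family, in which derivation is a change
    of parameters. *)
Definition wave c w th (x : R) : R := c * sin (w * x + th).

Definition dwave c w th : R -> R := wave (c * w) w (th + pi / 2).

Lemma dwaveE c w th x : dwave c w th x = c * w * cos (w * x + th).
Proof. by rewrite /dwave /wave addrA sinDpihalf. Qed.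

Lemma is_derive_wave c w th x : is_derive x 1 (wave c w th) (dwave c w th x).
Proof.
have H : is_derive x 1 (fun y : R => w * y + th) w.
  by apply: is_derive_eq; rewrite addr0 -[LHS]/(w * 1) mulr1.
have H2 := @is_derive1_comp R sin _ x _ _ (is_derive_sin (w * x + th)) H.
have := @is_deriveZ R R R (sin \o (fun y => w * y + th)) c x 1 _ H2.
rewrite dwaveE; rewrite (_ : c *: (cos (w * x + th) * w) = c * w * cos (w * x + th))//.
by rewrite -[LHS]/(c * (cos (w * x + th) * w)); ring.
Qed.

Lemma ddwave c w th : dwave (c * w) w (th + pi / 2) =
  (fun x => - w ^+ 2 * wave c w th x).
Proof.
apply/funext => x; rewrite dwaveE addrA cosDpihalf /wave; ring.
Qed.

Lemma is_derive_dwave c w th x :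
  is_derive x 1 (dwave c w th) (- w ^+ 2 * wave c w th x).
Proof. by have := is_derive_wave (c * w) w (th + pi / 2) x; rewrite ddwave. Qed.

Lemma continuous_wave c w th : continuous (wave c w th).
Proof.
move=> x; apply: differentiable_continuous; apply/derivable1_diffP.
by case: (is_derive_wave c w th x).
Qed.

Lemma wave_bound c w th x : `|wave c w th x| <= `|c|.
Proof. by rewrite normrM ler_piMr// sin_max. Qed.

Lemma bmeas_wave c w th (D : set R) : bmeas D (wave c w th).
Proof.
split; last by exists `|c| => x _; exact: wave_bound.
apply: measurable_funTS; apply: continuous_measurable_fun.
exact: continuous_wave.
Qed.

Lemma bmeas_continuous_bounded (p : R -> R) M :
  continuous p -> (forall x, `|p x| <= M) -> bmeas setT p.
Proof. by move=> cp pM; split; [exact: continuous_measurable_fun|exists M => x _]. Qed.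

Lemma int_derive (F f : R -> R) a b (l : bool) : a < b ->
  (forall x, is_derive x 1 F (f x)) -> continuous f ->
  \int[lebesgue_measure]_(x in [set` Interval (BSide l a) (BLeft b)]) f x = F b - F a.
Proof.
move=> ab dF cf.
have cF : continuous F.
  move=> x; apply: differentiable_continuous; apply/derivable1_diffP.
  by case: (dF x).
have E : \int[lebesgue_measure]_(x in `[a, b]) f x = F b - F a.
  rewrite /Rintegral (@continuous_FTC2 _ f F)//.
  - by apply: continuous_subspaceT => x; exact: cf.
  - split.
    + by move=> x _; case: (dF x).
    + by apply: cvg_at_right_filter; exact: cF.
    + by apply: cvg_at_left_filter; exact: cF.
  - by move=> x _; rewrite derive1E; apply: derive_val.
have I : lebesgue_measure.-integrable `[a, b] (EFin \o f).
  apply: continuous_compact_integrable; first exact: segment_compact.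
  by apply: continuous_subspaceT => x; exact: cf.
rewrite -E; case: l => /=.
  rewrite Rintegral_itv_bndo_bndc//.
  by apply: integrableS I => // x /=; rewrite !in_itv/= => /andP[-> /ltW].
rewrite Rintegral_itv_bndo_bndc.
  rewrite Rintegral_itv_obnd_cbnd//.
  by apply: integrableS I => // x /=; rewrite !in_itv/= => /andP[/ltW -> ->].
by apply: integrableS I => // x /=; rewrite !in_itv/= => /andP[/ltW -> /ltW].
Qed.

Lemma int_derive0 (F f : R -> R) a b (l : bool) : a < b -> F b = F a ->
  (forall x, is_derive x 1 F (f x)) -> continuous f ->
  \int[lebesgue_measure]_(x in [set` Interval (BSide l a) (BLeft b)]) f x = 0.
Proof. by move=> ab Fab dF cf; rewrite (int_derive l ab dF cf) Fab subrr. Qed.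

Variables (a b : R) (l : bool).
Hypothesis ab : a < b.
Local Notation D := [set` Interval (BSide l a) (BLeft b)].
Local Notation mu := (@lebesgue_measure R).

Lemma itv_measurable : measurable (D : set (measurableTypeR R)).
Proof. exact: measurable_itv. Qed.

Lemma itv_measureE : mu D = (b - a)%:E.
Proof.
by rewrite lebesgue_measure_itv /= lte_fin ab.
Qed.

Lemma itv_finite : (mu D < +oo)%E.
Proof. by rewrite itv_measureE ltry. Qed.

Section pair.
Variables (c w th c' w' th' : R).
Local Notation u := (wave c w th).
Local Notation du := (dwave c w th).
Local Notation v := (wave c' w' th').
Local Notation dv := (dwave c' w' th').
Hypothesis uv_bdry : u b * dv b = u a * dv a.

(** Integration by parts, with [v'' = - w' ^ 2 * v]. The hypothesis on the boundary
    terms holds for Dirichlet and for periodic conditions alike. *)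
Lemma int_dwave_dwave :
  \int[mu]_(x in D) (du x * dv x) = w' ^+ 2 * \int[mu]_(x in D) (u x * v x).
Proof.
have bb := bmeasM (bmeas_wave c w th D) (bmeas_wave c' w' th' D).
have bd := bmeasM (bmeas_wave (c * w) w (th + pi / 2) D)
  (bmeas_wave (c' * w') w' (th' + pi / 2) D).
rewrite -(intZ itv_measurable itv_finite)//; apply/eqP.
rewrite -subr_eq0 -(intB itv_measurable itv_finite)//; last exact: bmeasZ.
apply/eqP; apply: (@int_derive0 (fun x => u x * dv x)).
- exact: ab.
- exact: uv_bdry.
- move=> x; have := is_deriveM (is_derive_wave c w th x) (is_derive_dwave c' w' th' x).
  move=> H; apply: is_derive_eq; rewrite -[LHS]/(u x * (- w' ^+ 2 * v x) + dv x * du x).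
  by ring.
- move=> x; apply: cvgB; first by apply: cvgM; exact: continuous_wave.
  apply: cvgM; first exact: cvg_cst.
  by apply: cvgM; exact: continuous_wave.
Qed.

Hypothesis vu_bdry : v b * du b = v a * du a.

(** Integration by parts the other way round gives the factor [w ^ 2] instead of
    [w' ^ 2]: eigenfunctions of distinct eigenvalues are orthogonal. *)
Lemma int_wave_wave_eq0 : w ^+ 2 != w' ^+ 2 -> \int[mu]_(x in D) (u x * v x) = 0.
Proof.
move=> ww'.
have H1 := int_dwave_dwave.
have bb := bmeasM (bmeas_wave c w th D) (bmeas_wave c' w' th' D).
have H2 : \int[mu]_(x in D) (du x * dv x) = w ^+ 2 * \int[mu]_(x in D) (u x * v x).
  have bd := bmeasM (bmeas_wave (c * w) w (th + pi / 2) D)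
    (bmeas_wave (c' * w') w' (th' + pi / 2) D).
  rewrite -(intZ itv_measurable itv_finite)//; apply/eqP.
  rewrite -subr_eq0 -(intB itv_measurable itv_finite)//; last exact: bmeasZ.
  apply/eqP; apply: (@int_derive0 (fun x => v x * du x)).
  - exact: ab.
  - exact: vu_bdry.
  - move=> x; have := is_deriveM (is_derive_wave c' w' th' x) (is_derive_dwave c w th x).
    move=> H; apply: is_derive_eq; rewrite -[LHS]/(v x * (- w ^+ 2 * u x) + du x * dv x).
    by ring.
  - move=> x; apply: cvgB; first by apply: cvgM; exact: continuous_wave.
    apply: cvgM; first exact: cvg_cst.
    by apply: cvgM; exact: continuous_wave.
move: H1; rewrite H2 => /eqP; rewrite -subr_eq0 -mulrBl mulf_eq0 subr_eq0.
by rewrite (negbTE ww')/= => /eqP.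
Qed.

End pair.

Lemma int_wave_sq c w th : w != 0 ->
  wave c w th b * dwave c w th b = wave c w th a * dwave c w th a ->
  \int[mu]_(x in D) (wave c w th x * wave c w th x) = c ^+ 2 * (b - a) / 2.
Proof.
move=> w0 H.
(* With u the wave, u'^2 + w^2 u^2 = c^2 and u'' = - w^2 u, so the derivative of
   u u' is c^2 - 2 w^2 u^2. *)
pose F x := c ^+ 2 / 2 * x - (2 * w ^+ 2)^-1 * (wave c w th x * dwave c w th x).
have -> : c ^+ 2 * (b - a) / 2 = F b - F a by rewrite /F H; ring.
apply: int_derive => //.
- move=> x.
  have H1 := is_deriveM (is_derive_wave c w th x) (is_derive_dwave c w th x).
  have H2 := @is_deriveZ R R R _ (2 * w ^+ 2)^-1 x 1 _ H1.
  have H3 := @is_deriveZ R R R _ (c ^+ 2 / 2) x 1 _ (is_derive_id x 1).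
  have H4 := is_deriveB H3 H2.
  apply: is_derive_eq.
  rewrite -[LHS]/(c ^+ 2 / 2 * 1 - (2 * w ^+ 2)^-1 *
    (wave c w th x * (- w ^+ 2 * wave c w th x) + dwave c w th x * dwave c w th x)).
  rewrite dwaveE /wave; set s := sin _; set k := cos _.
  have -> : c * w * k * (c * w * k) = c ^+ 2 * w ^+ 2 * (1 - s ^+ 2).
    by rewrite -cos2sin2 -/k; ring.
  by field.
- by move=> x; apply: cvgM; exact: continuous_wave.
Qed.

(** The sine and the cosine of one frequency: their product is the derivative of
    a multiple of the square. *)
Lemma int_wave_quarter c w th : w != 0 ->
  wave c w th b ^+ 2 = wave c w th a ^+ 2 ->
  \int[mu]_(x in D) (wave c w th x * wave c w (th + pi / 2) x) = 0.
Proof.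
move=> w0 H.
apply: (@int_derive0 (fun x => (2 * w)^-1 * (wave c w th x * wave c w th x))).
- exact: ab.
- by rewrite -!expr2 H.
- move=> x.
  have H1 := is_deriveM (is_derive_wave c w th x) (is_derive_wave c w th x).
  have H2 := @is_deriveZ R R R _ (2 * w)^-1 x 1 _ H1.
  apply: is_derive_eq.
  rewrite -[LHS]/((2 * w)^-1 *
    (wave c w th x * dwave c w th x + wave c w th x * dwave c w th x)).
  by rewrite /dwave /wave; field.
- by move=> x; apply: cvgM; exact: continuous_wave.
Qed.

End waves.

(** * Dirichlet and trigonometric modes *)

Section trigonometric_systems.
Variable R : realType.
Implicit Types (x L : R) (k m : nat).
Local Notation mu := (@lebesgue_measure R).

Lemma sin_natpi k : sin (k%:R * pi) = 0 :> R.
Proof.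
elim: k => [|k IH]; first by rewrite mul0r sin0.
by rewrite -natr1 mulrDl mul1r sinDpi IH oppr0.
Qed.

Lemma sin_period k x : sin (x + k%:R * (2 * pi)) = sin x.
Proof.
have -> : k%:R * (2 * pi) = pi *+ 2 *+ k :> R.
  by rewrite -[pi *+ 2]mulr_natl -[RHS]mulr_natl.
by rewrite periodicn//; exact: sinD2pi.
Qed.

Lemma wave_period (c w th L : R) k x : w * L = k%:R * (2 * pi) ->
  wave c w th (x + L) = wave c w th x.
Proof. by move=> wL; rewrite /wave mulrDr wL addrAC sin_period. Qed.

(** The Dirichlet modes of [-1, 1]. The sine is taken at [x + 1], which is why the
    phase equals the frequency, and the length 2 makes the amplitude 1. *)
Definition sine_freq k : R := k.+1%:R * (pi / 2).
Definition sine_mode k : R -> R := wave 1 (sine_freq k) (sine_freq k).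

Lemma sine_freq_gt0 k : 0 < sine_freq k.
Proof. by rewrite mulr_gt0// divr_gt0// pi_gt0. Qed.

Lemma sine_modeE k x : sine_mode k x = sin (k.+1%:R * (pi / 2 * (x + 1))).
Proof. by rewrite /sine_mode /wave /sine_freq mul1r; congr sin; ring. Qed.

Lemma sine_mode_left k : sine_mode k (-1) = 0.
Proof. by rewrite sine_modeE addNr !mulr0 sin0. Qed.

Lemma sine_mode_right k : sine_mode k 1 = 0.
Proof.
rewrite sine_modeE (_ : _ * (_ * _) = k.+1%:R * pi) ?sin_natpi//; lra.
Qed.

Lemma sine_orth k m :
  \int[mu]_(x in `]-1, 1[) (sine_mode k x * sine_mode m x) = (k == m)%:R.
Proof.
have ab : -1 < 1 :> R by lra.
have [<-|km] := eqVneq.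
  rewrite (@int_wave_sq R _ _ false ab).
  - by rewrite opprK expr1n mul1r divff.
  - by rewrite gt_eqF ?sine_freq_gt0.
  - by rewrite [X in X * _]sine_mode_right [X in _ = X * _]sine_mode_left !mul0r.
apply: (@int_wave_wave_eq0 R _ _ false ab).
- by rewrite [X in X * _]sine_mode_right [X in _ = X * _]sine_mode_left !mul0r.
- by rewrite [X in X * _]sine_mode_right [X in _ = X * _]sine_mode_left !mul0r.
- rewrite eqrXn2 ?ltW ?sine_freq_gt0// /sine_freq.
  rewrite (inj_eq (mulIf _)) ?eqr_nat ?eqSS//.
  by rewrite gt_eqF// divr_gt0// pi_gt0.
Qed.

(** The trigonometric system of period [L]: the constant, then the cosine
    (odd index) and the sine (even index) of each frequency. *)
Definition torus_freq L k : R := (uphalf k)%:R * (2 * pi / L).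
Definition torus_amp L k : R := Num.sqrt ((if k == 0 then 1 else 2) / L).
Definition torus_phase k : R := if (k == 0) || odd k then pi / 2 else 0.
Definition torus_mode L k : R -> R :=
  wave (torus_amp L k) (torus_freq L k) (torus_phase k).

Lemma torus_freq_period L k : 0 < L ->
  torus_freq L k * L = (uphalf k)%:R * (2 * pi).
Proof. by move=> L0; rewrite /torus_freq; field; rewrite gt_eqF. Qed.

Lemma torus_mode_period L k x : 0 < L -> torus_mode L k (x + L) = torus_mode L k x.
Proof. by move=> /torus_freq_period H; apply: wave_period; exact: H. Qed.

Lemma torus_bdry L k m : 0 < L ->
  torus_mode L k L * dwave (torus_amp L m) (torus_freq L m) (torus_phase m) L =
  torus_mode L k 0 * dwave (torus_amp L m) (torus_freq L m) (torus_phase m) 0.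
Proof.
move=> L0; have := torus_mode_period k 0 L0; rewrite add0r => ->; congr (_ * _).
have := @wave_period (torus_amp L m * torus_freq L m) (torus_freq L m)
  (torus_phase m + pi / 2) L (uphalf m) 0; rewrite add0r /dwave => ->//.
exact: torus_freq_period.
Qed.

Lemma uphalf_eqP k m : uphalf k = uphalf m -> k != m ->
  exists j, (k = j.+1.*2 /\ m = j.+1.*2.-1) \/ (k = j.+1.*2.-1 /\ m = j.+1.*2).
Proof.
have := odd_double_half k; have := odd_double_half m; rewrite !uphalf_half.
move: (odd k) (odd m) (k./2) (m./2) => [] [] p q /= Em Ek pq kDm.
- lia.
- by exists p; right; lia.
- by exists q; left; lia.
- lia.
Qed.

Lemma torus_orth L k m (l : bool) : 0 < L ->
  \int[mu]_(x in [set` Interval (BSide l 0) (BLeft L)])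
     (torus_mode L k x * torus_mode L m x) = (k == m)%:R.
Proof.
move=> L0.
have w0 j : 0 < torus_freq L j.+1.
  by rewrite /torus_freq mulr_gt0 ?divr_gt0 ?mulr_gt0 ?pi_gt0// ltr0n.
have [<-|km] := eqVneq.
  case: k => [|k].
    rewrite (eq_Rintegral mu (g := cst L^-1)); last first.
      move=> x _; rewrite /torus_mode /wave /torus_freq/= !mul0r !add0r.
      rewrite /torus_phase/= sin_pihalf !mulr1 /torus_amp/= -expr2 sqr_sqrtr ?mul1r//.
      by rewrite invr_ge0 ltW.
    rewrite Rintegral_cst; last exact: measurable_itv.
    rewrite [X in fine X](itv_measureE l L0)/= subr0 mulVf//; by rewrite gt_eqF.
  rewrite (@int_wave_sq R _ _ l L0).
  - rewrite /torus_amp/= sqr_sqrtr; last by rewrite divr_ge0// ltW.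
    by rewrite subr0 divfK ?gt_eqF// divff.
  - by rewrite gt_eqF.
  - exact: torus_bdry.
have [uu|uu] := eqVneq (uphalf k) (uphalf m); last first.
  apply: (@int_wave_wave_eq0 R _ _ l L0); [exact: torus_bdry|exact: torus_bdry|].
  have P : 0 < 2 * pi / L by rewrite divr_gt0// mulr_gt0// pi_gt0.
  have ge0 j : 0 <= torus_freq L j by rewrite mulr_ge0// ltW.
  rewrite eqrXn2// /torus_freq (inj_eq (mulIf _)) ?eqr_nat//.
  by rewrite gt_eqF.
have Q j : \int[mu]_(x in [set` Interval (BSide l 0) (BLeft L)])
     (torus_mode L j.+1.*2 x * torus_mode L j.+1.*2.-1 x) = 0.
  have E1 : torus_mode L j.+1.*2.-1 =
      wave (torus_amp L j.+1.*2) (torus_freq L j.+1.*2) (torus_phase j.+1.*2 + pi / 2).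
    rewrite /torus_mode /torus_amp /torus_freq /torus_phase doubleS/= odd_double/= add0r.
    by congr (wave _ (_%:R * _) _); rewrite uphalf_double doubleK.
  rewrite E1; apply: (@int_wave_quarter R _ _ l L0).
    by rewrite doubleS; exact: lt0r_neq0.
  have := torus_mode_period j.+1.*2 0 L0.
  by rewrite add0r /torus_mode => ->.
have [j [[-> ->]|[-> ->]]] := uphalf_eqP uu km; first exact: Q.
by apply: etrans (Q j); apply: eq_Rintegral => x _; rewrite mulrC.
Qed.

(** Product-to-sum formulas: a class [V] closed under combinations that contains
    the modes contains their products with the lowest cosine and, on the torus,
    the lowest sine. For [V] a class of approximable functions, this makes them
    multipliers. *)
Section closure.
Variable V : (R -> R) -> Prop.
Hypothesis Vcomb : forall a f g, V f -> V g -> V (fun x => a * f x + g x).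

Let Vscale f a : V f -> V (fun x => a * f x).
Proof.
move=> Vf; have := Vcomb (a - 1) Vf Vf.
by congr V; apply/funext => x; ring.
Qed.

Lemma sine_mul_cos : (forall k, V (sine_mode k)) ->
  forall k, V (fun x => cos (pi / 2 * (x + 1)) * sine_mode k x).
Proof.
move=> Vs [|k].
  have := Vscale 2^-1 (Vs 1%N); congr V; apply/funext => x.
  rewrite !sine_modeE; set th := _ * (x + 1).
  by rewrite mul1r mulr_natl sin_mulr2n -[_ *+ 2]mulr_natl; field.
have := Vscale 2^-1 (Vcomb 1 (Vs k.+2) (Vs k)).
congr V; apply/funext => x; rewrite mul1r !sine_modeE; set th := _ * (x + 1).
have -> : k.+3%:R * th = k.+2%:R * th + th by rewrite -[k.+3%:R]natr1; ring.
have -> : k.+1%:R * th = k.+2%:R * th - th by rewrite -[k.+2%:R]natr1; ring.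
by rewrite sinD sinB; field.
Qed.

Variable L : R.
Hypothesis L0 : 0 < L.
Hypothesis Vt : forall k, V (torus_mode L k).

Local Notation th x := (2 * pi / L * x).

Let amp0 k : torus_amp L k != 0.
Proof. by rewrite gt_eqF// sqrtr_gt0 divr_gt0//; case: ifP. Qed.

Let modeE k x : torus_mode L k x = torus_amp L k *
  if (k == 0) || odd k then cos ((uphalf k)%:R * th x) else sin ((uphalf k)%:R * th x).
Proof.
rewrite /torus_mode /wave /torus_freq /torus_phase; congr (_ * _).
by case: ifP => _; rewrite ?addr0 ?sinDpihalf -mulrA.
Qed.

Let Vcos k : V (fun x => cos (k%:R * th x)).
Proof.
have := Vscale (torus_amp L k.*2.-1)^-1 (Vt k.*2.-1).
congr V; apply/funext => x; rewrite modeE mulKf//.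
case: k => [|k]; first by rewrite eqxx/= !mul0r.
by rewrite doubleS/= odd_double/= doubleK.
Qed.

Let Vsin k : V (fun x => sin (k%:R * th x)).
Proof.
case: k => [|k].
  have := Vscale 0 (Vt 0); congr V; apply/funext => x.
  by rewrite !mul0r sin0.
have := Vscale (torus_amp L k.+1.*2)^-1 (Vt k.+1.*2).
congr V; apply/funext => x; rewrite modeE mulKf//.
by rewrite odd_double/= uphalf_double.
Qed.

Let modeP (P : (R -> R) -> Prop) : (forall f a, P f -> P (fun x => a * f x)) ->
  (forall m, P (fun x => cos (m%:R * th x))) ->
  (forall m, P (fun x => sin (m%:R * th x))) -> forall k, P (torus_mode L k).
Proof.
move=> PZ Pc Ps k.
case c: ((k == 0) || odd k).
  rewrite (_ : torus_mode L k = fun x => torus_amp L k * cos ((uphalf k)%:R * th x)).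
    exact: PZ _ _ (Pc _).
  by apply/funext => x; rewrite modeE c.
rewrite (_ : torus_mode L k = fun x => torus_amp L k * sin ((uphalf k)%:R * th x)).
  exact: PZ _ _ (Ps _).
by apply/funext => x; rewrite modeE c.
Qed.

Lemma torus_mul_cos k : V (fun x => cos (th x) * torus_mode L k x).
Proof.
move: k; apply: (modeP (P := fun f => V (fun x => cos (th x) * f x))).
- by move=> f a Vf; have := Vscale a Vf; congr V; apply/funext => x; ring.
- move=> [|m].
    have := Vcos 1; congr V; apply/funext => x.
    by rewrite mul1r mul0r cos0 mulr1.
  have := Vscale 2^-1 (Vcomb 1 (Vcos m.+2) (Vcos m)).
  congr V; apply/funext => x; rewrite mul1r; set t := th x.
  have -> : m.+2%:R * t = m.+1%:R * t + t by rewrite -[m.+2%:R]natr1; ring.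
  have -> : m%:R * t = m.+1%:R * t - t by rewrite -[m.+1%:R]natr1; ring.
  by rewrite cosD cosB; field.
- move=> [|m].
    have := Vscale 0 (Vsin 0); congr V; apply/funext => x.
    by rewrite mul0r [0 * th x]mul0r sin0 mulr0.
  have := Vscale 2^-1 (Vcomb 1 (Vsin m.+2) (Vsin m)).
  congr V; apply/funext => x; rewrite mul1r; set t := th x.
  have -> : m.+2%:R * t = m.+1%:R * t + t by rewrite -[m.+2%:R]natr1; ring.
  have -> : m%:R * t = m.+1%:R * t - t by rewrite -[m.+1%:R]natr1; ring.
  by rewrite sinD sinB; field.
Qed.

Lemma torus_mul_sin k : V (fun x => sin (th x) * torus_mode L k x).
Proof.
move: k; apply: (modeP (P := fun f => V (fun x => sin (th x) * f x))).
- by move=> f a Vf; have := Vscale a Vf; congr V; apply/funext => x; ring.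
- move=> [|m].
    have := Vsin 1; congr V; apply/funext => x.
    by rewrite mul1r mul0r cos0 mulr1.
  have := Vscale 2^-1 (Vcomb (-1) (Vsin m) (Vsin m.+2)).
  congr V; apply/funext => x; set t := th x.
  have -> : m.+2%:R * t = m.+1%:R * t + t by rewrite -[m.+2%:R]natr1; ring.
  have -> : m%:R * t = m.+1%:R * t - t by rewrite -[m.+1%:R]natr1; ring.
  by rewrite sinB sinD; field.
- move=> [|m].
    have := Vscale 0 (Vsin 0); congr V; apply/funext => x.
    by rewrite mul0r [0 * th x]mul0r sin0 mulr0.
  have := Vscale 2^-1 (Vcomb (-1) (Vcos m.+2) (Vcos m)).
  congr V; apply/funext => x; set t := th x.
  have -> : m.+2%:R * t = m.+1%:R * t + t by rewrite -[m.+2%:R]natr1; ring.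
  have -> : m%:R * t = m.+1%:R * t - t by rewrite -[m.+1%:R]natr1; ring.
  by rewrite cosD cosB; field.
Qed.

End closure.

(** The order of angles in [0, 2 pi) is read off the sign of the sine and the value
    of the cosine, according to the half turn that contains the bound. *)
Lemma angle_lt_small (t g : R) : 0 <= t < 2 * pi -> 0 < g <= pi ->
  (t < g) = (0 <= sin t) && (cos g < cos t).
Proof.
move=> /andP[t0 t2] /andP[g0 gpi]; have [tpi|tpi] := leP t pi.
  rewrite sin_ge0_pi ?t0//= ltr_cos// !in_itv/= ?t0 ?tpi ?gpi ?(ltW g0)//.
rewrite ltNge (le_trans gpi (ltW tpi))/=.
apply/esym/negbTE; rewrite negb_and -ltNge; apply/orP; left.
have -> : sin t = - sin (t - pi) by rewrite -[in LHS](subrK pi t) sinDpi.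
by rewrite oppr_lt0 sin_gt0_pi// subr_gt0 tpi/=; move: t2; lra.
Qed.

Lemma angle_lt_large (t g : R) : 0 <= t < 2 * pi -> pi < g < 2 * pi ->
  (t < g) = ~~ ((sin t < 0) && (cos g <= cos t)).
Proof.
move=> /andP[t0 t2] /andP[gpi g2]; have [tpi|tpi] := leP t pi.
  rewrite (le_lt_trans tpi gpi); apply/esym; rewrite negb_and -leNgt.
  by rewrite sin_ge0_pi ?t0.
have -> : sin t < 0.
  have -> : sin t = - sin (t - pi) by rewrite -[in LHS](subrK pi t) sinDpi.
  by rewrite oppr_lt0 sin_gt0_pi// subr_gt0 tpi/=; move: t2; lra.
have cE y : cos y = cos (2 * pi - y) :> R.
  rewrite -cosN -(cosD2pi (- y)); congr cos; rewrite -mulr_natl; ring.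
rewrite /= (cE g) (cE t) -ltNge ltr_cos ?in_itv/=.
- by rewrite ltrD2l ltrN2.
- by move: tpi t2 gpi g2; lra.
- by move: tpi t2 gpi g2; lra.
Qed.

End trigonometric_systems.

Section angle_multiplier.
Context d (X : measurableType d) (R : realType).
Variables (mu : {measure set X -> \bar R}) (D : set X).
Variables (I : eqType) (e : I -> X -> R) (K : nat -> seq I).
Hypothesis ons : orthonormal_system mu D e K.
Local Notation mult := (multiplier mu D e K).

(** On a circle no single continuous function separates the points, hence the
    recourse to both the cosine and the sine of the coordinate. *)
Lemma multiplier_angle_lt (t : X -> R) : (forall x, D x -> 0 <= t x < 2 * pi) ->
  mult (fun x => cos (t x)) -> mult (fun x => sin (t x)) ->
  forall g, mult (\1_[set x | t x < g]).
Proof.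
move=> t02 mc ms g.
have [g0|g0] := leP g 0.
  apply: (multiplier_triv ons (P := False)) => x Dx; split => //= H.
  have /andP[t0 _] := t02 x Dx.
  by have := lt_le_trans H g0; rewrite ltNge t0.
have [g2|g2] := leP (2 * pi) g.
  apply: (multiplier_triv ons (P := True)) => x Dx; split => //= _.
  have /andP[_ t2] := t02 x Dx; exact: lt_le_trans t2 g2.
have msN : mult (\1_[set x | sin (t x) < 0]).
  have := multiplier_gt ons 0 (multiplierN ons ms).
  by apply: (multiplier_indic_ext ons) => x _ /=; rewrite oppr_gt0.
have [gp|gp] := leP g pi.
  have := multiplier_indicI ons (multiplier_indicC ons msN)
    (multiplier_gt ons (cos g) mc).
  apply: (multiplier_indic_ext ons) => x Dx /=.
  rewrite (angle_lt_small (t02 x Dx)) ?g0//; split.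
    by move=> [/negP + ->]; rewrite -leNgt => ->.
  by move=> /andP[s0 ->]; split => //; apply/negP; rewrite -leNgt.
have := multiplier_indicC ons (multiplier_indicI ons msN (multiplier_indicC ons
  (multiplier_gt ons (- cos g) (multiplierN ons mc)))).
apply: (multiplier_indic_ext ons) => x Dx /=.
rewrite (angle_lt_large (t02 x Dx)) ?gp// ltrN2; split.
  move=> H; apply/negP => /andP[s0 c0]; apply: H; split => //.
  by apply/negP; rewrite -leNgt.
by move/negP => H [s0 /negP c0]; apply: H; rewrite s0 leNgt.
Qed.

End angle_multiplier.

(** * Tensor products on boxes *)

Section tensor_products.
Variable R : realType.
Local Notation mu := (@lebesgue_measure R).

Definition tensor n (F : 'I_n -> R -> R) (u : 'rV[R]_n) : R := \prod_i F i (u 0 i).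

Definition box n (A : 'I_n -> set R) : set 'rV[R]_n :=
  [set u | forall i, A i (u 0 i)].

Lemma tensor_consr n (F : 'I_n.+1 -> R -> R) (p : R * 'rV[R]_n) :
  tensor F (consr p) = F ord0 p.1 * tensor (fun i => F (lift ord0 i)) p.2.
Proof.
rewrite /tensor big_ord_recl consr0; congr (_ * _).
by apply: eq_bigr => i _; rewrite consrS.
Qed.

Lemma measurable_tensor n (F : 'I_n -> R -> R) :
  (forall i, measurable_fun setT (F i)) -> measurable_fun setT (tensor F).
Proof.
move=> mF; apply: measurable_prod => i _.
have := measurableT_comp (mF i) (@measurable_coord R n i).
exact.
Qed.

Lemma measurable_box n (A : 'I_n -> set R) :
  (forall i, measurable (A i : set (measurableTypeR R))) -> measurable (box A).
Proof.
move=> mA; rewrite (_ : box A = \bigcap_(i in [set: 'I_n])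
    ((fun u : 'rV[R]_n => u 0 i : measurableTypeR R) @^-1` A i)).
  apply: fin_bigcap_measurable => // i _.
  by rewrite -[X in measurable X]setTI; exact: measurable_coord.
by apply/seteqP; split => [u Au i _|u Au i]; [exact: Au|exact: Au i I].
Qed.

Lemma tensor_restrict n (F : 'I_n -> R -> R) (A : 'I_n -> set R) :
  tensor (fun i => F i \_ (A i)) = (tensor F) \_ (box A).
Proof.
apply/funext => u; rewrite /tensor /patch.
have [uA|uA] := boolP (u \in box A).
  by apply: eq_bigr => i _; rewrite mem_set//; move/set_mem: uA.
have [i Ai] : exists i, ~ A i (u 0 i).
  apply/existsNP => H; move/negP: uA; apply; apply/mem_set; exact: H.
by rewrite (bigD1 i)//= memNset// mul0r.
Qed.

(** Fubini, one coordinate at a time, as [leb] is the image under [consr] of a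
    product measure. *)
Lemma int_tensorT n (F : 'I_n -> R -> R) :
  (forall i, measurable_fun setT (F i)) ->
  (forall i, mu.-integrable setT (EFin \o F i)) ->
  (leb R n).-integrable setT (EFin \o tensor F) /\
  \int[leb R n]_u tensor F u = \prod_i \int[mu]_x F i x.
Proof.
elim: n F => [|n IH] F mF iF.
  have E : EFin \o tensor F = cst 1%E.
    by apply/funext => u; rewrite /tensor /= big_ord0.
  rewrite /Rintegral big_ord0 E; split.
    apply/integrableP; split => //.
    under eq_integral do rewrite /= normr1.
    by rewrite integral_cst//= mul1e diracT ltry.
  rewrite (_ : (fun u => (tensor F u)%:E) = cst 1%E)//.
  by rewrite integral_cst// mul1e [X in fine X]diracT.
have [iG EG] := IH (fun i => F (lift ord0 i)) (fun i => mF _) (fun i => iF _).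
set G := tensor _ in iG EG.
have mG : measurable_fun setT G by apply: measurable_tensor.
pose m1 : {sigma_finite_measure set (measurableTypeR R) -> \bar R} := mu.
pose g (p : measurableTypeR R * 'rV[R]_n) : \bar R := (F ord0 p.1 * G p.2)%:E.
have mg : measurable_fun setT g.
  apply/measurable_EFinP; apply: measurable_funM.
    exact: (measurableT_comp (mF ord0) measurable_fst).
  exact: (measurableT_comp mG measurable_snd).
have fG : (\int[leb R n]_v (G v)%:E)%E = (\int[leb R n]_v G v)%:E.
  by rewrite /Rintegral fineK//; exact: (integrable_fin_num measurableT iG).
have f0 : (\int[mu]_x (F ord0 x)%:E)%E = (\int[mu]_x F ord0 x)%:E.
  by rewrite /Rintegral fineK//; exact: (integrable_fin_num measurableT (iF ord0)).
have ig : (m1 \x leb R n)%E.-integrable setT g.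
  apply/(integrable12ltyP m1 (leb R n) mg).
  have /integrableP[_ iGa] := iG; have /integrableP[_ iFa] := iF ord0.
  have E x : (\int[leb R n]_v `|g (x, v)|)%E =
      (`|F ord0 x|%:E * \int[leb R n]_v `|(G v)%:E|)%E.
    rewrite -ge0_integralZl//.
      by apply: eq_integral => v _; rewrite /g /= normrM EFinM.
    by apply: measurableT_comp => //; exact/measurable_EFinP.
  under eq_integral do rewrite E.
  rewrite ge0_integralZr//.
    apply: lte_mul_pinfty; [exact: integral_ge0| |exact: iGa].
    by rewrite ge0_fin_numE//; exact: integral_ge0.
  - by apply/measurable_EFinP; apply: measurableT_comp => //; exact: mF.
  - exact: integral_ge0.
have gE : g = (EFin \o tensor F) \o @consr R n.
  by apply/funext => p; rewrite /g /= tensor_consr.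
have mT : measurable_fun setT (EFin \o tensor F).
  by apply/measurable_EFinP; exact: measurable_tensor.
have igT : (m1 \x leb R n)%E.-integrable (@consr R n @^-1` setT)
    ((EFin \o tensor F) \o @consr R n) by rewrite preimage_setT -gE.
split.
  exact: (integrable_pushforward (measurable_consr (n := n)) mT igT).
rewrite big_ord_recl -EG /Rintegral.
rewrite [X in fine X](integral_pushforward (measurable_consr (n := n)) mT igT)//.
rewrite preimage_setT -gE -(integral12_prod_meas1 ig).
have E x : (\int[leb R n]_v g (x, v))%E = ((F ord0 x)%:E * \int[leb R n]_v (G v)%:E)%E.
  by rewrite -integralZl//; apply: eq_integral => v _; rewrite /g EFinM.
have -> : fubini_F (leb R n) g = fun x => ((F ord0 x)%:E * (\int[leb R n]_v G v)%:E)%E.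
  by apply/funext => x; rewrite /fubini_F E fG.
have := @integralZr _ _ _ mu setT measurableT _ (iF ord0) (\int[leb R n]_v G v).
by move=> /= ->; rewrite f0 -EFinM.
Qed.

Lemma int_tensor n (F : 'I_n -> R -> R) (A : 'I_n -> set R) :
  (forall i, measurable (A i : set (measurableTypeR R))) ->
  (forall i, (mu (A i) < +oo)%E) ->
  (forall i, bmeas (A i) (F i)) ->
  \int[leb R n]_(u in box A) tensor F u = \prod_i \int[mu]_(x in A i) F i x.
Proof.
move=> mA fA bF; rewrite Rintegral_mkcond -tensor_restrict.
have H i : measurable_fun setT (F i \_ (A i)) /\
    mu.-integrable setT (EFin \o (F i \_ (A i))).
  split; first by apply/(measurable_restrictT _ (mA i)); case: (bF i).
  rewrite -restrict_EFin; apply/(integrable_mkcond _ (mA i)).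
  exact: (bmeas_integrable (mA i) (fA i) (bF i)).
have [_ ->] := int_tensorT (fun i => (H i).1) (fun i => (H i).2).
by apply: eq_bigr => i _; rewrite -Rintegral_mkcond.
Qed.

Lemma box_finite n (A : 'I_n -> set R) :
  (forall i, measurable (A i : set (measurableTypeR R))) ->
  (forall i, (mu (A i) < +oo)%E) -> (leb R n (box A) < +oo)%E.
Proof.
move=> mA fA.
have H i : measurable_fun setT (cst (1:R) \_ (A i)) /\
    mu.-integrable setT (EFin \o (cst (1:R) \_ (A i))).
  split; first by apply/(measurable_restrictT _ (mA i)).
  rewrite -restrict_EFin; apply/(integrable_mkcond _ (mA i)).
  exact: (bmeas_integrable (mA i) (fA i) (bmeas_cst _ 1)).
have [+ _] := int_tensorT (fun i => (H i).1) (fun i => (H i).2).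
rewrite tensor_restrict -restrict_EFin => i1.
have /integrableP[_] := (integrable_mkcond _ (measurable_box mA)).2 i1.
apply: le_lt_trans; rewrite (eq_integral (cst 1%E)).
  by rewrite integral_cst ?mul1e//; exact: measurable_box.
by move=> u _ /=; rewrite /tensor big1// normr1.
Qed.

Lemma bmeas_tensor n (F : 'I_n -> R -> R) (A : 'I_n -> set R) :
  (forall i, measurable_fun setT (F i)) ->
  (forall i, exists M, forall x, A i x -> `|F i x| <= M) -> bmeas (box A) (tensor F).
Proof.
move=> mF bF; split; first by apply: measurable_funTS; exact: measurable_tensor.
have [M HM] := choice bF.
exists (\prod_i M i) => u Au; rewrite /tensor normr_prod.
by apply: ler_prod => i _; rewrite normr_ge0 HM.
Qed.

End tensor_products.

(** * Laplace eigenfunctions on the domain *)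

Section space_modes.
Variables (R : realType) (n : nat).
Implicit Types (i j : 'I_n.+1) (m : nat) (k l : {ffun 'I_n.+1 -> nat}).
Local Notation mu := (@lebesgue_measure R).
Local Notation Rd := 'rV[R]_n.+1.
Local Notation Omega := (@Omega R n).

Definition side i : set R := if i == ord0 then `]-1, 1[%classic else `[0, 1[%classic.

(** The first coordinate carries the Dirichlet modes and each other coordinate the
    trigonometric modes of period 1, so that products of modes vanish on the
    boundary and live on the torus. *)
Definition mode_amp i m : R := if i == ord0 then 1 else torus_amp 1 m.
Definition mode_freq i m : R := if i == ord0 then sine_freq R m else torus_freq 1 m.
Definition mode_phase i m : R := if i == ord0 then sine_freq R m else torus_phase R m.
Definition mode i m : R -> R := wave (mode_amp i m) (mode_freq i m) (mode_phase i m).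
Definition dmode i m : R -> R := dwave (mode_amp i m) (mode_freq i m) (mode_phase i m).

Definition upd (F : 'I_n.+1 -> R -> R) i (f : R -> R) j := if j == i then f else F j.

Definition modes k i : R -> R := mode i (k i).
Definition eigenfun k : Rd -> R := tensor (modes k).
Definition deigenfun i k : Rd -> R := tensor (upd (modes k) i (dmode i (k i))).
Definition eigenval k : R := \sum_i mode_freq i (k i) ^+ 2.

Lemma OmegaE : Omega = box side.
Proof.
apply/seteqP; split => u.
  move=> [u0 u1] i; rewrite /side; case: (eqVneq i ord0) => [->|i0] /=.
    by rewrite in_itv.
  by rewrite in_itv/=; exact: u1.
move=> H; split.
  by have := H ord0; rewrite /side eqxx /= in_itv.
by move=> i i0; have := H i; rewrite /side (negbTE i0) /= in_itv.
Qed.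

Lemma measurable_side i : measurable (side i : set (measurableTypeR R)).
Proof. by rewrite /side; case: ifP => _; exact: measurable_itv. Qed.

Lemma side_finite i : (mu (side i) < +oo)%E.
Proof.
rewrite /side; case: ifP => _.
  by apply: (@itv_finite R _ _ false); lra.
exact: (@itv_finite R _ _ true).
Qed.

Lemma measurable_Omega : measurable Omega.
Proof. by rewrite OmegaE; apply: measurable_box => i; exact: measurable_side. Qed.

Lemma Omega_finite : (leb R n.+1 Omega < +oo)%E.
Proof.
rewrite OmegaE; apply: box_finite => i; [exact: measurable_side|exact: side_finite].
Qed.

Lemma mode_orth i m m' :
  \int[mu]_(x in side i) (mode i m x * mode i m' x) = (m == m')%:R.
Proof.
rewrite /side /mode /mode_amp /mode_freq /mode_phase; case: ifP => _.
  exact: sine_orth.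
exact: (@torus_orth R 1 m m' true).
Qed.

Lemma dmode_orth i m m' :
  \int[mu]_(x in side i) (dmode i m x * dmode i m' x) =
  mode_freq i m' ^+ 2 * (m == m')%:R.
Proof.
rewrite -(mode_orth i).
rewrite /side /dmode /mode /mode_amp /mode_freq /mode_phase; case: ifP => _.
  apply: (@int_dwave_dwave R _ _ false); first lra.
  by rewrite [X in X * _]sine_mode_right [X in _ = X * _]sine_mode_left !mul0r.
by apply: (@int_dwave_dwave R _ _ true) => //; exact: torus_bdry.
Qed.

Lemma tensorM (F G : 'I_n.+1 -> R -> R) u :
  tensor F u * tensor G u = tensor (fun i x => F i x * G i x) u.
Proof. by rewrite /tensor big_split. Qed.

Lemma measurable_mode i m : measurable_fun setT (mode i m).
Proof. by have [] := bmeas_wave (mode_amp i m) (mode_freq i m) (mode_phase i m) setT. Qed.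

Lemma measurable_dmode i m : measurable_fun setT (dmode i m).
Proof. by rewrite /dmode; case: (bmeas_wave (mode_amp i m * mode_freq i m)
  (mode_freq i m) (mode_phase i m + pi / 2) setT). Qed.

Lemma bmeas_mode i m D : bmeas D (mode i m).
Proof. exact: bmeas_wave. Qed.

Lemma bmeas_dmode i m D : bmeas D (dmode i m).
Proof. exact: bmeas_wave. Qed.

Lemma bmeas_tensor_Omega (F : 'I_n.+1 -> R -> R) :
  (forall i, measurable_fun setT (F i)) ->
  (forall i, bmeas (side i) (F i)) -> bmeas Omega (tensor F).
Proof.
by move=> mF bF; rewrite OmegaE; apply: bmeas_tensor => // i; case: (bF i).
Qed.

Lemma bmeas_eigenfun k : bmeas Omega (eigenfun k).
Proof.
by apply: bmeas_tensor_Omega => i; [exact: measurable_mode|exact: bmeas_mode].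
Qed.

Lemma bmeas_deigenfun j k : bmeas Omega (deigenfun j k).
Proof.
apply: bmeas_tensor_Omega => i; rewrite /upd; case: ifP => _.
- exact: measurable_dmode.
- exact: measurable_mode.
- exact: bmeas_dmode.
- exact: bmeas_mode.
Qed.

Lemma int_tensor_Omega (F : 'I_n.+1 -> R -> R) :
  (forall i, bmeas (side i) (F i)) ->
  \int[leb R n.+1]_(u in Omega) tensor F u = \prod_i \int[mu]_(x in side i) F i x.
Proof.
move=> bF; rewrite OmegaE; apply: int_tensor => //.
- exact: measurable_side.
- exact: side_finite.
Qed.

Lemma prod_eq_ffun k l : \prod_i (k i == l i)%:R = (k == l)%:R :> R.
Proof.
have [->|kl] := eqVneq k l; first by rewrite big1// => i _; rewrite eqxx.
have [i ki] : exists i, k i != l i.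
  apply/existsP; rewrite -negb_forall; apply: contra kl => /forallP H.
  by apply/eqP/ffunP => i; apply/eqP.
by rewrite (bigD1 i)//= (negbTE ki) mul0r.
Qed.

Lemma eigenfun_orth k l :
  \int[leb R n.+1]_(u in Omega) (eigenfun k u * eigenfun l u) = (k == l)%:R.
Proof.
under eq_Rintegral do rewrite tensorM.
rewrite int_tensor_Omega; last by move=> i; apply: bmeasM; exact: bmeas_mode.
rewrite -prod_eq_ffun; apply: eq_bigr => i _; exact: mode_orth.
Qed.

Lemma deigenfun_orth j k l :
  \int[leb R n.+1]_(u in Omega) (deigenfun j k u * deigenfun j l u) =
  mode_freq j (l j) ^+ 2 * (k == l)%:R.
Proof.
under eq_Rintegral do rewrite tensorM.
rewrite int_tensor_Omega; last first.
  by move=> i; apply: bmeasM; rewrite /upd; case: ifP => _;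
    do ?[exact: bmeas_mode|exact: bmeas_dmode].
rewrite -prod_eq_ffun (bigD1 j)//= [in RHS](bigD1 j)//= mulrA; congr (_ * _).
  by rewrite /upd eqxx; exact: dmode_orth.
apply: eq_bigr => i ij; rewrite /upd (negbTE ij); exact: mode_orth.
Qed.

Definition cutoff_modes (N : nat) : seq {ffun 'I_n.+1 -> nat} :=
  [seq [ffun i => val (x i)] | x : {ffun 'I_n.+1 -> 'I_N}].

Lemma mem_cutoff_modes N k : (forall i, k i < N)%N -> k \in cutoff_modes N.
Proof.
move=> kN; apply/mapP; exists [ffun i => Ordinal (kN i)]; first by rewrite mem_enum.
by apply/ffunP => i; rewrite !ffunE.
Qed.

Lemma eigenfun_system :
  orthonormal_system (leb R n.+1) Omega eigenfun cutoff_modes.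
Proof.
split.
- exact: measurable_Omega.
- exact: Omega_finite.
- exact: bmeas_eigenfun.
- exact: eigenfun_orth.
- move=> N; rewrite map_inj_uniq ?enum_uniq// => x y /ffunP xy.
  by apply/ffunP => i; apply/val_inj; have := xy i; rewrite !ffunE.
- move=> k; exists (\max_i k i).+1 => // N /= kN.
  by apply: mem_cutoff_modes => i; apply: leq_trans kN; rewrite ltnS leq_bigmax.
Qed.

Local Notation apx := (approximable (leb R n.+1) Omega eigenfun cutoff_modes).
Local Notation mult := (multiplier (leb R n.+1) Omega eigenfun cutoff_modes).

Lemma tensor_upd (F : 'I_n.+1 -> R -> R) i (f : R -> R) u :
  tensor (upd F i f) u = f (u 0 i) * \prod_(j | j != i) F j (u 0 j).
Proof.
rewrite /tensor (bigD1 i)//= /upd eqxx; congr (_ * _).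
by apply: eq_bigr => j /negbTE ->.
Qed.

Lemma eigenfunE k i u :
  eigenfun k u = mode i (k i) (u 0 i) * \prod_(j | j != i) modes k j (u 0 j).
Proof. by rewrite /eigenfun /tensor (bigD1 i). Qed.

(** The hypothesis is a closure property in one variable. It is quantified over
    the class [V] because it is used for the functions of coordinate [i] whose
    product with the other factors of a given mode is approximable. *)
Lemma coordinate_multiplier i (p : R -> R) : bmeas setT p ->
  (forall V : (R -> R) -> Prop,
    (forall a f g, V f -> V g -> V (fun x => a * f x + g x)) ->
    (forall m, V (mode i m)) -> forall m, V (fun x => p x * mode i m x)) ->
  mult (fun u => p (u 0 i)).
Proof.
move=> [mp [M pM]] H; apply: (multiplier_gen eigenfun_system).
  split; last by exists M => u _; exact: pM.
  by apply: measurable_funTS; exact: (measurableT_comp mp (measurable_coord i)).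
move=> k.
have := H (fun f => apx (tensor (upd (modes k) i f))) _ _ (k i).
have -> : tensor (upd (modes k) i (fun x => p x * mode i (k i) x)) =
    fun u => p (u 0 i) * eigenfun k u.
  by apply/funext => u; rewrite tensor_upd (eigenfunE k i) mulrA.
apply.
- move=> a f g Vf Vg; have := approximable_comb eigenfun_system a Vf Vg.
  congr approximable; apply/funext => u; rewrite !tensor_upd; ring.
- move=> m; have := approximable_e eigenfun_system [ffun j => if j == i then m else k j].
  congr approximable; apply/funext => u; rewrite tensor_upd (eigenfunE _ i).
  rewrite ffunE eqxx; congr (_ * _); apply: eq_bigr => j ji.
  by rewrite /modes ffunE (negbTE ji).
Qed.

(** The function cos (pi (x + 1) / 2) decreases on [-1, 1], so that half spaces in
    the first coordinate are superlevel sets of a multiplier. *)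
Lemma multiplier_coord0_lt (c : R) : mult (\1_[set u : Rd | u 0 ord0 < c]).
Proof.
have [c1|c1] := leP c (-1).
  apply: (multiplier_triv eigenfun_system (P := False)) => u [/andP[u0 _] _]; split => //= H.
  by have := lt_le_trans H c1; rewrite ltNge (ltW u0).
have [c2|c2] := leP 1 c.
  apply: (multiplier_triv eigenfun_system (P := True)) => u [/andP[_ u1] _]; split => //= _.
  exact: lt_le_trans u1 c2.
have P := pi_gt0 R.
have mc : mult (fun u => cos (pi / 2 * (u 0 ord0 + 1))).
  apply: (@coordinate_multiplier ord0 (fun x => cos (pi / 2 * (x + 1)))).
    apply: (@bmeas_continuous_bounded _ _ 1); last by move=> x; exact: cos_max.
    move=> x; apply: continuous_comp; last exact: continuous_cos.
    by apply: cvgM; [exact: cvg_cst|apply: cvgD; [exact: cvg_id|exact: cvg_cst]].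
  by move=> V VD Vm m; apply: sine_mul_cos.
have := multiplier_gt eigenfun_system (cos (pi / 2 * (c + 1))) mc.
apply: (multiplier_indic_ext eigenfun_system) => u [/andP[u0 u1] _] /=.
rewrite ltr_cos.
- by rewrite ltr_pM2l ?divr_gt0// ltrD2r.
- by rewrite in_itv/=; apply/andP; split; nra.
- by rewrite in_itv/=; apply/andP; split; nra.
Qed.

Lemma multiplier_coord_lt i (c : R) : mult (\1_[set u : Rd | u 0 i < c]).
Proof.
have [->|i0] := eqVneq i ord0; first exact: multiplier_coord0_lt.
have P := pi_gt0 R.
pose t (x : R) : R := 2 * pi / 1 * x.
have ct : continuous t by move=> x; apply: cvgM; [exact: cvg_cst|exact: cvg_id].
have modeE m : mode i m = torus_mode 1 m.
  by rewrite /mode /mode_amp /mode_freq /mode_phase (negbTE i0).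
have mc : mult (fun u => cos (t (u 0 i))).
  apply: (@coordinate_multiplier i (fun x => cos (t x))).
    apply: (@bmeas_continuous_bounded _ _ 1); last by move=> x; exact: cos_max.
    by move=> x; apply: continuous_comp; [exact: ct|exact: continuous_cos].
  move=> V VD Vm m; rewrite modeE; apply: torus_mul_cos => // m'.
  by rewrite -modeE.
have ms : mult (fun u => sin (t (u 0 i))).
  apply: (@coordinate_multiplier i (fun x => sin (t x))).
    apply: (@bmeas_continuous_bounded _ _ 1); last by move=> x; exact: sin_max.
    by move=> x; apply: continuous_comp; [exact: ct|exact: continuous_sin].
  move=> V VD Vm m; rewrite modeE; apply: torus_mul_sin => // m'.
  by rewrite -modeE.
have tu u : Omega u -> 0 <= t (u 0 i) < 2 * pi.
  by move=> [_ /(_ i i0)/andP[u0 u1]]; rewrite /t divr1; apply/andP; split; nra.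
have := multiplier_angle_lt eigenfun_system tu mc ms (t c).
apply: (multiplier_indic_ext eigenfun_system) => u Ou /=.
by rewrite /t ltr_pM2l// divr_gt0// mulr_gt0.
Qed.

Lemma multiplier_measurable (E : set Rd) : measurable E -> mult (\1_E).
Proof.
have S := multiplier_sigma_algebra eigenfun_system.
have sub : @measurable _ Rd `<=` [set E | mult (\1_E)]; last exact (sub E).
apply: smallest_sub; first exact: S.
move=> A /=; rewrite -bigcup_seq => -[i _ [B mB <-]] /=.
rewrite setTI; apply: (multiplier_preimage eigenfun_system) mB.
by move=> c; exact: multiplier_coord_lt.
Qed.

Lemma mode_pos i x : side i x -> 0 < mode i 0 x.
Proof.
have P := pi_gt0 R.
rewrite /side /mode /mode_amp /mode_freq /mode_phase; case: ifP => _ /=.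
  rewrite in_itv/= => /andP[x0 x1].
  rewrite [ltRHS]sine_modeE mul1r; apply: sin_gt0_pi; apply/andP; split; nra.
move=> _; rewrite /wave /torus_freq/= !mul0r add0r /torus_phase/= sin_pihalf mulr1.
by rewrite sqrtr_gt0 divr_gt0.
Qed.

(** The indicators of half spaces are multipliers, hence so are those of all
    measurable sets; the lowest mode is positive on the domain. *)
Theorem eigenfun_complete (f : Rd -> R) : bmeas Omega f -> apx f.
Proof.
move=> bf; pose k0 : {ffun 'I_n.+1 -> nat} := [ffun=> 0%N].
apply: (approximable_bmeas eigenfun_system multiplier_measurable
  (approximable_e eigenfun_system k0) _ bf).
move=> u; rewrite OmegaE => uO; apply: prodr_gt0 => i _.
by rewrite /modes ffunE; apply: mode_pos; exact: uO.
Qed.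

End space_modes.

(** * The Fourier system in time *)

Section time_modes.
Variables (R : realType) (T : R).
Hypothesis T0 : 0 < T.
Local Notation mu := (@lebesgue_measure R).
Local Notation D := (`]0, T[%classic : set (measurableTypeR R)).

(** The odd number of indices keeps the cosine and the sine of a frequency
    together, so that the span is stable under derivation. *)
Definition time_cutoff (M : nat) : seq nat := iota 0 M.*2.+1.

Lemma time_system : @orthonormal_system _ (measurableTypeR R) R mu D _ (torus_mode T) time_cutoff.
Proof.
split.
- exact: measurable_itv.
- exact: (@itv_finite R _ _ false T0).
- by move=> j; exact: bmeas_wave.
- move=> j k; exact: (@torus_orth R T j k false T0).
- by move=> M; exact: iota_uniq.
- by move=> j; exists j => // M /= jM; rewrite mem_iota add0n leq0n /=; lia.
Qed.

Local Notation apx := (approximable mu D (torus_mode T) time_cutoff).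
Local Notation mult := (multiplier mu D (torus_mode T) time_cutoff).

Let angle (x : R) : R := 2 * pi / T * x.

Lemma time_multiplier (p : R -> R) : bmeas setT p ->
  (forall V : (R -> R) -> Prop,
    (forall a f g, V f -> V g -> V (fun x => a * f x + g x)) ->
    (forall m, V (torus_mode T m)) -> forall m, V (fun x => p x * torus_mode T m x)) ->
  mult p.
Proof.
move=> [mp [M pM]] H; apply: (multiplier_gen time_system).
  by split; [exact: measurable_funTS|exists M => x _; exact: pM].
apply: (H (fun f => apx f)) => [a f g Vf Vg|m].
  exact: (approximable_comb time_system a Vf Vg).
exact: (approximable_e time_system).
Qed.

Theorem time_complete (f : R -> R) : bmeas D f -> apx f.
Proof.
move=> bf; have P := pi_gt0 R.
have ct : continuous angle by move=> x; apply: cvgM; [exact: cvg_cst|exact: cvg_id].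
have mc : mult (fun x => cos (angle x)).
  apply: time_multiplier => [|V VD Vm m]; last exact: torus_mul_cos.
  apply: (@bmeas_continuous_bounded _ _ 1); last by move=> x; exact: cos_max.
  by move=> x; apply: continuous_comp; [exact: ct|exact: continuous_cos].
have ms : mult (fun x => sin (angle x)).
  apply: time_multiplier => [|V VD Vm m]; last exact: torus_mul_sin.
  apply: (@bmeas_continuous_bounded _ _ 1); last by move=> x; exact: sin_max.
  by move=> x; apply: continuous_comp; [exact: ct|exact: continuous_sin].
have angle02 x : D x -> 0 <= angle x < 2 * pi.
  rewrite /= in_itv/= => /andP[x0 xT]; rewrite /angle; apply/andP; split.
    by rewrite mulr_ge0 ?divr_ge0 ?mulr_ge0 ?ltW.
  by rewrite mulrAC ltr_pdivrMr// ltr_pM2l ?mulr_gt0.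
have mlt c : mult (\1_[set x | x < c]).
  have := multiplier_angle_lt time_system angle02 mc ms (angle c).
  apply: (multiplier_indic_ext time_system) => x Dx /=.
  by rewrite /angle ltr_pM2l// divr_gt0// mulr_gt0.
have mE (E : set (measurableTypeR R)) : measurable E -> mult (\1_E).
  move=> mE; have := multiplier_preimage time_system (u := id) mlt mE.
  by rewrite preimage_id.
apply: (approximable_bmeas time_system mE (approximable_e time_system 0%N) _ bf).
move=> x _; rewrite /torus_mode /wave /torus_freq/= !mul0r add0r /torus_phase/=.
by rewrite sin_pihalf mulr1 sqrtr_gt0 divr_gt0.
Qed.

End time_modes.

(** * Directional derivatives of sums of waves *)

Section one_sided_derivatives.
Variables (R : realType) (V : normedModType R).
Implicit Types (D : set V) (f g : V -> R) (v x : V).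

(** A two-sided derivative along a line. It determines the derivatives relative to
    every set in which the point has admissible increments. *)
Definition is_der v f x (l : R) : Prop := is_derive (0 : R) 1 (fun h : R => f (h *: v + x)) l.

Lemma is_der_cvg v f x l : is_der v f x l -> dquot f v x h @[h --> 0^'] --> l.
Proof.
move=> [df dE]; pose F h := f (h *: v + x).
have E : (fun h : R => h^-1 *: ((F \o shift 0) (h *: 1) - F 0)) = dquot f v x.
  by apply/funext => h /=; rewrite /dquot /F scale0r !add0r addr0 -[h%:A]/(h * 1) mulr1.
have {}df : cvg (dquot f v x h @[h --> 0^']) by rewrite -E.
by rewrite -dE /derive E.
Qed.

Section der.
Variables (D : set V) (v x : V).
Hypotheses (Dx : D x) (DF : ProperFilter (dfilter D v x)).

Lemma is_der_der_ext f g l : (forall y, D y -> f y = g y) -> is_der v g x l ->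
  derivable_on D v f x /\ der D v f x = l.
Proof.
move=> fg /is_der_cvg H.
have H' : dquot f v x h @[h --> dfilter D v x] --> l.
  have : dquot g v x h @[h --> dfilter D v x] --> l by exact: cvg_within_filter.
  apply: cvg_trans; apply: near_eq_cvg.
  rewrite /dfilter /prop_near1 /= /within/=; apply: nearW => h Dh.
  by rewrite /dquot !fg.
by split; [apply/cvg_ex; exists l|exact: cvg_lim].
Qed.

Lemma is_der_der f l : is_der v f x l -> derivable_on D v f x /\ der D v f x = l.
Proof. exact: is_der_der_ext. Qed.

End der.

(** At a boundary point only the increments of one sign [s] may be admissible. *)
Lemma dfilter_proper D v x (s e : R) : `|s| = 1 -> 0 < e ->
  (forall h, 0 < h < e -> D ((s * h) *: v + x)) -> ProperFilter (dfilter D v x).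
Proof.
move=> s1 e0 H; apply: Build_ProperFilter_ex.
move=> P; rewrite /dfilter /within /= => HP.
have : \forall h \near (0 : R)^', `|h| < e by exact: dnbhs0_lt.
move=> /(filterI HP) [r r0 Hr].
have m0 : 0 < Num.min e r / 2 by rewrite divr_gt0// lt_min e0.
have me : Num.min e r / 2 < e.
  rewrite ltr_pdivrMr// (@le_lt_trans _ _ e)//; first by rewrite ge_min lexx.
  by rewrite ltr_pMr// ltr1n.
have mr : Num.min e r / 2 < r.
  rewrite ltr_pdivrMr// (@le_lt_trans _ _ r)//; first by rewrite ge_min lexx orbT.
  by rewrite ltr_pMr// ltr1n.
exists (s * (Num.min e r / 2)).
have [] := Hr (s * (Num.min e r / 2)).
- by rewrite /= sub0r normrN normrM s1 mul1r gtr0_norm.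
- by rewrite -normr_gt0 normrM s1 mul1r gtr0_norm.
by move=> + _; apply; apply: H; rewrite m0.
Qed.

Lemma dfilter_proper_itv D v x (y : V -> R) (a b : R) : a < b ->
  (forall h z, y (h *: v + z) = h + y z) ->
  (forall h z, D z -> a <= y (h *: v + z) <= b -> D (h *: v + z)) ->
  (forall z, D z -> a <= y z <= b) -> D x -> ProperFilter (dfilter D v x).
Proof.
move=> ab yv DV Dy Dx; have /andP[ya yb] := Dy x Dx.
have [yb'|yb'] := ltP (y x) b.
  apply: (@dfilter_proper _ _ _ 1 (b - y x)); [exact: normr1|by rewrite subr_gt0|].
  by move=> h /andP[h0 hb]; apply: DV => //; rewrite mul1r yv; apply/andP; split; lra.
apply: (@dfilter_proper _ _ _ (-1) (b - a)); [by rewrite normrN normr1|by rewrite subr_gt0|].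
by move=> h /andP[h0 hb]; apply: DV => //; rewrite mulN1r yv; apply/andP; split; lra.
Qed.

Lemma dfilter_properT D v x : (forall h, D (h *: v + x)) -> ProperFilter (dfilter D v x).
Proof. by move=> H; apply: (@dfilter_proper _ _ _ 1 1) => //; exact: normr1. Qed.

(** In a class of everywhere smooth functions that is stable under derivation, the
    iterated derivatives relative to [D] agree on [D] with members of the class. *)
Lemma Ck_class D (vs : set V) (S : set (V -> R)) :
  (forall v x, vs v -> D x -> ProperFilter (dfilter D v x)) ->
  (forall f, S f -> continuous f) ->
  (forall f v, S f -> vs v ->
     exists2 f', S f' & forall x, D x -> is_der v f x (f' x)) ->
  forall k f g, S g -> (forall x, D x -> f x = g x) -> Ck D vs k f.
Proof.
move=> PF Sc Sd.
have cf f g : S g -> (forall x, D x -> f x = g x) -> {within D, continuous f}.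
  move=> Sg fg; apply: (subspace_eq_continuous (f := g)).
    by move=> x /set_mem/fg.
  exact: continuous_subspaceT (Sc _ Sg).
elim => [|k IH] f g Sg fg; first by split => //; exact: cf fg.
split; first exact: cf fg.
move=> v vv; have [g' Sg' gg'] := Sd g v Sg vv; split.
  by move=> x Dx; have [] := is_der_der_ext Dx (PF v x vv Dx) fg (gg' x Dx).
apply: (IH _ g') => // x Dx.
by have [] := is_der_der_ext Dx (PF v x vv Dx) fg (gg' x Dx).
Qed.

End one_sided_derivatives.

(** Functions of [x : V] that are combinations of products of waves in the
    coordinates of [prj x], with coefficients constant along the directions
    [vec i]: this covers functions on space as well as on space-time. *)
Section wave_sums.
Variables (R : realType) (n : nat) (V : normedModType R).
Local Notation Rd := 'rV[R]_n.+1.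
Variables (prj : V -> Rd) (vec : 'I_n.+1 -> V).
Hypothesis prj_cont : continuous prj.
Hypothesis prj_vec : forall i h x, prj (h *: vec i + x) = h *: evec R i + prj x.
Variables (I : Type) (s : seq I).

Definition coefficient (g : V -> R) : Prop :=
  continuous g /\ forall i h x, g (h *: vec i + x) = g x.

(** Parameters, rather than functions, are kept so that a derivative of a sum of
    waves is syntactically such a sum again. *)
Record wave_param := WaveParam { wamp : R; wfreq : R; wphase : R }.
Definition wave_of p := wave (wamp p) (wfreq p) (wphase p).
Definition dparam p := WaveParam (wamp p * wfreq p) (wfreq p) (wphase p + pi / 2).

Definition wave_sum (g : I -> V -> R) (p : I -> 'I_n.+1 -> wave_param) (x : V) : R :=
  \sum_(k <- s) g k x * tensor (fun i => wave_of (p k i)) (prj x).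

Definition dparams i (p : I -> 'I_n.+1 -> wave_param) k j :=
  if j == i then dparam (p k j) else p k j.

Lemma continuous_wave_sum g p : (forall k, coefficient (g k)) ->
  continuous (wave_sum g p).
Proof.
move=> Cg; apply: continuous_big => [|k _]; first exact: add_continuous.
suff ct : continuous (fun x => tensor (fun i => wave_of (p k i)) (prj x)).
  by move=> x; apply: cvgM; [exact: (Cg k).1|exact: ct].
rewrite /tensor; apply: continuous_big => [|i _]; first exact: mul_continuous.
have c1 : continuous (fun y => prj y 0 i).
  move=> y; apply: (@continuous_comp _ _ _ prj (fun M : Rd => M 0 i)).
    exact: prj_cont.
  exact: coord_continuous.
move=> x; apply: (@continuous_comp _ _ _ (fun y => prj y 0 i) (wave_of (p k i))).
  exact: c1.
exact: continuous_wave.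
Qed.

Lemma is_der_wave_sum g p i x : (forall k, coefficient (g k)) ->
  is_der (vec i) (wave_sum g p) x (wave_sum g (dparams i p) x).
Proof.
move=> Cg; rewrite /is_der.
pose c k := g k x * \prod_(j | j != i) wave_of (p k j) (prj x 0 j).
have E : (fun h : R => wave_sum g p (h *: vec i + x)) =
    fun h => \sum_(k <- s) c k * wave_of (p k i) (h + prj x 0 i).
  apply/funext => h; apply: eq_bigr => k _; rewrite (Cg k).2 /c -mulrA; congr (_ * _).
  rewrite prj_vec /tensor (bigD1 i)//= mulrC; congr (_ * _).
    apply: eq_bigr => j ji; congr (wave_of _ _).
    by rewrite !mxE (negbTE ji) andbF mulr0 add0r.
  by rewrite !mxE !eqxx mulr1.
have E' : wave_sum g (dparams i p) x =
    \sum_(k <- s) c k * wave_of (dparam (p k i)) (prj x 0 i).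
  apply: eq_bigr => k _; rewrite /c -mulrA; congr (_ * _).
  rewrite /tensor (bigD1 i)//= mulrC; congr (_ * _).
    by apply: eq_bigr => j ji; rewrite /dparams (negbTE ji).
  by rewrite /dparams eqxx.
rewrite E E' {E E'}; elim: s => [|k r IH].
  rewrite big_nil (_ : (fun _ => _) = cst 0); first exact: is_derive_cst.
  by apply/funext => h; rewrite big_nil.
rewrite big_cons (_ : (fun _ => _) = (fun h => c k * wave_of (p k i) (h + prj x 0 i)) +
    (fun h => \sum_(k <- r) c k * wave_of (p k i) (h + prj x 0 i))); last first.
  by apply/funext => h; rewrite big_cons.
apply: is_deriveD.
have H1 : is_derive (0 : R) 1 (fun h : R => h + prj x 0 i) 1.
  by apply: is_derive_eq; rewrite addr0.
have H2 := @is_derive1_comp R (wave_of (p k i)) _ (0:R) _ _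
  (is_derive_wave _ _ _ (0 + prj x 0 i)) H1.
have := @is_deriveZ R R R _ (c k) (0:R) 1 _ H2.
by rewrite add0r mulr1.
Qed.

Variable D : set V.
Hypothesis D_proper : forall i x, D x -> ProperFilter (dfilter D (vec i) x).

Lemma Ck_wave_sum k g p : (forall k, coefficient (g k)) ->
  Ck D (range vec) k (wave_sum g p).
Proof.
move=> Cg.
apply: (Ck_class (S := [set f | exists p, f = wave_sum g p]) _ _ _ _ (g := wave_sum g p)).
- by move=> v x [i _ <-]; exact: D_proper.
- by move=> _ [q ->]; exact: continuous_wave_sum.
- move=> _ v [q ->] [i _ <-]; exists (wave_sum g (dparams i q)); first by exists (dparams i q).
  by move=> x _; exact: is_der_wave_sum.
- by exists p.
- by [].
Qed.

Lemma der_wave_sum g p i x : (forall k, coefficient (g k)) -> D x ->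
  der D (vec i) (wave_sum g p) x = wave_sum g (dparams i p) x.
Proof.
by move=> Cg Dx; have [] := is_der_der Dx (D_proper i Dx) (is_der_wave_sum p i x Cg).
Qed.

Lemma laplacian_wave_sum g p x : (forall k, coefficient (g k)) -> D x ->
  laplacian D vec (wave_sum g p) x =
  - \sum_(k <- s) (\sum_i wfreq (p k i) ^+ 2) * g k x *
      tensor (fun i => wave_of (p k i)) (prj x).
Proof.
move=> Cg Dx; rewrite /laplacian.
transitivity (\sum_i wave_sum g (dparams i (dparams i p)) x).
  apply: eq_bigr => i _.
  have fg y : D y -> der D (vec i) (wave_sum g p) y = wave_sum g (dparams i p) y.
    exact: der_wave_sum.
  by have [] := is_der_der_ext Dx (D_proper i Dx) fg (is_der_wave_sum _ i x Cg).
rewrite exchange_big -sumrN; apply: eq_bigr => k _.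
rewrite !mulr_suml -sumrN; apply: eq_bigr => i _.
rewrite [RHS](_ : _ = - wfreq (p k i) ^+ 2 * (g k x * tensor (fun i => wave_of (p k i)) (prj x))).
  rewrite mulrCA; congr (_ * _); rewrite /tensor (bigD1 i)//= [in RHS](bigD1 i)//= mulrA.
  congr (_ * _).
    rewrite /dparams eqxx /=.
    exact: (congr1 (fun f => f (prj x 0 i)) (ddwave (wamp (p k i)) (wfreq (p k i)) (wphase (p k i)))).
  by apply: eq_bigr => j ji; rewrite /dparams (negbTE ji).
by ring.
Qed.

End wave_sums.

(** * Test functions *)

Section test_functions.
Variables (R : realType) (n : nat).
Local Notation Rd := 'rV[R]_n.+1.
Local Notation RxRd := (R^o * 'rV[R]_n.+1)%type.
Local Notation idx := {ffun 'I_n.+1 -> nat}.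
Implicit Types (k : idx) (s : seq idx).

Definition mode_param k i := WaveParam (mode_amp R i (k i)) (mode_freq R i (k i))
  (mode_phase R i (k i)).

Lemma eigenfun_period k u v : @torus_dirs R n v -> eigenfun k (u + v) = eigenfun k u.
Proof.
move=> [i i0 <-]; apply: eq_bigr => j _; rewrite !mxE.
case: (eqVneq j i) => [->|_] /=; last by rewrite addr0.
rewrite /modes /mode /mode_amp /mode_freq /mode_phase (negbTE i0).
exact: (torus_mode_period (k i) (u 0 i) ltr01).
Qed.

Lemma eigenfun_boundary k u : @GammaU R n u -> eigenfun k u = 0.
Proof.
move=> u0; rewrite (eigenfunE k ord0) (_ : mode _ _ _ = 0) ?mul0r//.
rewrite /mode /mode_amp /mode_freq /mode_phase eqxx.
by case: u0 => ->; [exact: sine_mode_left|exact: sine_mode_right].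
Qed.

Lemma cOmegaU_proper i (u : Rd) :
  cOmegaU u -> ProperFilter (dfilter (@cOmegaU R n) (evec R i) u).
Proof.
move=> Du; have [->|i0] := eqVneq i ord0.
  apply: (@dfilter_proper_itv _ _ _ _ _ (fun u : Rd => u 0 ord0) (-1) 1).
  - lra.
  - by move=> h z; rewrite !mxE !eqxx mulr1.
  - by [].
  - by [].
  - exact: Du.
apply: dfilter_properT => h; rewrite /cOmegaU /= !mxE eq_sym (negbTE i0) andbF.
by rewrite mulr0 add0r.
Qed.

Lemma Omega_cOmegaU u : @Omega R n u -> cOmegaU u.
Proof. by move=> [/andP[/ltW a /ltW b] _]; rewrite /cOmegaU /= a b. Qed.

Definition space_sum s (c : idx -> R) (u : Rd) : R := \sum_(k <- s) c k * eigenfun k u.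

Lemma space_sumE s c : space_sum s c =
  wave_sum (fun u : Rd => u) s (fun k _ => c k) mode_param.
Proof. by []. Qed.

Let space_coef (c : idx -> R) k : coefficient (@evec R n) (fun _ : Rd => c k).
Proof. by split; [exact: cst_continuous|]. Qed.

Let id_cont : continuous (fun u : Rd => u).
Proof. by move=> u; exact: cvg_id. Qed.

Let id_vec i h (u : Rd) : h *: evec R i + u = h *: evec R i + u.
Proof. by []. Qed.

Lemma tensor_dmode k i u :
  tensor (fun j => wave_of (dparams i mode_param k j)) u = deigenfun i k u.
Proof.
apply: eq_bigr => j _; rewrite /dparams /upd; case: eqP => [->|_] //.
Qed.

Lemma space_sum_C2_0 s c : C2_0 (space_sum s c).
Proof.
split.
- move=> v u vt; apply: eq_bigr => k _; by rewrite eigenfun_period.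
- exact: (Ck_wave_sum id_cont id_vec s cOmegaU_proper 2 mode_param (space_coef c)).
- by move=> u u0; rewrite /space_sum big1// => k _; rewrite eigenfun_boundary ?mulr0.
Qed.

Lemma space_sum_laplacian s c u : cOmegaU u ->
  laplacian (@cOmegaU R n) (@evec R n) (space_sum s c) u =
  - \sum_(k <- s) eigenval R k * c k * eigenfun k u.
Proof.
move=> Du.
exact: (laplacian_wave_sum id_vec s cOmegaU_proper mode_param (space_coef c) Du).
Qed.

Lemma space_sum_der s c i u : cOmegaU u ->
  der (@cOmegaU R n) (evec R i) (space_sum s c) u =
  \sum_(k <- s) c k * deigenfun i k u.
Proof.
move=> Du; rewrite space_sumE.
rewrite (der_wave_sum id_vec s cOmegaU_proper mode_param i (space_coef c) Du).
by apply: eq_bigr => k _; rewrite tensor_dmode.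
Qed.

Variable T : R.
Hypothesis T0 : 0 < T.
Local Notation D := (@cOmegaU_T R n T).

Lemma cOmegaU_T_proper i (z : RxRd) :
  D z -> ProperFilter (dfilter D (space_vec R i) z).
Proof.
move=> Dz; have [->|i0] := eqVneq i ord0.
  apply: (@dfilter_proper_itv _ _ _ _ _ (fun z : RxRd => z.2 0 ord0) (-1) 1).
  - lra.
  - by move=> h y; rewrite !mxE !eqxx mulr1.
  - by move=> h y [y1 _]; rewrite /cOmegaU_T /= scaler0 add0r.
  - by move=> y [].
  - exact: Dz.
apply: dfilter_properT => h; move: Dz; rewrite /cOmegaU_T /cOmegaU /= scaler0 add0r.
by rewrite !mxE eq_sym (negbTE i0) andbF mulr0 add0r.
Qed.

Lemma cOmegaU_T_time_proper (z : RxRd) :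
  D z -> ProperFilter (dfilter D (time_vec R n) z).
Proof.
move=> Dz; apply: (@dfilter_proper_itv _ _ _ _ _ (fun z : RxRd => z.1) 0 T).
- exact: T0.
- by move=> h y /=; rewrite -[h *: 1]/(h * 1) mulr1.
- by move=> h y [_ y2] /= H; rewrite /cOmegaU_T /= scaler0 add0r.
- by move=> y [].
- exact: Dz.
Qed.

Variables (g dg : idx -> R -> R).
Hypothesis g_der : forall k (t : R), is_derive t 1 (g k) (dg k t).
Hypothesis dg_cont : forall k, continuous (dg k).

Definition spacetime_sum s (z : RxRd) : R := \sum_(k <- s) g k z.1 * eigenfun k z.2.

Lemma spacetime_sumE s : spacetime_sum s =
  wave_sum (fun z : RxRd => z.2) s (fun k z => g k z.1) mode_param.
Proof. by []. Qed.

Let g_cont k : continuous (g k).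
Proof.
move=> t; apply: differentiable_continuous; apply/derivable1_diffP.
by case: (g_der k t).
Qed.

Let fst_comp (f : R -> R) : continuous f -> continuous (fun z : RxRd => f z.1).
Proof.
move=> cf z; apply: (@continuous_comp _ _ _ (fun z : RxRd => z.1) f); last exact: cf.
exact: cvg_fst.
Qed.

Let snd_cont : continuous (fun z : RxRd => z.2).
Proof. by move=> z; exact: cvg_snd. Qed.

Let snd_vec i h (z : RxRd) : (h *: space_vec R i + z).2 = h *: evec R i + z.2.
Proof. by []. Qed.

Let time_coef (f : idx -> R -> R) k : continuous (f k) ->
  coefficient (@space_vec R n) (fun z : RxRd => f k z.1).
Proof.
move=> cf; split; first exact: fst_comp.
by move=> i h z /=; rewrite scaler0 add0r.
Qed.

Let spacetime_time_der s z : is_der (time_vec R n) (spacetime_sum s) z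
  (\sum_(k <- s) dg k z.1 * eigenfun k z.2).
Proof.
rewrite /is_der (_ : (fun h => _) = fun h => \sum_(k <- s) eigenfun k z.2 * g k (h + z.1)).
  elim: s => [|k s IH].
    rewrite big_nil (_ : (fun _ => _) = cst 0); first exact: is_derive_cst.
    by apply/funext => h; rewrite big_nil.
  rewrite big_cons (_ : (fun _ => _) = (fun h => eigenfun k z.2 * g k (h + z.1)) +
      (fun h => \sum_(k <- s) eigenfun k z.2 * g k (h + z.1))); last first.
    by apply/funext => h; rewrite big_cons.
  apply: is_deriveD.
  have H1 : is_derive (0 : R) 1 (fun h : R => h + z.1) 1.
    by apply: is_derive_eq; rewrite addr0.
  have H2 := @is_derive1_comp R (g k) _ (0:R) _ _ (g_der k (0 + z.1)) H1.
  have := @is_deriveZ R R R _ (eigenfun k z.2) (0:R) 1 _ H2.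
  by rewrite add0r mulr1 [dg k z.1 * _]mulrC.
apply/funext => h; apply: eq_bigr => k _ /=.
by rewrite scaler0 add0r mulrC -[h *: 1]/(h * 1) mulr1.
Qed.

Lemma spacetime_sum_dt s z : D z ->
  der D (time_vec R n) (spacetime_sum s) z = \sum_(k <- s) dg k z.1 * eigenfun k z.2.
Proof.
move=> Dz.
by have [] := is_der_der Dz (cOmegaU_T_time_proper Dz) (spacetime_time_der s z).
Qed.

Lemma spacetime_sum_C12_0 s : C12_0 T (spacetime_sum s).
Proof.
have cG (f : idx -> R -> R) : (forall k, continuous (f k)) ->
    continuous (fun z : RxRd => \sum_(k <- s) f k z.1 * eigenfun k z.2).
  move=> cf.
  have C k : coefficient (@space_vec R n) (fun z : RxRd => f k z.1).
    exact: time_coef.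
  exact: (@continuous_wave_sum R n RxRd (fun z : RxRd => z.2) (@space_vec R n)
    snd_cont idx s (fun k z => f k z.1) mode_param C).
split.
- move=> v z [i i0 <-]; apply: eq_bigr => k _ /=.
  by rewrite addr0 eigenfun_period//; exists i.
- split; first by apply: continuous_subspaceT; exact: cG.
  move=> _ ->; split.
    move=> z Dz.
    by have [] := is_der_der Dz (cOmegaU_T_time_proper Dz) (spacetime_time_der s z).
  split => //; apply: (subspace_eq_continuous
    (f := fun z : RxRd => \sum_(k <- s) dg k z.1 * eigenfun k z.2)).
    by move=> z /set_mem Dz; apply/esym; exact: spacetime_sum_dt.
  by apply: continuous_subspaceT; exact: cG.
- rewrite spacetime_sumE.
  have H := @Ck_wave_sum R n RxRd (fun z : RxRd => z.2) (@space_vec R n) snd_cont snd_vec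
    idx s D cOmegaU_T_proper 2 (fun k z => g k z.1) mode_param
    (fun k => time_coef (@g_cont k)).
  exact H.
- move=> t u _ u0; rewrite /spacetime_sum big1// => k _ /=.
  by rewrite eigenfun_boundary ?mulr0.
Qed.

Lemma spacetime_sum_der s i z : D z ->
  der D (space_vec R i) (spacetime_sum s) z = \sum_(k <- s) g k z.1 * deigenfun i k z.2.
Proof.
move=> Dz; rewrite spacetime_sumE.
have := @der_wave_sum R n RxRd (fun z : RxRd => z.2) (@space_vec R n) snd_vec
  idx s D cOmegaU_T_proper (fun k z => g k z.1) mode_param i z
  (fun k => time_coef (@g_cont k)) Dz.
move=> ->; by apply: eq_bigr => k _; rewrite tensor_dmode.
Qed.

Lemma spacetime_sum_laplacian s z : D z ->
  laplacian D (@space_vec R n) (spacetime_sum s) z =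
  - \sum_(k <- s) eigenval R k * g k z.1 * eigenfun k z.2.
Proof.
move=> Dz.
exact: (@laplacian_wave_sum R n RxRd (fun z : RxRd => z.2) (@space_vec R n) snd_vec
  idx s D cOmegaU_T_proper (fun k z => g k z.1) mode_param z
  (fun k => time_coef (@g_cont k)) Dz).
Qed.

End test_functions.

(** * Densities of measures *)

Section densities.
Variables (R : realType) (n : nat).
Local Notation Rd := 'rV[R]_n.+1.
Local Notation Omega := (@Omega R n).
Local Notation measureRd := {measure set 'rV[R]_n.+1 -> \bar R}.
Local Notation mO := (@measurable_Omega R n).
Local Notation fO := (@Omega_finite R n).

Lemma ae_eq_intO (f g : Rd -> R) : measurable_fun Omega f -> measurable_fun Omega g ->
  {ae leb R n.+1, forall u, Omega u -> f u = g u} -> intO f = intO g.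
Proof.
move=> mf mg fg; rewrite /intO /Rintegral; congr fine.
apply: ae_eq_integral; [exact: mO|exact/measurable_EFinP|exact/measurable_EFinP|].
by apply: filterS fg => u fgu Ou /=; rewrite fgu.
Qed.

(** A density lies in [0, 1] only almost everywhere. Clipping gives a version that
    does so everywhere, to which bounded integration applies. *)
Definition clip (r : R) : R := Num.max 0 (Num.min 1 r).

Lemma clip01 r : 0 <= clip r <= 1.
Proof. by rewrite /clip le_max lexx /= ge_max ler01 ge_min lexx. Qed.

Lemma clip_id r : 0 <= r <= 1 -> clip r = r.
Proof. by move=> /andP[r0 r1]; rewrite /clip min_r// max_r. Qed.

Lemma measurable_clip (f : Rd -> R) :
  measurable_fun Omega f -> measurable_fun Omega (clip \o f).
Proof.
move=> mf; apply: measurable_maxr; first exact: measurable_cst.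
by apply: measurable_minr; first exact: measurable_cst.
Qed.

Lemma is_density_clip (mu : measureRd) rho : is_density mu rho ->
  is_density mu (clip \o rho) /\
  {ae leb R n.+1, forall u, Omega u -> rho u = clip (rho u)}.
Proof.
move=> [mrho rho01 murho].
have E : {ae leb R n.+1, forall u, Omega u -> rho u = clip (rho u)}.
  by apply: filterS rho01 => u H Ou; rewrite clip_id// H.
split => //; split.
- exact: measurable_clip.
- by apply: aeW => u _; exact: clip01.
- move=> A mA; rewrite murho//; apply: ae_eq_integral.
  + by apply: measurableI => //; exact: mO.
  + by apply/measurable_EFinP; apply: measurable_funS mrho => //; exact: mO.
  + apply/measurable_EFinP; apply: measurable_funS (measurable_clip mrho) => //; exact: mO.
  + by apply: filterS E => u H [_ Ou] /=; rewrite -H.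
Qed.

(** For indicators this is the definition of a density; combinations and bounded
    limits give the other functions. *)
Lemma pairing_density (mu : measureRd) rho G : measM mu -> is_density mu rho ->
  (forall u, 0 <= rho u <= 1) -> bmeas Omega G ->
  pairing mu G = intO (fun u => rho u * G u).
Proof.
move=> [_ mu2] [mrho _ murho] rho01 bG.
have muO : (mu Omega < +oo)%E.
  apply: le_lt_trans (ltry 2); apply: le_trans mu2.
  by apply: le_measure; rewrite ?inE//; exact: mO.
have brho : bmeas Omega rho by exact: bmeas01.
suff : bmeas Omega G /\ pairing mu G = intO (fun u => rho u * G u) by case.
apply: (bmeas_ind mO (P := fun G => bmeas Omega G /\
  pairing mu G = intO (fun u => rho u * G u))) bG.
- move=> E mE; split.
    split; first by apply: measurable_funTS; exact: measurable_indic.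
    by exists 1 => u _; rewrite indicE; case: (_ \in _); rewrite ?normr1 ?normr0.
  rewrite /pairing /Rintegral integral_indic//; last exact: mO.
  rewrite murho; last by apply: measurableI => //; exact: mO.
  rewrite /intO /Rintegral; congr fine.
  rewrite -setIA setIid setIC integral_mkcondr; apply: eq_integral => u _.
  rewrite /patch indicE; case: ifP => _; by rewrite ?mulr1 ?mulr0.
- move=> a f g [bf pf] [bg pg]; split; first by apply: bmeasD => //; exact: bmeasZ.
  rewrite /pairing (intD mO muO)//; last exact: bmeasZ.
  rewrite (intZ mO muO)// -!/(pairing _ _) pf pg /intO.
  rewrite -(intZ mO fO); last exact: bmeasM.
  rewrite -(intD mO fO); [|by apply: bmeasZ; exact: bmeasM|exact: bmeasM].
  by apply: int_ext => u _; ring.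
- move=> h f M Ph hM hf.
  have mh k : measurable_fun Omega (h k) by case: (Ph k) => -[].
  have [bf cf] := bounded_cvg_bmeas mO muO mh hM hf; split => //.
  have hb k u : Omega u -> `|rho u * h k u| <= M.
    move=> Ou; have /andP[r0 r1] := rho01 u; rewrite normrM ger0_norm//.
    by apply: le_trans (hM k u Ou); rewrite ler_piMl.
  have hc u : Omega u -> rho u * h k u @[k --> \oo] --> rho u * f u.
    by move=> Ou; apply: cvgM; [exact: cvg_cst|exact: hf].
  have [_ cr] := bounded_cvg_bmeas mO fO (fun k => measurable_funM mrho (mh k)) hb hc.
  rewrite /pairing -(cvg_lim _ cf)// /intO -(cvg_lim _ cr)//.
  congr (lim (_ @ \oo)); apply/funext => k; exact: (Ph k).2.
Qed.

Lemma L2_norm_ge (f : Rd -> R) delta : bmeas Omega f -> 0 < delta ->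
  ~ (L2_norm f < delta%:E)%E -> delta ^+ 2 <= intO (fun u => f u ^+ 2).
Proof.
move=> bf d0 /negP; rewrite -leNgt /L2_norm => H.
have n2 : (2 : R) != 0 by [].
have E : (\int[leb R n.+1]_x (`|(EFin \o (f \_ Omega)) x| `^ 2) =
    (intO (fun u => f u ^+ 2))%:E)%E.
  rewrite /intO /Rintegral fineK; last first.
    by apply: (integrable_fin_num mO); apply: (bmeas_integrable mO fO); exact: bmeasX.
  rewrite [RHS]integral_mkcond; apply: eq_integral => u _.
  rewrite /= -[X in _ `^ X]/(2%:R) powR_mulrn// /patch; case: ifP => _ /=.
    by rewrite real_normK// num_real.
  by rewrite normr0 expr0n.
have H2 : (delta%:E `^ 2 <= ('N[leb R n.+1]_2%:E[EFin \o (f \_ Omega)]) `^ 2)%E.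
  apply: gt0_ler_poweR H => //.
  - by rewrite in_itv/= lee_fin ltW//= leey.
  - by rewrite in_itv/= Lnorm_ge0 leey.
move: H2; rewrite poweR_Lnorm// E poweR_EFin lee_fin.
by rewrite -[X in _ `^ X]/(2%:R) powR_mulrn// ltW.
Qed.

End densities.

(** * Measurability by discretization *)

Section discretization.
Variable R : realType.

Lemma measurable_discrete d (X : measurableType d) (C : countType) (q : X -> C)
    (g : C -> R) : (forall c, measurable (q @^-1` [set c])) ->
  measurable_fun setT (g \o q).
Proof.
move=> mq _ Y mY; rewrite setTI.
rewrite (_ : _ @^-1` Y = \bigcup_c (if g c \in Y then q @^-1` [set c] else set0)).
  by apply: countable_bigcupT_measurable => // c; case: ifP.
apply/seteqP; split => [x Yx|x [c _]] /=; first by exists (q x) => //; rewrite mem_set.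
by case: ifPn => // /set_mem Yc /= ->.
Qed.

Lemma measurable_floor_eq k (z : int) :
  measurable ([set t : R | Num.floor (t * k.+1%:R) = z] : set (measurableTypeR R)).
Proof.
rewrite (_ : [set t | _] = `[z%:~R / k.+1%:R, (z + 1)%:~R / k.+1%:R[%classic).
  exact: measurable_itv.
apply/seteqP; split => t /=.
  by move=> <-; rewrite in_itv/= ler_pdivrMr// ltr_pdivlMr// floor_itv.
rewrite in_itv/= ler_pdivrMr// ltr_pdivlMr// => H.
exact: floor_def.
Qed.

Lemma cvg_floor (t : R) (c : int) :
  (Num.floor (t * k.+1%:R) + c)%:~R / k.+1%:R @[k --> \oo] --> t.
Proof.
have H : (`|c%:~R| + 1) * k.+1%:R^-1 @[k --> \oo] --> (0 : R).
  rewrite -[X in _ --> X](mulr0 (`|c%:~R| + 1)).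
  by apply: cvgM; [exact: cvg_cst|exact: cvg_harmonic].
apply/cvgrPdist_le => e e0; move/cvgrPdist_le : H => /(_ e e0).
apply: filterS => k; rewrite sub0r normrN; apply: le_trans.
have /andP[f0 f1] := floor_itv (t * k.+1%:R).
have k0 : 0 < k.+1%:R^-1 :> R by [].
rewrite [leRHS]normrM (ger0_norm (ltW k0)) (_ : t - _ =
    (t * k.+1%:R - (Num.floor (t * k.+1%:R))%:~R - c%:~R) * k.+1%:R^-1); last first.
  by rewrite intrD; field.
rewrite normrM (ger0_norm (ltW k0)) ler_pM2r//.
apply: le_trans (ler_norm _).
rewrite (le_trans (ler_normB _ _))// addrC lerD2l.
rewrite ger0_norm ?subr_ge0//; move: f1; rewrite intrD; lra.
Qed.

Lemma right_continuous_measurable (c : R -> R) (T : R) :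
  (forall t, 0 <= t < T -> c s @[s --> t^'+] --> c t) ->
  measurable_fun (`]0, T[%classic : set (measurableTypeR R)) c.
Proof.
move=> cr.
(* The next point of the grid of mesh 1 / (k + 1): adding 1 to the floor puts it
   strictly to the right of [t]. *)
pose h (k : nat) (t : R) : R := c ((Num.floor (t * k.+1%:R) + 1)%:~R / k.+1%:R).
have hc (t : R) : `]0, T[%classic t -> h k t @[k --> \oo] --> c t.
  rewrite /= in_itv/= => /andP[t0 tT].
  have /= := cr t; rewrite (ltW t0) tT => /(_ isT); apply: cvg_trans.
  move=> A HA; have HA' : nbhs t (fun u => t < u -> A (c u)) by exact: HA.
  have H : \forall k \near \oo, t < (Num.floor (t * k.+1%:R) + 1)%:~R / k.+1%:R -> A (h k t).
    exact: (@cvg_floor t 1 _ HA').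
  suff : \forall k \near \oo, A (h k t) by [].
  apply: filterS H => k; apply; rewrite ltr_pdivlMr//.
  by have /andP[_] := floor_itv (t * k.+1%:R).
apply: (measurable_fun_cvg _ hc) => k; apply: measurable_funTS.
apply: (@measurable_discrete _ (measurableTypeR R) int
  (fun t : R => Num.floor (t * k.+1%:R)) (fun z => c ((z + 1)%:~R / k.+1%:R))).
exact: measurable_floor_eq.
Qed.

(** The sigma-algebra on rows is generated by the coordinates, so that continuity
    is exploited by sampling on grids rather than through open sets. *)
Lemma continuous_measurable_row n (f : 'rV[R]_n -> R) : continuous f ->
  measurable_fun setT f.
Proof.
move=> cf.
pose dsc k (u : 'rV[R]_n) : {ffun 'I_n -> int} := [ffun i => Num.floor (u 0 i * k.+1%:R)].
pose pt k (z : {ffun 'I_n -> int}) : 'rV[R]_n := \row_i ((z i + 0)%:~R / k.+1%:R).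
have fc u : setT u -> f (pt k (dsc k u)) @[k --> \oo] --> f u.
  move=> _; apply: (@cvg_comp _ _ _ (fun k => pt k (dsc k u)) f _ _ _ _ (cf u)).
  move=> A /nbhs_ballP[e e0 eA].
  suff : \forall k \near \oo, A (pt k (dsc k u)) by [].
  have H i : \forall k \near \oo, ball (u 0 i) e (pt k (dsc k u) 0 i).
    have H : \forall k \near \oo,
        ball (u 0 i) e ((Num.floor (u 0 i * k.+1%:R) + 0)%:~R / k.+1%:R).
      exact: (@cvg_floor (u 0 i) 0 _ (nbhsx_ballx (u 0 i) e e0)).
    by apply: filterS H => k /=; rewrite mxE ffunE.
  have H' : \forall k \near \oo, forall i, ball (u 0 i) e (pt k (dsc k u) 0 i).
    exact: filter_forall H.
  apply: filterS H' => k Hk; apply: eA; split => //.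
  by move=> i j; rewrite ord1; exact: Hk.
apply: (measurable_fun_cvg _ fc) => k.
apply: (@measurable_discrete _ _ {ffun 'I_n -> int} (dsc k) (f \o pt k)) => z.
rewrite (_ : _ @^-1` _ = \bigcap_(i in [set: 'I_n])
  ((fun u : 'rV[R]_n => u 0 i : measurableTypeR R) @^-1`
    [set t | Num.floor (t * k.+1%:R) = z i])).
  apply: fin_bigcap_measurable => // i _.
  rewrite -[X in measurable X]setTI; apply: measurable_coord => //.
  exact: measurable_floor_eq.
apply/seteqP; split => u /=; first by move=> <- i _ /=; rewrite ffunE.
by move=> H; apply/ffunP => i; rewrite ffunE; exact: H.
Qed.

End discretization.

(** * Boundary flux of the stationary profile *)

Section integral_monotone.
Context d (X : measurableType d) (R : realType).
Variables (mu : {measure set X -> \bar R}) (D : set X).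

(** The integral of a nonnegative function is a supremum over the simple functions
    below it, which makes it monotone without measurability. *)
Lemma ge0_le_integral_any (f g : X -> \bar R) :
  (forall x, D x -> (0 <= f x)%E) -> (forall x, D x -> (f x <= g x)%E) ->
  (\int[mu]_(x in D) f x <= \int[mu]_(x in D) g x)%E.
Proof.
move=> f0 fg.
have g0 x : D x -> (0 <= g x)%E by move=> Dx; apply: le_trans (fg x Dx); exact: f0.
rewrite !ge0_integralE//; apply: le_ereal_sup => _ [h /= hf <-]; exists h => //= x.
apply: le_trans (hf x) _; rewrite /patch; case: ifP => // /set_mem; exact: fg.
Qed.

Hypotheses (mD : measurable D) (muD : (mu D < +oo)%E).

(** Time integrals of nonlinear functionals of the density are bounded in this
    way, as weak regularity in time says nothing of their measurability. *)
Lemma le_Rintegral_any (f g : X -> R) M : (forall x, D x -> `|f x| <= M) ->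
  bmeas D g -> (forall x, D x -> f x <= g x) ->
  \int[mu]_(x in D) f x <= \int[mu]_(x in D) g x.
Proof.
move=> fM bg fg.
have iM : (\int[mu]_(x in D) M%:E)%E \is a fin_num.
  apply: (integrable_fin_num mD); exact: (bmeas_integrable mD muD (bmeas_cst D M)).
have fin (h : X -> \bar R) : (forall x, D x -> (0 <= h x <= M%:E)%E) ->
    (\int[mu]_(x in D) h x)%E \is a fin_num.
  move=> hM; rewrite ge0_fin_numE; last first.
    by apply: integral_ge0 => x /hM/andP[].
  apply: (@le_lt_trans _ _ (\int[mu]_(x in D) M%:E)%E).
    by apply: ge0_le_integral_any => x /hM/andP[].
  by move: iM; rewrite fin_numE => /andP[_]; rewrite -ltey.
have ig := bmeas_integrable mD muD bg.
have M0 x : D x -> 0 <= M by move=> /fM; exact: le_trans.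
have fp : (\int[mu]_(x in D) (EFin \o f)^\+ x)%E \is a fin_num.
  apply: fin => x Dx; rewrite funeposE /= -EFin_max !lee_fin le_max lexx orbT/=.
  by rewrite ge_max (M0 x Dx) (le_trans (ler_norm _) (fM x Dx)).
have fn : (\int[mu]_(x in D) (EFin \o f)^\- x)%E \is a fin_num.
  apply: fin => x Dx; rewrite funenegE /= -EFin_max !lee_fin le_max lexx orbT/=.
  by rewrite ge_max (M0 x Dx) andbT (le_trans (ler_norm _))// normrN fM.
have gp := integrable_pos_fin_num mD ig.
have gn := integrable_neg_fin_num mD ig.
rewrite /Rintegral; apply: fine_le.
- by rewrite integralE fin_numB fp fn.
- by rewrite integralE fin_numB gp gn.
rewrite integralE [leRHS]integralE; apply: leeB; apply: ge0_le_integral_any => x Dx.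
- by rewrite funepos_ge0.
- by rewrite !funeposE /= -!EFin_max !lee_fin ge_max !le_max fg// lexx orbT.
- by rewrite funeneg_ge0.
- by rewrite !funenegE /= -!EFin_max !lee_fin ge_max !le_max lerN2 fg// lexx orbT.
Qed.

End integral_monotone.

Lemma bmeas_phi d (X : measurableType d) (R : realType) (a : R) (D : set X) (f : X -> R) :
  bmeas D f -> bmeas D (fun x => phi a (f x)).
Proof.
move=> bf; rewrite /phi; apply: (bmeasM bf).
by apply: bmeasD; [exact: bmeas_cst|exact: bmeasZ].
Qed.

Section faces.
Variables (R : realType) (n : nat).
Local Notation Rd := 'rV[R]_n.+1.
Local Notation Omega := (@Omega R n).
Implicit Types (k : {ffun 'I_n.+1 -> nat}).
Local Notation cube := [set v : 'rV[R]_n | forall i, 0 <= v 0 i < 1].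

Let leN11 : -1 <= 1 :> R.
Proof. by lra. Qed.

Let cubeE : cube = box (fun _ : 'I_n => `[0, 1[%classic).
Proof.
by apply/seteqP; split => v H i; have := H i; rewrite /= in_itv.
Qed.

Lemma measurable_cube : measurable cube.
Proof. by rewrite cubeE; apply: measurable_box => i; exact: measurable_itv. Qed.

Lemma cube_finite : (leb R n cube < +oo)%E.
Proof.
rewrite cubeE; apply: box_finite => i; first exact: measurable_itv.
exact: (@itv_finite R _ _ true).
Qed.

Variables (a : R) (b : Rd -> R).
Hypothesis hb : boundary_density b.

Lemma GammaU_consr (s : R) v : s = 1 \/ s = -1 -> @GammaU R n (consr (s, v)).
Proof. by rewrite /GammaU /= consr0 /=; case=> ->; [right|left]. Qed.

Lemma consr_continuous (s : R) : continuous (fun v : 'rV[R]_n => consr (s, v)).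
Proof.
move=> v A /nbhs_ballP[e e0 eA]; apply/nbhs_ballP; exists e => //= w [_ vw].
apply: eA; split => // i j; rewrite ord1.
case: (unliftP ord0 j) => [j'|] ->; last by rewrite !consr0; exact: ballxx.
by rewrite !consrS /=; exact: vw.
Qed.

Lemma bmeas_face_b (s : R) : s = 1 \/ s = -1 -> bmeas cube (fun v => b (consr (s, v))).
Proof.
move=> hs; have [_ [cb _] b01] := hb; split; last first.
  exists 1 => v _; have /andP[b0 b1] := b01 _ (GammaU_consr v hs).
  by rewrite gtr0_norm// ltW.
apply: measurable_funTS; apply: continuous_measurable_row => v.
move/subspace_continuousP : cb => /(_ _ (GammaU_consr v hs)) cbv.
apply: cvg_comp cbv => A; rewrite /within /= => HA.
have H : \forall w \near v, GammaU (consr (s, w)) -> A (consr (s, w)).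
  exact: consr_continuous HA.
suff : \forall w \near v, A (consr (s, w)) by [].
by apply: filterS H => w; apply; exact: GammaU_consr.
Qed.

Lemma bmeas_face_deigenfun (s : R) k :
  bmeas cube (fun v => deigenfun ord0 k (consr (s, v))).
Proof.
have [m [M HM]] : bmeas (box (fun _ : 'I_n.+1 => [set: R])) (deigenfun ord0 k).
  apply: bmeas_tensor => i; rewrite /upd; case: ifP => _.
  - exact: measurable_dmode.
  - exact: measurable_mode.
  - exact: (bmeas_dmode ord0 (k ord0) [set: R]).2.
  - exact: (bmeas_mode i (k i) [set: R]).2.
split; last by exists M => v _; apply: HM.
apply: measurable_funTS.
have mT : measurable_fun setT (deigenfun ord0 k : Rd -> R).
  apply: measurable_tensor => i; rewrite /upd; case: ifP => _.
    exact: measurable_dmode.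
  exact: measurable_mode.
apply: (measurableT_comp mT).
apply: measurable_fun_row => i; case: (unliftP ord0 i) => [j|] ->.
  by under eq_fun do rewrite consrS; exact: measurable_coord.
by under eq_fun do rewrite consr0; exact: measurable_cst.
Qed.

Definition face_flux (s : R) k : R := int_face s (fun u => phi a (b u) * deigenfun ord0 k u).

Lemma int_face_sum (s : R) (r : seq {ffun 'I_n.+1 -> nat}) (g : _ -> R) :
  s = 1 \/ s = -1 ->
  int_face s (fun u => phi a (b u) * \sum_(k <- r) g k * deigenfun ord0 k u) =
  \sum_(k <- r) g k * face_flux s k.
Proof.
move=> hs; rewrite /face_flux /int_face.
under eq_Rintegral do rewrite mulr_sumr.
have bk k : bmeas cube (fun v => phi a (b (consr (s, v))) * deigenfun ord0 k (consr (s, v))).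
  by apply: bmeasM; [apply: bmeas_phi; exact: bmeas_face_b|exact: bmeas_face_deigenfun].
rewrite (@int_sum _ _ _ (leb R n) _ measurable_cube cube_finite _ r
    (fun k v => phi a (b (consr (s, v))) * (g k * deigenfun ord0 k (consr (s, v))))).
  apply: eq_bigr => k _; rewrite -(intZ measurable_cube cube_finite)//.
  by apply: int_ext => v _; rewrite mulrCA.
move=> k; apply: bmeas_ext (bmeasZ (g k) (bk k)) => v _; by rewrite mulrCA.
Qed.

Variable rhobar : Rd -> R.
Hypothesis hst : stationary_profile a b rhobar.

(** The weak stationary equation tested with one mode: it trades the boundary
    values of [b] for the profile inside the domain. *)
Lemma stationary_flux k : face_flux 1 k - face_flux (-1) k =
  - (eigenval R k * intO (fun u => phi a (rhobar u) * eigenfun k u)).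
Proof.
have [rb01 [[mrb _] _] H] := hst.
have brb : bmeas Omega rhobar by exact: bmeas01.
have := H _ (space_sum_C2_0 [:: k] (fun _ => 1)).
rewrite /int_Gamma => E.
have -> : face_flux 1 k - face_flux (-1) k =
    int_face 1 (fun u => phi a (b u) * normal1 u *
      der (@cOmegaU R n) (evec R ord0) (space_sum [:: k] (fun=> 1)) u) +
    int_face (-1) (fun u => phi a (b u) * normal1 u *
      der (@cOmegaU R n) (evec R ord0) (space_sum [:: k] (fun=> 1)) u).
  congr (_ + _).
    apply: int_ext => v _; rewrite /normal1 consr0 mulr1 space_sum_der.
      by rewrite big_seq1 mul1r.
    by rewrite /cOmegaU /= consr0 lexx andbT leN11.
  rewrite -[LHS]mulN1r /face_flux /int_face -(intZ measurable_cube cube_finite); last first.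
    by apply: bmeasM; [apply: bmeas_phi; apply: bmeas_face_b; right|exact: bmeas_face_deigenfun].
  apply: int_ext => v _; rewrite /normal1 consr0 space_sum_der.
    by rewrite big_seq1 mul1r /=; ring.
  by rewrite /cOmegaU /= consr0 lexx /= leN11.
rewrite -E -mulNr /intO -(intZ (@measurable_Omega R n) (@Omega_finite R n)); last first.
  by apply: bmeasM; [exact: bmeas_phi|exact: bmeas_eigenfun].
apply: int_ext => u Ou; rewrite space_sum_laplacian; last exact: Omega_cOmegaU.
by rewrite big_seq1; ring.
Qed.

End faces.

(** * Fourier projection in time *)

Section time_projection.
Variables (R : realType) (T : R).
Hypothesis T0 : 0 < T.
Local Notation mu := (@lebesgue_measure R).
Local Notation D := (`]0, T[%classic : set (measurableTypeR R)).
Local Notation tau := (torus_mode T).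
Local Notation tcoef := (coef mu D tau).

Definition dtau j : R -> R := dwave (torus_amp T j) (torus_freq T j) (torus_phase R j).

Lemma is_derive_tau j (t : R) : is_derive t 1 (tau j) (dtau j t).
Proof. exact: is_derive_wave. Qed.

Lemma dtau0 t : dtau 0 t = 0.
Proof. by rewrite /dtau dwaveE /torus_freq /= mul0r mulr0 mul0r. Qed.

Lemma dtau_odd m t : dtau m.*2.+1 t = - torus_freq T m.*2.+1 * tau m.*2.+2 t.
Proof.
rewrite /dtau dwaveE /torus_mode /wave /torus_phase /torus_amp /torus_freq /=.
rewrite odd_double /= addr0 uphalf_double doubleK cosDpihalf; ring.
Qed.

Lemma dtau_even m t : dtau m.*2.+2 t = torus_freq T m.*2.+1 * tau m.*2.+1 t.
Proof.
rewrite /dtau dwaveE /torus_mode /wave /torus_phase /torus_amp /torus_freq /=.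
by rewrite odd_double /= addr0 uphalf_double doubleK sinDpihalf; ring.
Qed.

Definition tproj M (w : R -> R) (t : R) : R := proj mu D tau (time_cutoff M) w t.
Definition dtproj M (w : R -> R) (t : R) : R :=
  \sum_(j <- time_cutoff M) tcoef w j * dtau j t.

Lemma is_derive_tproj M w (t : R) : is_derive t 1 (tproj M w) (dtproj M w t).
Proof.
rewrite /tproj /dtproj /proj; elim: (time_cutoff M) => [|j r IH].
  rewrite big_nil (_ : (fun _ => _) = cst 0); first exact: is_derive_cst.
  by apply/funext => s; rewrite big_nil.
rewrite big_cons (_ : (fun _ => _) = (fun s => tcoef w j * tau j s) +
    (fun s => \sum_(i <- r) tcoef w i * tau i s)); last first.
  by apply/funext => s; rewrite big_cons.
apply: is_deriveD.
exact: (@is_deriveZ R R R _ (tcoef w j) t 1 _ (is_derive_tau j t)).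
Qed.

Lemma continuous_dtproj M w : continuous (dtproj M w).
Proof.
apply: continuous_big => [|j _]; first exact: add_continuous.
by move=> t; apply: cvgM; [exact: cvg_cst|exact: continuous_wave].
Qed.

Lemma bmeas_tproj M w : bmeas D (tproj M w).
Proof. exact: (bmeas_proj (time_system T0)). Qed.

Lemma bmeas_dtproj M w : bmeas D (dtproj M w).
Proof. by apply: bmeas_sum => j; apply: bmeasZ; exact: bmeas_wave. Qed.

Let mD := itv_measurable 0 T false.
Let fD := itv_finite false T0.

(** Derivation maps the span of the time modes to itself and is antisymmetric
    there. So [w] pairs with the derivative of its projection p as p does with p',
    that is, to 0. In this way [w] is integrated by parts with no regularity in
    time; in coordinates, the cosine and the sine of each frequency cancel. *)
Lemma int_mul_dtproj M w : bmeas D w -> \int[mu]_(t in D) (w t * dtproj M w t) = 0.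
Proof.
move=> bw.
have bd j : bmeas D (fun t => w t * dtau j t) by apply: bmeasM => //; exact: bmeas_wave.
pose z j := tcoef w j * \int[mu]_(t in D) (w t * dtau j t).
have -> : \int[mu]_(t in D) (w t * dtproj M w t) = \sum_(j <- time_cutoff M) z j.
  transitivity (\int[mu]_(t in D) (\sum_(j <- time_cutoff M) tcoef w j * (w t * dtau j t))).
    by apply: int_ext => t _; rewrite mulr_sumr; apply: eq_bigr => j _; rewrite mulrCA.
  rewrite (int_sum mD fD); last by move=> j; exact: bmeasZ.
  by apply: eq_bigr => j _; rewrite (intZ mD fD).
have bt j : bmeas D (fun t => w t * tau j t) by apply: bmeasM => //; exact: bmeas_wave.
have z_odd m : z m.*2.+1 = - torus_freq T m.*2.+1 * (tcoef w m.*2.+1 * tcoef w m.*2.+2).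
  rewrite /z mulrCA; congr (_ * _); rewrite /coef -(intZ mD fD)//.
  by apply: int_ext => t _; rewrite dtau_odd mulrCA.
have z_even m : z m.*2.+2 = torus_freq T m.*2.+1 * (tcoef w m.*2.+1 * tcoef w m.*2.+2).
  have -> : z m.*2.+2 = tcoef w m.*2.+2 * (torus_freq T m.*2.+1 * tcoef w m.*2.+1).
    rewrite /z; congr (_ * _); rewrite /coef -(intZ mD fD)//.
    by apply: int_ext => t _; rewrite dtau_even mulrCA.
  by ring.
have z0 : z 0%N = 0.
  rewrite /z [X in _ * X](_ : _ = 0) ?mulr0//.
  rewrite -[RHS](mul0r (fine (mu D))) -Rintegral_cst//.
  by apply: int_ext => t _; rewrite dtau0 mulr0.
elim: M => [|m IH]; first by rewrite /time_cutoff /= big_seq1.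
have -> : time_cutoff m.+1 = time_cutoff m ++ [:: m.*2.+1; m.*2.+2].
  by rewrite /time_cutoff doubleS -[m.*2.+3]addn2 iotaD.
rewrite big_cat /= IH add0r big_cons big_seq1 /= z_odd z_even.
by ring.
Qed.

Lemma int_tproj_sq M w : bmeas D w ->
  \int[mu]_(t in D) tproj M w t ^+ 2 <= \int[mu]_(t in D) w t ^+ 2.
Proof.
move=> bw.
rewrite /tproj /proj (int_comb_sq (time_system T0)); last exact: iota_uniq.
by apply: (bessel (time_system T0)) => //; exact: iota_uniq.
Qed.

Lemma tproj_cvg w : bmeas D w ->
  \int[mu]_(t in D) (w t - tproj M w t) ^+ 2 @[M --> \oo] --> (0 : R).
Proof. by move=> /(time_complete T0)[]. Qed.

End time_projection.

(** * Estimates at a fixed time *)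

(** Write q as chi x minus an error. The main part m chi^2 x^2 is at least
    c chi^2 x^2, half of which absorbs the product with the error. *)
Lemma young_split (R : realType) (c L m chi x q : R) : 0 < c -> c <= m <= L ->
  c / 2 * (chi ^+ 2 * x ^+ 2) - L ^+ 2 / (2 * c) * (chi * x - q) ^+ 2
  <= chi * (m * x * q).
Proof.
move=> cp /andP[cm mL].
have L0 : 0 < L by exact: lt_le_trans (lt_le_trans cp cm) mL.
have H0 : m * x * (chi * x - q) * chi <=
    c / 2 * (chi ^+ 2 * x ^+ 2) + L ^+ 2 / (2 * c) * (chi * x - q) ^+ 2.
  have mm : m ^+ 2 <= L ^+ 2 by rewrite lerXn2r ?nnegrE ?(ltW L0)// (le_trans (ltW cp)).
  have : 0 <= (c * chi * x - m * (chi * x - q)) ^+ 2 / (2 * c).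
    by rewrite divr_ge0 ?sqr_ge0// mulr_ge0// ltW.
  have -> : (c * chi * x - m * (chi * x - q)) ^+ 2 / (2 * c) =
      c / 2 * (chi ^+ 2 * x ^+ 2) - m * x * (chi * x - q) * chi
      + m ^+ 2 / (2 * c) * (chi * x - q) ^+ 2.
    by field; rewrite gt_eqF.
  have : m ^+ 2 / (2 * c) * (chi * x - q) ^+ 2 <= L ^+ 2 / (2 * c) * (chi * x - q) ^+ 2.
    by rewrite ler_wpM2r ?sqr_ge0// ler_wpM2r// invr_ge0 mulr_ge0// ltW.
  set A := c / 2 * _; set B := m * x * _ * _; set E := m ^+ 2 / _ * _.
  by set F := L ^+ 2 / _ * _; lra.
have H1 : c * (chi ^+ 2 * x ^+ 2) <= m * (chi ^+ 2 * x ^+ 2).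
  by rewrite ler_wpM2r// mulr_ge0// sqr_ge0.
have -> : chi * (m * x * q) = m * (chi ^+ 2 * x ^+ 2) - m * x * (chi * x - q) * chi by ring.
move: H0 H1; set B := m * x * _ * _; set F := L ^+ 2 / _ * _.
by set A := chi ^+ 2 * x ^+ 2; lra.
Qed.

Section static_estimates.
Variables (R : realType) (n : nat).
Local Notation Rd := 'rV[R]_n.+1.
Local Notation Omega := (@Omega R n).
Local Notation idx := {ffun 'I_n.+1 -> nat}.
Local Notation mO := (@measurable_Omega R n).
Local Notation fO := (@Omega_finite R n).
Local Notation ocoef := (coef (leb R n.+1) Omega (@eigenfun R n)).
Implicit Types (k : idx) (s : seq idx).

(** The Dirichlet direction alone contributes at least (pi / 2) ^ 2. *)
Lemma eigenval_ge1 k : 1 <= eigenval R k.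
Proof.
rewrite /eigenval (bigD1 ord0)//= -[leLHS]addr0; apply: lerD; last first.
  by apply: sumr_ge0 => i _; exact: sqr_ge0.
rewrite /mode_freq eqxx /sine_freq -[leLHS](expr1n _ 2) lerXn2r ?nnegrE//.
  by rewrite mulr_ge0// divr_ge0// pi_ge0.
have P := pihalf_ge1 R.
by rewrite -[leLHS]mulr1 ler_pM// ler1n.
Qed.

(** The derivatives of distinct modes along a coordinate are orthogonal. *)
Lemma int_gradient s (g : idx -> R) : uniq s ->
  intO (fun u : Rd => \sum_i (\sum_(k <- s) g k * deigenfun i k u) ^+ 2) =
  \sum_(k <- s) g k ^+ 2 * eigenval R k.
Proof.
move=> us.
have bd i k : bmeas Omega (fun u => g k * deigenfun i k u).
  by apply: bmeasZ; exact: bmeas_deigenfun.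
rewrite /intO (@int_sum _ _ _ (leb R n.+1) _ mO fO _ _
  (fun i (u : Rd) => (\sum_(k <- s) g k * deigenfun i k u) ^+ 2)); last first.
  by move=> i; apply: bmeasX; apply: bmeas_sum.
rewrite /eigenval; under [RHS]eq_bigr do rewrite mulr_sumr.
rewrite [RHS]exchange_big; apply: eq_bigr => i _.
transitivity (\int[leb R n.+1]_(u in Omega) (\sum_(k <- s) \sum_(l <- s)
    (g k * g l) * (deigenfun i k u * deigenfun i l u))).
  apply: int_ext => u _; rewrite expr2 mulr_suml; apply: eq_bigr => k _.
  by rewrite mulr_sumr; apply: eq_bigr => l _; ring.
have bdd k l : bmeas Omega (fun u => (g k * g l) * (deigenfun i k u * deigenfun i l u)).
  by apply: bmeasZ; apply: bmeasM; exact: bmeas_deigenfun.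
rewrite (int_sum mO fO); last by move=> k; apply: bmeas_sum.
rewrite big_seq [RHS]big_seq; apply: eq_bigr => k ks.
rewrite (int_sum mO fO)// (bigD1_seq k)//= [X in _ + X]big1 ?addr0.
  rewrite (intZ mO fO); last by apply: bmeasM; exact: bmeas_deigenfun.
  by rewrite deigenfun_orth eqxx mulr1 expr2.
move=> l lk; rewrite (intZ mO fO); last by apply: bmeasM; exact: bmeas_deigenfun.
by rewrite deigenfun_orth eq_sym (negbTE lk) !mulr0.
Qed.

Variable a : R.
Hypothesis ha : - 2^-1 < a.

Definition ellipticity : R := Num.min 1 (1 + 2 * a).
Definition lipschitz : R := 1 + 2 * `|a|.
Local Notation c0 := ellipticity.
Local Notation L := lipschitz.

(** The condition a > -1/2 says that the derivative 1 + 2 a r of [phi] is positive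
    on [0, 1]. *)
Lemma ellipticity_gt0 : 0 < c0.
Proof. by rewrite /c0 lt_min ltr01/=; move: ha; lra. Qed.

Lemma lipschitz_ge1 : 1 <= L.
Proof. by rewrite lerDl mulr_ge0. Qed.

Lemma slope_bounds (x y : R) : 0 <= x <= 1 -> 0 <= y <= 1 ->
  c0 <= 1 + a * (x + y) <= L.
Proof.
move=> /andP[x0 x1] /andP[y0 y1]; rewrite /ellipticity /lipschitz.
have [a0|a0] := leP 0 a.
  rewrite ger0_norm//; apply/andP; split; last nra.
  by apply: (@le_trans _ _ 1); [rewrite ge_min lexx|nra].
rewrite ltr0_norm//; apply/andP; split; last nra.
by apply: (@le_trans _ _ (1 + 2 * a)); [rewrite ge_min lexx orbT|nra].
Qed.

Lemma phi_subE (x y : R) : phi a x - phi a y = (1 + a * (x + y)) * (x - y).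
Proof. by rewrite /phi; ring. Qed.

Lemma sigma_bounds (x : R) : 0 <= x <= 1 -> 0 <= sigma a x <= L.
Proof.
move=> x01; have /andP[x0 x1] := x01.
have /andP[s0 s1] := slope_bounds x01 x01.
have := ellipticity_gt0; rewrite /sigma => c0p.
have -> : 1 + 2 * a * x = 1 + a * (x + x) by ring.
have q : 0 <= 2 * x * (1 - x) <= 1 by apply/andP; split; nra.
have /andP[q0 q1] := q.
by rewrite mulr_ge0 ?(le_trans (ltW c0p) s0)//= -[leRHS]mul1r ler_pM// (le_trans (ltW c0p) s0).
Qed.

Variables (r rbar : Rd -> R).
Hypotheses (mr : measurable_fun Omega r) (mrbar : measurable_fun Omega rbar).
Hypotheses (r01 : forall u, Omega u -> 0 <= r u <= 1).
Hypotheses (rbar01 : forall u, Omega u -> 0 <= rbar u <= 1).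

Local Notation f := (fun u => r u - rbar u).
Local Notation Phi := (fun u => phi a (r u) - phi a (rbar u)).

Let br : bmeas Omega r.
Proof. exact: bmeas01. Qed.

Let brbar : bmeas Omega rbar.
Proof. exact: bmeas01. Qed.

Lemma bmeas_diff : bmeas Omega f.
Proof. exact: bmeasB. Qed.

Let bPhi : bmeas Omega Phi.
Proof. by apply: bmeasB; exact: bmeas_phi. Qed.

Definition dist2 : R := intO (fun u => (r u - rbar u) ^+ 2).

Lemma dist2_le : dist2 <= fine (leb R n.+1 Omega).
Proof.
rewrite /dist2 /intO -[leRHS]mul1r -Rintegral_cst//; last exact: mO.
apply: (int_le mO fO); [by apply: bmeasX; exact: bmeas_diff|exact: bmeas_cst|].
move=> u Ou; have /andP[x0 x1] := r01 Ou; have /andP[y0 y1] := rbar01 Ou.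
by rewrite /cst; nra.
Qed.

(** Monotonicity of [phi], tested with an approximation of chi (r - rbar) by modes.
    The price is the squared distance of the approximation, which
    [int_sub_comb_sq] expresses by coefficients. *)
Lemma flux_lower_bound s (chi : R) (p : idx -> R) : uniq s ->
  c0 / 2 * (chi ^+ 2 * dist2) - L ^+ 2 / (2 * c0) *
    (chi ^+ 2 * dist2 - \sum_(k <- s) (chi * ocoef f k) ^+ 2 +
     \sum_(k <- s) (p k - chi * ocoef f k) ^+ 2)
  <= chi * \sum_(k <- s) p k * ocoef Phi k.
Proof.
move=> us; have cp := ellipticity_gt0.
pose P (u : Rd) := \sum_(k <- s) p k * eigenfun k u.
have bP : bmeas Omega P by apply: bmeas_sum => k; apply: bmeasZ; exact: bmeas_eigenfun.
have bf := bmeas_diff.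
have bcf : bmeas Omega (fun u => chi * f u) by exact: bmeasZ.
have -> : chi * \sum_(k <- s) p k * ocoef Phi k = intO (fun u => chi * (Phi u * P u)).
  rewrite /intO (intZ mO fO); last exact: bmeasM.
  by rewrite (int_comb_mul (eigenfun_system R n)).
have E := int_sub_comb_sq (eigenfun_system R n) p bcf us.
have E1 : \int[leb R n.+1]_(u in Omega) (chi * f u) ^+ 2 = chi ^+ 2 * dist2.
  rewrite /dist2 /intO -(intZ mO fO); last exact: bmeasX.
  by apply: int_ext => u _; rewrite exprMn.
have E2 k : ocoef (fun u => chi * f u) k = chi * ocoef f k.
  by apply: coefZ => //; exact: (eigenfun_system R n).
move: E; rewrite E1; under eq_bigr do rewrite E2; under [X in _ + X]eq_bigr do rewrite E2.
move=> <-.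
have bq : bmeas Omega (fun u => (chi * f u - P u) ^+ 2) by apply: bmeasX; exact: bmeasB.
rewrite -[X in X * _ - _]/(c0 / 2) /dist2 /intO -(intZ mO fO); last exact: bmeasX.
rewrite -(intZ mO fO); last by apply: bmeasZ; exact: bmeasX.
rewrite -(intZ mO fO)// -(intB mO fO); [|by do 2 apply: bmeasZ; exact: bmeasX|exact: bmeasZ].
apply: (int_le mO fO).
- by apply: bmeasB; [do 2 apply: bmeasZ; exact: bmeasX|exact: bmeasZ].
- by apply: bmeasZ; exact: bmeasM.
move=> u Ou; rewrite phi_subE.
exact: (young_split chi (r u - rbar u) (P u) cp (slope_bounds (r01 Ou) (rbar01 Ou))).
Qed.

Lemma coef_sq_le (q : Rd -> R) k : bmeas Omega q ->
  ocoef q k ^+ 2 <= intO (fun u => q u ^+ 2).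
Proof.
move=> bq; have := bessel (eigenfun_system R n) (s := [:: k]) bq isT.
by rewrite big_seq1.
Qed.

End static_estimates.

(** * Estimates along a trajectory *)

Section trajectory_estimates.
Variables (R : realType) (n : nat).
Local Notation Rd := 'rV[R]_n.+1.
Local Notation Omega := (@Omega R n).
Local Notation idx := {ffun 'I_n.+1 -> nat}.
Local Notation mO := (@measurable_Omega R n).
Local Notation fO := (@Omega_finite R n).
Local Notation ocoef := (coef (leb R n.+1) Omega (@eigenfun R n)).
Local Notation mu := (@lebesgue_measure R).
Local Notation vol := (fine (leb R n.+1 Omega)).
Implicit Types (k : idx) (s : seq idx).

Variables (T : R) (r : R -> Rd -> R) (rbar : Rd -> R).
Hypothesis T0 : 0 < T.
Local Notation D := (`]0, T[%classic : set (measurableTypeR R)).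
Hypothesis mrbar : measurable_fun Omega rbar.
Hypothesis rbar01 : forall u, Omega u -> 0 <= rbar u <= 1.
Hypothesis mr : forall t : R, D t -> measurable_fun Omega (r t).
Hypothesis r01 : forall t : R, D t -> forall u, Omega u -> 0 <= r t u <= 1.
Hypothesis mt : forall k, measurable_fun D (fun t => ocoef (r t) k).

Let mD := itv_measurable 0 T false.
Let fD := itv_finite false T0.

Definition mode_coef k (t : R) : R := ocoef (fun u => r t u - rbar u) k.
Definition sqdist (t : R) : R := dist2 (r t) rbar.
Local Notation c := mode_coef.

Lemma vol_ge0 : 0 <= vol.
Proof. by rewrite fine_ge0. Qed.

Let brbar : bmeas Omega rbar.
Proof. exact: bmeas01. Qed.

Let br (t : R) : D t -> bmeas Omega (r t).
Proof. by move=> Dt; apply: bmeas01; [exact: mr|exact: r01]. Qed.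

Lemma mode_coef_sum_le s (t : R) : uniq s -> D t ->
  \sum_(k <- s) c k t ^+ 2 <= sqdist t.
Proof.
move=> us Dt; apply: (bessel (eigenfun_system R n)) => //.
exact: (bmeasB (br Dt) brbar).
Qed.

Lemma sqdist_le (t : R) : D t -> sqdist t <= vol.
Proof. by move=> Dt; apply: dist2_le => //; [exact: mr|exact: r01]. Qed.

Lemma bmeas_mode_coef k : bmeas D (c k).
Proof.
split.
  have : measurable_fun D (fun t => ocoef (r t) k - ocoef rbar k).
    by apply: measurable_funB; [exact: mt|exact: measurable_cst].
  apply: eq_measurable_fun => t /set_mem Dt.
  by rewrite /c (coefB (eigenfun_system R n))//; exact: br.
exists (1 + vol) => t Dt.
have H : c k t ^+ 2 <= vol.
  have := mode_coef_sum_le (s := [:: k]) isT Dt; rewrite big_seq1 => /le_trans; apply.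
  exact: sqdist_le.
have V0 := vol_ge0.
rewrite -ler_sqr ?nnegrE ?normr_ge0 ?addr_ge0// real_normK ?num_real//.
apply: le_trans H _; move: V0; move: vol => v v0; nra.
Qed.

Lemma sqdist_cvg (t : R) : D t ->
  \sum_(k <- cutoff_modes n N) c k t ^+ 2 @[N --> \oo] --> sqdist t.
Proof.
move=> Dt; have bf := bmeasB (br Dt) brbar.
have [_ H] := eigenfun_complete bf.
have H1 : sqdist t - resid (leb R n.+1) Omega (@eigenfun R n) (cutoff_modes n N)
    (fun u => r t u - rbar u) @[N --> \oo] --> sqdist t - 0.
  by apply: cvgB => //; exact: cvg_cst.
rewrite subr0 in H1; apply: cvg_trans H1.
apply: near_eq_cvg; apply: nearW => N.
rewrite (residE (eigenfun_system R n))//; last exact: (ons_uniq (eigenfun_system R n)).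
by rewrite opprB addrCA subrr addr0.
Qed.

Lemma bmeas_mode_sum s : bmeas D (fun t => \sum_(k <- s) c k t ^+ 2).
Proof. by apply: bmeas_sum => k; apply: bmeasX; exact: bmeas_mode_coef. Qed.

(** The modes are weakly measurable in time, and Parseval passes this on to the
    squared norm. *)
Lemma bmeas_sqdist : bmeas D sqdist.
Proof.
have := @bounded_cvg_bmeas _ _ _ mu D mD fD
  (fun N t => \sum_(k <- cutoff_modes n N) c k t ^+ 2) sqdist vol.
case=> //.
- by move=> N; exact: (bmeas_mode_sum _).1.
- move=> N t Dt; rewrite ger0_norm; last by apply: sumr_ge0 => k _; exact: sqr_ge0.
  apply: le_trans (sqdist_le Dt); apply: mode_coef_sum_le => //.
  exact: (ons_uniq (eigenfun_system R n)).
- exact: sqdist_cvg.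
Qed.

(** A time cutoff vanishing at both ends of [0, T], with derivative of order
    1/T, so that its cost does not grow with T. *)
Definition cutoff : R -> R := wave 1 (pi / T) 0.
Definition dcutoff : R -> R := dwave 1 (pi / T) 0.
Local Notation chi := cutoff.
Local Notation dchi := dcutoff.

Lemma cutoff0 : chi 0 = 0.
Proof. by rewrite /chi /wave mulr0 addr0 sin0 mulr0. Qed.

Lemma cutoffT : chi T = 0.
Proof. by rewrite /chi /wave divfK ?gt_eqF// addr0 sinpi mulr0. Qed.

Lemma cutoff_sq_le1 t : chi t ^+ 2 <= 1.
Proof.
by rewrite /chi /wave mul1r -real_normK ?num_real// expr_le1// sin_max.
Qed.

Lemma dcutoff_le t : `|dchi t| <= pi / T.
Proof.
have P0 : 0 <= pi / T :> R by rewrite divr_ge0 ?pi_ge0// ltW.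
by rewrite /dchi dwaveE mul1r normrM (ger0_norm P0) ler_piMr// cos_max.
Qed.

Lemma int_cutoff_sq : \int[mu]_(t in D) (chi t ^+ 2) = T / 2.
Proof.
under eq_Rintegral do rewrite expr2.
rewrite (@int_wave_sq R 0 T false T0).
- by rewrite expr1n subr0 mul1r.
- by rewrite gt_eqF// divr_gt0// pi_gt0.
- by rewrite [X in X * _]cutoffT [X in _ = X * _]cutoff0 !mul0r.
Qed.

Let bchi : bmeas D chi. Proof. exact: bmeas_wave. Qed.

Definition wcoef k (t : R) : R := chi t * c k t.
Local Notation w := wcoef.

Lemma bmeas_wcoef k : bmeas D (w k).
Proof. exact: (bmeasM bchi (bmeas_mode_coef k)). Qed.

Definition pcoef M k : R -> R := tproj T M (w k).

Lemma bmeas_pcoef M k : bmeas D (pcoef M k).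
Proof. exact: bmeas_tproj. Qed.

Lemma int_pcoef_sq_le M k :
  \int[mu]_(t in D) pcoef M k t ^+ 2 <= \int[mu]_(t in D) w k t ^+ 2.
Proof. by apply: int_tproj_sq => //; exact: bmeas_wcoef. Qed.

(** By [int_sub_comb_sq] this is the squared distance, at time [t], between
    chi (r - rbar) and the sum of the modes with coefficients [pcoef M k t]. *)
Definition excess N M (t : R) : R :=
  chi t ^+ 2 * sqdist t - \sum_(k <- cutoff_modes n N) w k t ^+ 2
  + \sum_(k <- cutoff_modes n N) (pcoef M k t - w k t) ^+ 2.

Lemma bmeas_excess N M : bmeas D (excess N M).
Proof.
apply: bmeasD.
  apply: bmeasB; first by apply: bmeasM; [exact: bmeasX|exact: bmeas_sqdist].
  by apply: bmeas_sum => k; apply: bmeasX; exact: bmeas_wcoef.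
apply: bmeas_sum => k; apply: bmeasX.
by apply: bmeasB; [exact: bmeas_pcoef|exact: bmeas_wcoef].
Qed.

(** Completeness in space provides [N]; then completeness in time, for the finitely
    many functions [wcoef k], provides [M]. *)
Lemma excess_small eps : 0 < eps ->
  exists N M, \int[mu]_(t in D) excess N M t <= eps.
Proof.
move=> eps0; have e2 : 0 < eps / 2 by rewrite divr_gt0.
pose A N (t : R) := chi t ^+ 2 * (sqdist t - \sum_(k <- cutoff_modes n N) c k t ^+ 2).
have bA N : bmeas D (A N).
  apply: bmeasM; first exact: bmeasX.
  by apply: bmeasB; [exact: bmeas_sqdist|exact: bmeas_mode_sum].
have [N AN] : exists N, \int[mu]_(t in D) A N t <= eps / 2.
  have := @bounded_cvg_bmeas _ _ _ mu D mD fD A (fun=> 0) vol.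
  case=> [N|N t Dt|t Dt|_].
  - exact: (bA N).1.
  - have us := ons_uniq (eigenfun_system R n) N.
    have h1 := mode_coef_sum_le us Dt; have h2 := sqdist_le Dt.
    have h3 : 0 <= \sum_(k <- cutoff_modes n N) c k t ^+ 2.
      by apply: sumr_ge0 => k _; exact: sqr_ge0.
    rewrite /A normrM (ger0_norm (sqr_ge0 _)) ger0_norm ?subr_ge0//.
    apply: (@le_trans _ _ (sqdist t - \sum_(k <- cutoff_modes n N) c k t ^+ 2)).
      by rewrite ler_piMl ?subr_ge0// cutoff_sq_le1.
    by rewrite lerBlDr (le_trans h2)// lerDl.
  - rewrite -[X in _ --> X](mulr0 (chi t ^+ 2)) -[X in _ * X](subrr (sqdist t)).
    apply: cvgM; first exact: cvg_cst.
    by apply: cvgB; [exact: cvg_cst|exact: sqdist_cvg].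
  rewrite Rintegral_cst// mul0r => /cvgrPdist_le/(_ _ e2)[N _ /(_ N (leqnn N))] /=.
  by rewrite sub0r normrN => H; exists N; exact: le_trans (ler_norm _) H.
exists N.
pose B M (t : R) := \sum_(k <- cutoff_modes n N) (pcoef M k t - w k t) ^+ 2.
have bpw M k : bmeas D (fun t => (pcoef M k t - w k t) ^+ 2).
  by apply: bmeasX; apply: bmeasB; [exact: bmeas_pcoef|exact: bmeas_wcoef].
have bB M : bmeas D (B M) by apply: bmeas_sum => k; exact: bpw.
have [M BM] : exists M, \int[mu]_(t in D) B M t <= eps / 2.
  have : \sum_(k <- cutoff_modes n N) \int[mu]_(t in D) (w k t - pcoef M k t) ^+ 2
      @[M --> \oo] --> \sum_(k <- cutoff_modes n N) (0 : R).
    apply: cvg_big => [|k _]; first exact: add_continuous.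
    by apply: tproj_cvg => //; exact: bmeas_wcoef.
  rewrite big1// => /cvgrPdist_le/(_ _ e2)[M _ /(_ M (leqnn M))] /=.
  rewrite sub0r normrN => H; exists M; apply: le_trans (le_trans (ler_norm _) H).
  rewrite /B (int_sum mD fD)//; apply: ler_sum => k _.
  rewrite le_eqVlt; apply/orP; left; apply/eqP; apply: int_ext => t _.
  by rewrite -sqrrN opprB.
exists M; rewrite (_ : \int[mu]_(t in D) _ =
    \int[mu]_(t in D) (A N t + B M t)); last first.
  apply: int_ext => t _; rewrite /excess /A /B mulrBr mulr_sumr; congr (_ - _ + _).
  by apply: eq_bigr => k _; rewrite /w exprMn.
rewrite (intD mD fD)//; move: AN BM.
by move: (\int[mu]_(t in D) A N t) (\int[mu]_(t in D) B M t) => x y hx hy; lra.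
Qed.

Variables (lam : R) (N M : nat).
Hypothesis lam0 : 0 < lam.
Local Notation p := (pcoef M).
Local Notation s := (cutoff_modes n N).

(** Dividing by [eigenval R k] applies the inverse Laplacian, which makes the time
    derivative that of a norm of negative order and leaves in the diffusion term
    the plain pairing with [phi]. The second factor [cutoff] makes the test
    function vanish at both ends of the time interval. *)
Definition gcoef k (t : R) : R := lam / eigenval R k * (chi t * p k t).
Definition dgcoef k (t : R) : R :=
  lam / eigenval R k * (chi t * dtproj T M (w k) t + p k t * dchi t).

Lemma is_derive_gcoef k (t : R) : is_derive t 1 (gcoef k) (dgcoef k t).
Proof.
have H := is_deriveM (is_derive_wave 1 (pi / T) 0 t) (is_derive_tproj T M (w k) t).
exact: (@is_deriveZ R R R _ (lam / eigenval R k) t 1 _ H).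
Qed.

Lemma continuous_dgcoef k : continuous (dgcoef k).
Proof.
move=> t; apply: cvgM; first exact: cvg_cst.
apply: cvgD; apply: cvgM.
- exact: continuous_wave.
- exact: continuous_dtproj.
- apply: differentiable_continuous; apply/derivable1_diffP.
  by case: (is_derive_tproj T M (w k) t).
- exact: continuous_wave.
Qed.

Lemma gcoef0 k : gcoef k 0 = 0.
Proof. by rewrite /gcoef cutoff0 mul0r mulr0. Qed.

Lemma gcoefT k : gcoef k T = 0.
Proof. by rewrite /gcoef cutoffT mul0r mulr0. Qed.

Lemma bmeas_gcoef k : bmeas D (gcoef k).
Proof. by apply: bmeasZ; apply: bmeasM => //; exact: bmeas_pcoef. Qed.

Lemma bmeas_dgcoef k : bmeas D (dgcoef k).
Proof.
apply: bmeasZ; apply: bmeasD; first by apply: bmeasM => //; exact: bmeas_dtproj.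
by apply: bmeasM; [exact: bmeas_pcoef|exact: bmeas_wave].
Qed.

Lemma int_dgcoef k : \int[mu]_(t in D) dgcoef k t = 0.
Proof.
apply: (@int_derive0 R (gcoef k) (dgcoef k) 0 T false).
- exact: T0.
- by rewrite gcoef0 gcoefT.
- exact: is_derive_gcoef.
- exact: continuous_dgcoef.
Qed.

Let eig0 k : 0 < eigenval R k.
Proof. exact: lt_le_trans ltr01 (eigenval_ge1 R k). Qed.

Let eigV k : 0 <= lam / eigenval R k <= lam.
Proof.
apply/andP; split; first by rewrite divr_ge0 ?ltW.
by rewrite ler_pdivrMr// ler_peMr ?eigenval_ge1// ltW.
Qed.

(** By [int_mul_dtproj] the derivative of the projection contributes nothing. What
    remains contains the derivative of the cutoff, of order 1 / T, and is
    integrated over a length T: the bound does not depend on T. *)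
Lemma time_term_le :
  \sum_(k <- s) \int[mu]_(t in D) (dgcoef k t * c k t) <= lam * (pi * vol).
Proof.
have E k : \int[mu]_(t in D) (dgcoef k t * c k t) <=
    lam * (pi / T) * \int[mu]_(t in D) c k t ^+ 2.
  have bc := bmeas_mode_coef k; have bp := bmeas_pcoef M k.
  have bd : bmeas D dchi by exact: bmeas_wave.
  have bdp := bmeas_dtproj T M (w k).
  have b1 : bmeas D (fun t => w k t * dtproj T M (w k) t).
    by apply: bmeasM => //; exact: bmeas_wcoef.
  have b2 : bmeas D (fun t => dchi t * (p k t * c k t)).
    by apply: bmeasM => //; exact: bmeasM.
  rewrite (_ : \int[mu]_(t in D) _ = lam / eigenval R k *
      (\int[mu]_(t in D) (w k t * dtproj T M (w k) t) +
       \int[mu]_(t in D) (dchi t * (p k t * c k t)))); last first.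
    rewrite -(intD mD fD)// -(intZ mD fD); last exact: bmeasD.
    by apply: int_ext => t _; rewrite /dgcoef /w; ring.
  rewrite int_mul_dtproj//; last exact: bmeas_wcoef.
  rewrite add0r.
  have P0 : 0 <= pi / T by rewrite divr_ge0 ?pi_ge0 ?ltW.
  have H1 : \int[mu]_(t in D) (dchi t * (p k t * c k t)) <=
      pi / T / 2 * (\int[mu]_(t in D) p k t ^+ 2 + \int[mu]_(t in D) c k t ^+ 2).
    rewrite -(intD mD fD); [|exact: bmeasX|exact: bmeasX].
    have bs : bmeas D (fun t => p k t ^+ 2 + c k t ^+ 2).
      by apply: bmeasD; exact: bmeasX.
    rewrite -(intZ mD fD)//; apply: (int_le mD fD) => //; first exact: bmeasZ.
    move=> t Dt; have := dcutoff_le t; move: P0.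
    move: (pi / T) (dchi t) (p k t) (c k t) => q y x z q0; rewrite ler_norml => /andP[y1 y2].
    have h1 : 0 <= (x - z) ^+ 2 by exact: sqr_ge0.
    have h2 : 0 <= (x + z) ^+ 2 by exact: sqr_ge0.
    have h3 : 0 <= (q - y) * (x + z) ^+ 2 by rewrite mulr_ge0// subr_ge0.
    have h4 : 0 <= (q + y) * (x - z) ^+ 2 by rewrite mulr_ge0// -lerBlDl sub0r.
    (* |y| <= q gives y x z <= q (x^2 + z^2) / 2: expand two nonnegative squares. *)
    have e1 : (q - y) * (x + z) ^+ 2 + (q + y) * (x - z) ^+ 2 =
      4 * (q / 2 * (x ^+ 2 + z ^+ 2) - y * (x * z)) + 0 by field.
    rewrite -subr_ge0 -(pmulr_rge0 (x := 4))// -[X in 0 <= X]addr0 -e1.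
    exact: addr_ge0.
  have H2 : \int[mu]_(t in D) w k t ^+ 2 <= \int[mu]_(t in D) c k t ^+ 2.
    apply: (int_le mD fD); [by apply: bmeasX; exact: bmeas_wcoef|exact: bmeasX|].
    by move=> t _; rewrite /w exprMn ler_piMl ?sqr_ge0// cutoff_sq_le1.
  have H3 := int_pcoef_sq_le M k.
  have C0 : 0 <= \int[mu]_(t in D) c k t ^+ 2 by apply: Rintegral_ge0 => t _; exact: sqr_ge0.
  have /andP[l0 l1] := eigV k.
  have X : \int[mu]_(t in D) (dchi t * (p k t * c k t)) <= pi / T * \int[mu]_(t in D) c k t ^+ 2.
    apply: le_trans H1 _.
    have dbl (q C : R) : q * C = q / 2 * (C + C) by field.
    rewrite [leRHS]dbl; apply: ler_wpM2l; first by rewrite divr_ge0.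
    rewrite lerD2r; exact: le_trans H3 H2.
  apply: (@le_trans _ _ (lam / eigenval R k * (pi / T * \int[mu]_(t in D) c k t ^+ 2))).
    by rewrite ler_wpM2l.
  by rewrite -[leRHS]mulrA ler_wpM2r// mulr_ge0.
apply: (@le_trans _ _ (\sum_(k <- s) lam * (pi / T) * \int[mu]_(t in D) c k t ^+ 2)).
  by apply: ler_sum => k _; exact: E.
rewrite -mulr_sumr -(int_sum mD fD); last by move=> k; apply: bmeasX; exact: bmeas_mode_coef.
have S1 : \int[mu]_(t in D) (\sum_(k <- s) c k t ^+ 2) <= vol * T.
  have -> : vol * T = \int[mu]_(t in D) cst vol t.
    by rewrite Rintegral_cst// [X in _ = _ * fine X](itv_measureE false T0) /= subr0.
  apply: (int_le mD fD); [exact: bmeas_mode_sum|exact: bmeas_cst|].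
  move=> t Dt; apply: le_trans (sqdist_le Dt); apply: mode_coef_sum_le => //.
  exact: (ons_uniq (eigenfun_system R n)).
have -> : lam * (pi * vol) = lam * (pi / T) * (vol * T).
  by field; rewrite gt_eqF.
by rewrite ler_wpM2l// mulr_ge0 ?(ltW lam0)// divr_ge0 ?pi_ge0 ?ltW.
Qed.

(** The gradient costs a factor [eigenval R k], against the two inverse factors in
    [gcoef k t ^ 2]. *)
Lemma mobility_term_le :
  \sum_(k <- s) \int[mu]_(t in D) (gcoef k t ^+ 2 * eigenval R k)
  <= lam ^+ 2 * \int[mu]_(t in D) (chi t ^+ 2 * sqdist t).
Proof.
have E k : \int[mu]_(t in D) (gcoef k t ^+ 2 * eigenval R k) <=
    lam ^+ 2 * \int[mu]_(t in D) w k t ^+ 2.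
  apply: (@le_trans _ _ (lam ^+ 2 * \int[mu]_(t in D) p k t ^+ 2)); last first.
    by rewrite ler_wpM2l ?sqr_ge0//; exact: int_pcoef_sq_le.
  rewrite -(intZ mD fD); last by apply: bmeasX; exact: bmeas_pcoef.
  apply: (int_le mD fD).
  - apply: bmeasM; last exact: bmeas_cst.
    by apply: bmeasX; exact: bmeas_gcoef.
  - by apply: bmeasZ; apply: bmeasX; exact: bmeas_pcoef.
  move=> t _; rewrite /gcoef.
  have -> : (lam / eigenval R k * (chi t * p k t)) ^+ 2 * eigenval R k =
      chi t ^+ 2 * ((eigenval R k)^-1 * (lam ^+ 2 * p k t ^+ 2)).
    by field; rewrite gt_eqF.
  have q0 : 0 <= lam ^+ 2 * p k t ^+ 2 by rewrite mulr_ge0 ?sqr_ge0.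
  have iv : 0 <= (eigenval R k)^-1 by rewrite invr_ge0 ltW.
  apply: (@le_trans _ _ ((eigenval R k)^-1 * (lam ^+ 2 * p k t ^+ 2))).
    by apply: ler_piMl; [exact: mulr_ge0|exact: cutoff_sq_le1].
  by rewrite ler_piMl// invf_le1// eigenval_ge1.
apply: (@le_trans _ _ (\sum_(k <- s) lam ^+ 2 * \int[mu]_(t in D) w k t ^+ 2)).
  by apply: ler_sum => k _; exact: E.
have bw k : bmeas D (fun t => w k t ^+ 2) by apply: bmeasX; exact: bmeas_wcoef.
rewrite -mulr_sumr -(int_sum mD fD)// ler_wpM2l ?sqr_ge0//.
apply: (int_le mD fD).
- exact: bmeas_sum.
- by apply: bmeasM; [exact: bmeasX|exact: bmeas_sqdist].
move=> t Dt; under eq_bigr do rewrite /w exprMn.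
rewrite -mulr_sumr ler_wpM2l ?sqr_ge0//; apply: mode_coef_sum_le => //.
exact: (ons_uniq (eigenfun_system R n)).
Qed.

End trajectory_estimates.

(** * Lower bound of the action *)

Section action_lower_bound.
Variables (R : realType) (n : nat).
Local Notation Rd := 'rV[R]_n.+1.
Local Notation RxRd := (R^o * 'rV[R]_n.+1)%type.
Local Notation Omega := (@Omega R n).
Local Notation idx := {ffun 'I_n.+1 -> nat}.
Local Notation measureRd := {measure set 'rV[R]_n.+1 -> \bar R}.
Local Notation mO := (@measurable_Omega R n).
Local Notation fO := (@Omega_finite R n).
Local Notation ocoef := (coef (leb R n.+1) Omega (@eigenfun R n)).
Local Notation mu := (@lebesgue_measure R).
Local Notation vol := (fine (leb R n.+1 Omega)).
Implicit Types (k : idx).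

Lemma eigenfun_Cb k : Cb_Omega (@eigenfun R n k).
Proof.
split.
- by move=> v u; exact: eigenfun_period.
- have E : space_sum [:: k] (fun=> 1) = @eigenfun R n k.
    by apply/funext => u; rewrite /space_sum big_seq1 mul1r.
  have [_ [c _] _] := space_sum_C2_0 [:: k] (fun=> (1 : R)).
  rewrite -E; apply: continuous_subspaceW c => u /andP[/ltW u0 /ltW u1].
  by rewrite /cOmegaU /= u0 u1.
- have [_ [M HM]] : bmeas (box (fun _ : 'I_n.+1 => [set: R])) (@eigenfun R n k).
    apply: bmeas_tensor => i; first exact: measurable_mode.
    exact: (bmeas_mode i (k i) [set: R]).2.
  by exists M => u _; apply: HM.
Qed.

Variables (a : R) (b rbar : Rd -> R) (T : R).
Hypotheses (ha : - 2^-1 < a) (hb : boundary_density b) (hst : stationary_profile a b rbar).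
Hypothesis T0 : 0 < T.
Variable pi_ : R -> measureRd.
Hypothesis hpi : D_M0 T pi_.
Local Notation D := (`]0, T[%classic : set (measurableTypeR R)).

Definition profile (t : R) (u : Rd) : R := clip (density (pi_ t) u).
Local Notation r := profile.

Lemma density_is_density (t : R) : 0 <= t <= T ->
  is_density (pi_ t) (density (pi_ t)).
Proof. by move=> /(hpi.2 t)[_ [rho Hrho]]; apply: (xgetPex (cst 0)); exists rho. Qed.

Lemma profile_density (t : R) : 0 <= t <= T -> is_density (pi_ t) (r t).
Proof. by move=> /density_is_density /is_density_clip[]. Qed.

Let DT (t : R) : D t -> 0 <= t <= T.
Proof. by rewrite /= in_itv/= => /andP[/ltW -> /ltW ->]. Qed.

Let mr (t : R) : D t -> measurable_fun Omega (r t).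
Proof. by move=> /DT /profile_density[]. Qed.

Let r01 (t : R) : D t -> forall u, Omega u -> 0 <= r t u <= 1.
Proof. by move=> _ u _; exact: clip01. Qed.

Let pairing_profile (t : R) (G : Rd -> R) : 0 <= t <= T -> bmeas Omega G ->
  pairing (pi_ t) G = intO (fun u => r t u * G u).
Proof.
move=> tT bG; apply: pairing_density => //.
- exact: (hpi.2 t tT).1.
- exact: profile_density.
- by move=> u; exact: clip01.
Qed.

(* Weak right continuity is what makes the modes measurable in time. *)
Let mt k : measurable_fun D (fun t => ocoef (r t) k).
Proof.
have : measurable_fun D (fun t => pairing (pi_ t) (eigenfun k)).
  apply: right_continuous_measurable => t tT.
  by have [_ H _] := hpi.1; apply: H => //; exact: eigenfun_Cb.
apply: eq_measurable_fun => t /set_mem /DT tT.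
rewrite pairing_profile//; exact: bmeas_eigenfun.
Qed.

Let mrbar : measurable_fun Omega rbar.
Proof. by have [_ [[m _] _] _] := hst. Qed.

Let rbar01 u : Omega u -> 0 <= rbar u <= 1.
Proof. by have [H _ _] := hst; exact: H. Qed.

Let brbar : bmeas Omega rbar.
Proof. exact: bmeas01. Qed.

Let br (t : R) : D t -> bmeas Omega (r t).
Proof. by move=> Dt; apply: bmeas01; [exact: mr|exact: r01]. Qed.

Let mD := itv_measurable 0 T false.
Let fD := itv_finite false T0.

Lemma excess_profile_small (eps : R) : 0 < eps ->
  exists N M, \int[mu]_(t in D) excess T r rbar N M t <= eps.
Proof. exact: (excess_small T0 mrbar rbar01 mr r01 mt). Qed.

Lemma int_sqdist_avoid (delta : R) : 0 < delta ->
  (forall t, 0 <= t <= T -> ~ L2_ball rbar delta (r t)) ->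
  delta ^+ 2 * (T / 2) <= \int[mu]_(t in D) (cutoff T t ^+ 2 * sqdist r rbar t).
Proof.
move=> d0 avoid.
have bx : bmeas D (fun t => cutoff T t ^+ 2) by apply: bmeasX; exact: bmeas_wave.
rewrite -(int_cutoff_sq T0) -(intZ mD fD)//.
apply: (int_le mD fD); [exact: bmeasZ| |].
  by apply: bmeasM => //; exact: (bmeas_sqdist T0 mrbar rbar01 mr r01 mt).
move=> t Dt; rewrite mulrC ler_wpM2l ?sqr_ge0//.
apply: L2_norm_ge => //; first by apply: bmeasB => //; exact: br.
move=> near_rbar; apply: (avoid t (DT Dt)); split => //; first exact: mr.
by move=> u Ou; exact: r01 Dt _ Ou.
Qed.

Variables (lam : R) (N M : nat).
Hypothesis lam0 : 0 < lam.
Local Notation g := (gcoef T r rbar lam M).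
Local Notation dg := (dgcoef T r rbar lam M).
Local Notation s := (cutoff_modes n N).
Local Notation G := (spacetime_sum g s).
Local Notation c := (mode_coef r rbar).
Local Notation c0 := (ellipticity a).
Local Notation L := (lipschitz a).

Let us : uniq s. Proof. exact: (ons_uniq (eigenfun_system R n)). Qed.

Let g_der k (t : R) : is_derive t 1 (g k) (dg k t).
Proof. exact: is_derive_gcoef. Qed.

Let dg_cont k : continuous (dg k).
Proof. exact: continuous_dgcoef. Qed.

Let bg k : bmeas D (g k).
Proof. exact: bmeas_gcoef. Qed.

Let bdg k : bmeas D (dg k).
Proof. exact: bmeas_dgcoef. Qed.

Let bc k : bmeas D (c k).
Proof. exact: (bmeas_mode_coef mrbar rbar01 mr r01 mt). Qed.

Lemma test_function_C12_0 : C12_0 T G.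
Proof. exact: (spacetime_sum_C12_0 T0 g_der dg_cont). Qed.

Let Dz (t : R) u : D t -> cOmegaU u -> cOmegaU_T T ((t, u) : RxRd).
Proof. by move=> /DT tT uu; split. Qed.

Lemma endpoint_term (m : measureRd) (t : R) : (forall k, g k t = 0) ->
  pairing m (fun u => G (t, u)) = 0.
Proof.
move=> gt; rewrite /pairing (_ : (fun u => _) = cst 0).
  by rewrite Rintegral_cst ?mul0r//; exact: mO.
by apply/funext => u; rewrite /spacetime_sum big1// => k _; rewrite /= gt mul0r.
Qed.

(** The profile may be subtracted from the density, as the coefficients vanish at
    both ends of the time interval. *)
Lemma time_derivative_term :
  int_time T (fun t => pairing (pi_ t) (fun u =>
    der (@cOmegaU_T R n T) (time_vec R n) G (t, u))) =
  \sum_(k <- s) \int[mu]_(t in D) (dg k t * c k t).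
Proof.
rewrite /int_time.
rewrite (_ : \int[mu]_(t in D) _ = \int[mu]_(t in D)
    (\sum_(k <- s) (dg k t * c k t + ocoef rbar k * dg k t))).
  rewrite (int_sum mD fD); last first.
    by move=> k; apply: bmeasD; [exact: bmeasM|exact: bmeasZ].
  apply: eq_bigr => k _; rewrite (intD mD fD); [|exact: bmeasM|exact: bmeasZ].
  by rewrite (intZ mD fD)// (int_dgcoef r rbar T0) mulr0 addr0.
apply: int_ext => t Dt.
have -> : pairing (pi_ t) (fun u => der (@cOmegaU_T R n T) (time_vec R n) G (t, u)) =
    pairing (pi_ t) (fun u => \sum_(k <- s) dg k t * eigenfun k u).
  apply: int_ext => u Ou; apply: (spacetime_sum_dt T0 g_der) => //.
  by apply: Dz => //; exact: Omega_cOmegaU.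
have be k : bmeas Omega (fun u => dg k t * eigenfun k u).
  by apply: bmeasZ; exact: bmeas_eigenfun.
rewrite (pairing_profile (DT Dt)); last exact: bmeas_sum.
rewrite /intO (int_comb_mul (eigenfun_system R n)); last exact: br.
apply: eq_bigr => k _; rewrite [ocoef rbar k * _]mulrC -mulrDr; congr (_ * _).
rewrite /mode_coef (coefB (eigenfun_system R n))//; last exact: br.
by rewrite subrK.
Qed.

(** The stationary equation turns the boundary terms into the diffusion term of the
    profile, so that only a difference of values of [phi] is left in the action. *)
Lemma face_terms :
  (int_time T (fun t => int_face 1 (fun u => phi a (b u) *
     der (@cOmegaU_T R n T) (space_vec R ord0) G (t, u))) -
  int_time T (fun t => int_face (-1) (fun u => phi a (b u) *
     der (@cOmegaU_T R n T) (space_vec R ord0) G (t, u)))) =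
  - \int[mu]_(t in D) (\sum_(k <- s)
      g k t * (eigenval R k * ocoef (fun u => phi a (rbar u)) k)).
Proof.
have F (x : R) : x = 1 \/ x = -1 ->
    int_time T (fun t => int_face x (fun u => phi a (b u) *
      der (@cOmegaU_T R n T) (space_vec R ord0) G (t, u))) =
    \sum_(k <- s) face_flux a b x k * \int[mu]_(t in D) g k t.
  move=> hx; under [RHS]eq_bigr do rewrite -(intZ mD fD)//.
  rewrite -(int_sum mD fD); last by move=> k; exact: bmeasZ.
  apply: int_ext => t Dt.
  rewrite [RHS](eq_bigr (fun k => g k t * face_flux a b x k)); last first.
    by move=> k _; rewrite mulrC.
  rewrite -(int_face_sum (n := n) a hb s (fun k => g k t) hx).
  apply: int_ext => v _; congr (_ * _).
  apply: (spacetime_sum_der g_der); apply: Dz => //.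
  rewrite /cOmegaU /= consr0 /=.
  have h : -1 <= 1 :> R by rewrite (le_trans (lerN10 R)).
  by case: hx => ->; rewrite lexx ?andbT.
apply: etrans.
  exact: (f_equal2 (fun x y => x - y) (F 1 (or_introl erefl)) (F (-1) (or_intror erefl))).
rewrite /=.
rewrite (int_sum mD fD); last by move=> k; apply: bmeasM => //; exact: bmeas_cst.
rewrite -sumrB -sumrN; apply: eq_bigr => k _.
rewrite -mulrBl (stationary_flux hb hst) mulNr; congr (- _).
rewrite mulrC -RintegralZr//; exact: (bmeas_integrable mD fD (bg k)).
Qed.

Let clip_ext (F : R -> R) (t : R) (h : Rd -> R) :
  (forall q : Rd -> R, measurable_fun Omega q -> measurable_fun Omega (fun u => F (q u))) ->
  0 <= t <= T -> measurable_fun Omega h ->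
  intO (fun u => F (density (pi_ t) u) * h u) = intO (fun u => F (r t u) * h u).
Proof.
move=> mF tT mh; have [md _ _] := density_is_density tT.
have [[mcl _ _] E] := is_density_clip (density_is_density tT).
apply: ae_eq_intO.
- by apply: measurable_funM => //; exact: mF.
- by apply: measurable_funM => //; exact: mF.
- by apply: filterS E => u H Ou; rewrite {1}(H Ou).
Qed.

Let mphi (q : Rd -> R) : measurable_fun Omega q -> measurable_fun Omega (fun u => phi a (q u)).
Proof.
move=> mq; rewrite /phi; apply: (measurable_funM mq).
by apply: measurable_funD => //; exact: measurable_funM.
Qed.

Let msigma (q : Rd -> R) : measurable_fun Omega q -> measurable_fun Omega (fun u => sigma a (q u)).
Proof.
move=> mq; rewrite /sigma; apply: measurable_funM.
  apply: measurable_funM; first exact: measurable_funM.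
  exact: measurable_funB.
by apply: measurable_funD => //; exact: measurable_funM.
Qed.

(** A majorant of the diffusion term at time [t], measurable in time, in which the
    term of the profile is kept apart to cancel with [face_terms]. *)
Definition flux_bound (t : R) : R :=
  - lam * (c0 / 2 * (cutoff T t ^+ 2 * sqdist r rbar t)
     - L ^+ 2 / (2 * c0) * excess T r rbar N M t)
  - \sum_(k <- s) g k t * (eigenval R k * ocoef (fun u => phi a (rbar u)) k).

Let bmeas_flux_bound : bmeas D flux_bound.
Proof.
apply: bmeasB; last by apply: bmeas_sum => k; apply: bmeasM => //; exact: bmeas_cst.
apply: bmeasZ; apply: bmeasB; apply: bmeasZ.
  apply: bmeasM; first by apply: bmeasX; exact: bmeas_wave.
  exact: (bmeas_sqdist T0 mrbar rbar01 mr r01 mt).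
exact: (bmeas_excess T0 mrbar rbar01 mr r01 mt).
Qed.

Let diffusion_integrandE (t : R) : D t ->
  intO (fun u => phi a (density (pi_ t) u) *
    laplacian (@cOmegaU_T R n T) (@space_vec R n) G (t, u)) =
  - \sum_(k <- s) g k t * (eigenval R k * ocoef (fun u => phi a (r t u)) k).
Proof.
move=> Dt.
transitivity (intO (fun u => phi a (density (pi_ t) u) *
    \sum_(k <- s) (- (eigenval R k * g k t)) * eigenfun k u)).
  apply: int_ext => u Ou; congr (_ * _).
  rewrite (spacetime_sum_laplacian g_der); last by apply: Dz => //; exact: Omega_cOmegaU.
  by rewrite -sumrN; apply: eq_bigr => k _; rewrite mulNr.
rewrite (clip_ext mphi (DT Dt)); last first.
  by case: (@bmeas_comb _ _ _ _ _ _ _ _ (eigenfun_system R n) s (fun k => - (eigenval R k * g k t))).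
rewrite /intO (int_comb_mul (eigenfun_system R n)); last by apply: bmeas_phi; exact: br.
rewrite -sumrN; apply: eq_bigr => k _.
by rewrite mulNr -mulrA mulrCA.
Qed.

Lemma diffusion_term :
  int_time T (fun t => intO (fun u => phi a (density (pi_ t) u) *
     laplacian (@cOmegaU_T R n T) (@space_vec R n) G (t, u)))
  <= \int[mu]_(t in D) flux_bound t.
Proof.
rewrite /int_time.
rewrite (_ : \int[mu]_(t in D) _ = \int[mu]_(t in D)
    (- \sum_(k <- s) g k t * (eigenval R k * ocoef (fun u => phi a (r t u)) k))); last first.
  by apply: int_ext => t Dt; rewrite diffusion_integrandE.
have [Mg HMg] : exists Mg, forall k (t : R), k \in s -> D t -> `|g k t| <= Mg.
  have [Mf HMf] := choice (fun k => (bg k).2).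
  exists (\sum_(k <- s) `|Mf k|) => k t ks Dt.
  rewrite (le_trans (HMf k t Dt))// (le_trans (ler_norm _))//.
  by rewrite (big_rem k)//= lerDl sumr_ge0.
(* From x^2 <= v to |x| <= 1 + v: the value of the bound is immaterial. *)
pose B := 1 + L ^+ 2 * vol.
have HB k (t : R) : D t -> `|ocoef (fun u => phi a (r t u)) k| <= B.
  move=> Dt; have bp := bmeas_phi a (br Dt).
  have H1 := coef_sq_le k bp.
  have H2 : intO (fun u => phi a (r t u) ^+ 2) <= L ^+ 2 * vol.
    rewrite /intO -Rintegral_cst; last exact: mO.
    apply: (int_le mO fO); [exact: bmeasX|exact: bmeas_cst|] => u Ou.
    have x01 := r01 Dt Ou; have y01 : 0 <= (0 : R) <= 1 by rewrite lexx ler01.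
    have /andP[m0 m1] := slope_bounds a x01 y01.
    have E := phi_subE a (r t u) 0.
    rewrite {2}/phi mul0r !subr0 in E; rewrite E /cst exprMn.
    have mm : (1 + a * (r t u + 0)) ^+ 2 <= L ^+ 2.
      by rewrite lerXn2r ?nnegrE// ?(le_trans (ltW (ellipticity_gt0 ha)) m0)//
        (le_trans ler01 (lipschitz_ge1 a)).
    rewrite -[leRHS]mulr1 ler_pM ?sqr_ge0// expr_le1//; by case/andP: x01.
  have H3 := le_trans H1 H2.
  have V0 : 0 <= L ^+ 2 * vol by rewrite mulr_ge0 ?sqr_ge0// fine_ge0.
  rewrite -ler_sqr ?nnegrE ?normr_ge0 ?addr_ge0// real_normK ?num_real//.
  apply: le_trans H3 _; rewrite /B; move: V0; move: (L ^+ 2 * vol) => v v0; nra.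
apply: (le_Rintegral_any mD fD (M := \sum_(k <- s) Mg * (eigenval R k * B))).
- move=> t Dt; rewrite normrN (le_trans (ler_norm_sum _ _ _))//.
  rewrite big_seq [leRHS]big_seq; apply: ler_sum => k ks.
  have e0 : 0 <= eigenval R k by exact: le_trans ler01 (eigenval_ge1 R k).
  rewrite normrM (normrM (eigenval R k)) (ger0_norm e0); apply: ler_pM; [exact: normr_ge0| |exact: HMg|].
    by apply: mulr_ge0 => //; exact: normr_ge0.
  by rewrite ler_wpM2l// HB.
- exact: bmeas_flux_bound.
move=> t Dt; rewrite /flux_bound -subr_ge0.
have Hst := flux_lower_bound ha (mr Dt) mrbar (r01 Dt) rbar01
  (cutoff T t) (fun k => pcoef T r rbar M k t) us.
have E k : ocoef (fun u => phi a (r t u) - phi a (rbar u)) k =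
    ocoef (fun u => phi a (r t u)) k - ocoef (fun u => phi a (rbar u)) k.
  by rewrite (coefB (eigenfun_system R n))//; apply: bmeas_phi => //; exact: br.
rewrite (_ : _ - _ = lam * (cutoff T t * (\sum_(k <- s) pcoef T r rbar M k t *
      ocoef (fun u => phi a (r t u) - phi a (rbar u)) k) -
    (c0 / 2 * (cutoff T t ^+ 2 * sqdist r rbar t) -
      L ^+ 2 / (2 * c0) * excess T r rbar N M t))).
  by rewrite mulr_ge0 ?(ltW lam0)// subr_ge0.
rewrite [in RHS]mulrBr.
have -> : lam * (cutoff T t * (\sum_(k <- s) pcoef T r rbar M k t *
      ocoef (fun u => phi a (r t u) - phi a (rbar u)) k)) =
    \sum_(k <- s) g k t * (eigenval R k * ocoef (fun u => phi a (r t u)) k) -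
    \sum_(k <- s) g k t * (eigenval R k * ocoef (fun u => phi a (rbar u)) k).
  rewrite -sumrB !mulr_sumr; apply: eq_bigr => k _; rewrite E /gcoef.
  by field; rewrite gt_eqF// (lt_le_trans ltr01)// eigenval_ge1.
by rewrite opprK; ring.
Qed.

Lemma mobility_term :
  int_time T (fun t => intO (fun u => sigma a (density (pi_ t) u) *
    gradient_sq (@cOmegaU_T R n T) (@space_vec R n) G (t, u)))
  <= L * (lam ^+ 2 * \int[mu]_(t in D) (cutoff T t ^+ 2 * sqdist r rbar t)).
Proof.
have L0 : 0 <= L := le_trans ler01 (lipschitz_ge1 a).
pose H (t : R) := L * \sum_(k <- s) g k t ^+ 2 * eigenval R k.
have bge k : bmeas D (fun t => g k t ^+ 2 * eigenval R k).
  by apply: bmeasM; [exact: bmeasX|exact: bmeas_cst].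
have bH : bmeas D H by apply: bmeasZ; exact: bmeas_sum.
have E (t : R) : D t -> 0 <= intO (fun u => sigma a (density (pi_ t) u) *
    gradient_sq (@cOmegaU_T R n T) (@space_vec R n) G (t, u)) <= H t.
  move=> Dt.
  pose q (u : Rd) := \sum_i (\sum_(k <- s) g k t * deigenfun i k u) ^+ 2.
  have bq : bmeas Omega q.
    apply: bmeas_sum => i; apply: bmeasX; apply: bmeas_sum => k; apply: bmeasZ.
    exact: bmeas_deigenfun.
  have q0 u : 0 <= q u by apply: sumr_ge0 => i _; exact: sqr_ge0.
  have -> : intO (fun u => sigma a (density (pi_ t) u) *
      gradient_sq (@cOmegaU_T R n T) (@space_vec R n) G (t, u)) =
      intO (fun u => sigma a (r t u) * q u).
    transitivity (intO (fun u => sigma a (density (pi_ t) u) * q u)).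
      apply: int_ext => u Ou; congr (_ * _); apply: eq_bigr => i _; congr (_ ^+ 2).
      apply: (spacetime_sum_der g_der); apply: Dz => //; exact: Omega_cOmegaU.
    by apply: (clip_ext msigma (DT Dt)); case: bq.
  have sb u : Omega u -> 0 <= sigma a (r t u) <= L.
    by move=> Ou; apply: sigma_bounds => //; exact: r01 Dt _ Ou.
  apply/andP; split.
    by apply: Rintegral_ge0 => u /sb/andP[s0 _]; rewrite mulr_ge0.
  rewrite /H -(int_gradient (fun k => g k t) us) /intO -(intZ mO fO)//.
  apply: (int_le mO fO); [|exact: bmeasZ|].
    apply: bmeasM => //; split; first by apply: msigma; exact: mr.
    by exists L => u /sb/andP[s0 s1]; rewrite ger0_norm.
  by move=> u /sb/andP[s0 s1]; rewrite ler_wpM2r.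
apply: (@le_trans _ _ (\int[mu]_(t in D) H t)).
  have [_ [MH HMH]] := bH.
  apply: (le_Rintegral_any mD fD (M := MH)) => // t Dt; have /andP[h0 h1] := E t Dt.
    by rewrite ger0_norm// (le_trans h1)// (le_trans (ler_norm _))// HMH.
  exact: h1.
rewrite /H (intZ mD fD); last exact: bmeas_sum.
rewrite ler_wpM2l// (int_sum mD fD)//.
exact: (mobility_term_le T0 mrbar rbar01 mr r01 mt).
Qed.

Let int_flux_bound : \int[mu]_(t in D) flux_bound t =
  - (lam * (c0 / 2 * \int[mu]_(t in D) (cutoff T t ^+ 2 * sqdist r rbar t)
     - L ^+ 2 / (2 * c0) * \int[mu]_(t in D) excess T r rbar N M t))
  - \int[mu]_(t in D) (\sum_(k <- s)
      g k t * (eigenval R k * ocoef (fun u => phi a (rbar u)) k)).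
Proof.
have be := bmeas_excess T0 mrbar rbar01 mr r01 mt N M.
have bd := bmeas_sqdist T0 mrbar rbar01 mr r01 mt.
have bx : bmeas D (fun t => cutoff T t ^+ 2 * sqdist r rbar t).
  by apply: bmeasM => //; apply: bmeasX; exact: bmeas_wave.
rewrite /flux_bound (intB mD fD).
- congr (_ - _); rewrite (intZ mD fD) ?mulNr.
    by rewrite (intB mD fD) ?(intZ mD fD)//; exact: bmeasZ.
  by apply: bmeasB; exact: bmeasZ.
- by apply: bmeasZ; apply: bmeasB; exact: bmeasZ.
- by apply: bmeas_sum => k; apply: bmeasM => //; exact: bmeas_cst.
Qed.

(** The endpoint terms vanish with the cutoff, and the flux of the profile cancels
    between [diffusion_term] and [face_terms]. *)
Lemma J_lower_bound :
  ((lam * (c0 / 2 * \int[mu]_(t in D) (cutoff T t ^+ 2 * sqdist r rbar t)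
     - L ^+ 2 / (2 * c0) * \int[mu]_(t in D) excess T r rbar N M t)
   - lam * (pi * vol)
   - 2^-1 * (L * (lam ^+ 2 * \int[mu]_(t in D) (cutoff T t ^+ 2 * sqdist r rbar t))))%:E
  <= J a b T G pi_)%E.
Proof.
have comb (A B X S P F1 F2 Z : R) : A <= P -> B <= - X - F1 -> S <= Z -> F2 = - F1 ->
    X - P - 2^-1 * Z <= 0 - 0 - A - B + F2 - 2^-1 * S.
  by move=> hA hB hS ->; lra.
rewrite /J asboolT// lee_fin.
rewrite (endpoint_term (pi_ T)); last by move=> k; exact: gcoefT.
rewrite (endpoint_term (pi_ 0)); last by move=> k; exact: gcoef0.
rewrite -(addrA _ (int_time T _) (- int_time T _)).
apply: comb.
- rewrite time_derivative_term; exact: (time_term_le T0 mrbar rbar01 mr r01 mt N M lam0).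
- apply: le_trans diffusion_term _; rewrite int_flux_bound; exact: lexx.
- exact: mobility_term.
- exact: face_terms.
Qed.

End action_lower_bound.

(** * Choice of the constants *)

(** With lam = c0 / (2 L) the mobility consumes half of the coercive term
    c0 X / 2. The bound on X makes the other half at least v + 2, of which v pays
    for the cutoff and 1 for the excess. *)
Lemma action_constants (R : realType) (a delta v X E : R) :
  - 2^-1 < a -> 0 < delta ->
  let c0 := ellipticity a in let L := lipschitz a in let lam := c0 / (2 * L) in
  delta ^+ 2 * (8 * (v + 2) / (c0 * delta ^+ 2) / 2) <= X ->
  E <= 2 * c0 / L ^+ 2 ->
  lam <= lam * (c0 / 2 * X - L ^+ 2 / (2 * c0) * E) - lam * v
         - 2^-1 * (L * (lam ^+ 2 * X)).
Proof.
move=> ha d0 /=; have := ellipticity_gt0 ha; have := lipschitz_ge1 a.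
move: (ellipticity a) (lipschitz a) => c0 L L1 c00.
have L0 : 0 < L := lt_le_trans ltr01 L1.
rewrite (_ : delta ^+ 2 * _ = 4 * (v + 2) / c0); last first.
  by field; rewrite !gt_eqF.
rewrite ler_pdivrMr// => hX hE.
have hE' : L ^+ 2 / (2 * c0) * E <= 1.
  rewrite [leRHS](_ : 1 = L ^+ 2 / (2 * c0) * (2 * c0 / L ^+ 2)); last first.
    by field; rewrite !gt_eqF.
  by rewrite ler_wpM2l// divr_ge0// ?sqr_ge0// mulr_ge0// ltW.
have lam0 : 0 < c0 / (2 * L) by rewrite divr_gt0// mulr_gt0.
rewrite [leRHS](_ : _ = c0 / (2 * L) *
    (X * c0 / 4 - L ^+ 2 / (2 * c0) * E - v)); last by field; rewrite !gt_eqF.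
by rewrite ler_peMr// ?(ltW lam0)//; lra.
Qed.

Theorem lemma4p5 (R : realType) (n : nat) (a : R) (b : 'rV[R]_n.+1 -> R)
    (rhobar : 'rV[R]_n.+1 -> R) :
  - 2^-1 < a -> boundary_density b -> stationary_profile a b rhobar ->
  forall delta : R, 0 < delta ->
  exists T : R, 0 < T /\
    (0 < ereal_inf [set I_T a b T pi | pi in D_avoid T (L2_ball rhobar delta)])%E.
Proof.
move=> ha hb hst delta d0.
have c00 := ellipticity_gt0 ha.
have L0 : 0 < lipschitz a := lt_le_trans ltr01 (lipschitz_ge1 a).
pose v := pi * fine (leb R n.+1 (@Omega R n)).
have v0 : 0 <= v by rewrite mulr_ge0 ?pi_ge0// fine_ge0.
pose T := 8 * (v + 2) / (ellipticity a * delta ^+ 2).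
pose lam := ellipticity a / (2 * lipschitz a).
have T0 : 0 < T.
  by rewrite divr_gt0// ?mulr_gt0// ?exprn_gt0// ltr_wpDl.
have lam0 : 0 < lam by rewrite divr_gt0// mulr_gt0.
exists T; split; first exact: T0.
apply: (@lt_le_trans _ _ lam%:E); first by rewrite lte_fin.
apply/ereal_infP => _ [pi_ [hpi avoid] <-].
rewrite /I_T; case: ifPn => _; last exact: leey.
have eps0 : 0 < 2 * ellipticity a / lipschitz a ^+ 2.
  by rewrite divr_gt0 ?mulr_gt0// exprn_gt0.
have [N [M hE]] := excess_profile_small hst T0 hpi eps0.
have hX := int_sqdist_avoid hst T0 hpi d0
  (fun t tT => avoid t tT _ (profile_density hpi tT)).
apply: le_trans (ereal_sup_ubound _); last first.
  by eexists; [exact: (test_function_C12_0 rhobar T0 pi_ lam N M)|reflexivity].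
apply: le_trans (J_lower_bound ha hb hst T0 hpi N M lam0).
rewrite lee_fin; exact: (action_constants ha d0 hX hE).
Qed.
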